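(* Let $d\ge1$, $\lambda>0$, and let $$u_0(x)=b_0\exp\Big(-\frac12\sum_{j=1}^d a_{0j}(x_j-x_{0j})^2\Big),\qquad x\in\mathbb R^d,$$ with $b_0\in\mathbb C\setminus\{0\}$, $a_{0j}\in\mathbb C$, $\operatorname{Re}a_{0j}>0$ and $x_{0j}\in\mathbb R$ for $1\le j\le d$. Let $u\in L^\infty_{\rm loc}(\mathbb R;\Sigma)$ be the unique global solution to $$ i\partial_t u+\tfrac12\Delta u=\lambda \ln(|u|^2)\,u,\qquad u_{\mid t=0}=u_0 ,$$ and define $v=v(t,y)$, $t\ge0$, $y\in\mathbb R^d$, by $$u(t,x)=\frac{1}{\tau(t)^{d/2}}\,v\!\left(t,\frac{x}{\tau(t)}\right)\frac{\|u_0\|_{L^2(\mathbb R^d)}}{\|\gamma\|_{L^2(\mathbb R^d)}}\exp\!\left(i\frac{\dot\tau(t)}{\tau(t)}\frac{|x|^2}{2}\right).$$ Then the relative entropy of $|v|^2$ goes to zero for large time, $$\int_{\mathbb R^d}|v(t,y)|^2\ln\left|\frac{v(t,y)}{\gamma(y)}\right|^2dy\longrightarrow0\quad\text{as }t\to\infty,$$ and the convergence of $|v|^2$ to $\gamma^2$ is strong in $L^1$: $$\big\||v(t,\cdot)|^2-\gamma^2\big\|_{L^1(\mathbb R^d)}\longrightarrow0\quad\text{as }t\to\infty.$$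
   Context: $\Sigma=\{f\in H^1(\mathbb R^d):\ x\mapsto|x|f(x)\in L^2(\mathbb R^d)\}$, and $\gamma(x)=e^{-|x|^2/2}$ on $\mathbb R^d$. The function $\tau$ is the unique (positive) solution on $[0,\infty)$ of $\ddot\tau=\frac{2\lambda}{\tau}$, $\tau(0)=1$, $\dot\tau(0)=0$. The convention $z\ln|z|^2=0$ at $z=0$ is used. For every $u_0\in\Sigma$ the Cauchy problem has a unique global solution in $L^\infty_{\rm loc}(\mathbb R;\Sigma)$ (in the sense of distributions, and continuous in time with values in $L^2$). *)

(* Defs.v *)
From HB Require Import structures.
From mathcomp Require Import all_boot all_order all_algebra.
From mathcomp Require Import all_classical all_reals all_analysis.
From mathcomp Require Export complex.

Set Implicit Arguments.
Unset Strict Implicit.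
Unset Printing Implicit Defensive.

Import Order.TTheory GRing.Theory Num.Theory.
Import numFieldTopology.Exports numFieldNormedType.Exports.

Local Open Scope classical_set_scope.
Local Open Scope ring_scope.

Definition rV_display : measure_display. Proof. by []. Qed.

Section measurable_rV.
Context {R : realType} {n : nat}.

Definition rV_coord (i : 'I_n) (x : 'rV[R]_n) : measurableTypeR R := x 0 i.

Let rV_set0 : g_sigma_preimage rV_coord set0.
Proof. exact: sigma_algebra0. Qed.

Let rV_setC A : g_sigma_preimage rV_coord A -> g_sigma_preimage rV_coord (~` A).
Proof. exact: sigma_algebraC. Qed.

Let rV_bigcup (F : _^nat) : (forall i, g_sigma_preimage rV_coord (F i)) ->
  g_sigma_preimage rV_coord (\bigcup_i (F i)).
Proof. exact: sigma_algebra_bigcup. Qed.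

HB.instance Definition _ := @isMeasurable.Build rV_display 'rV[R]_n
  (g_sigma_preimage rV_coord) rV_set0 rV_setC rV_bigcup.

End measurable_rV.

Section measurable_rV_fun.
Context (R : realType).

Lemma measurable_fun_rVP d (T : measurableType d) n (f : T -> 'rV[R]_n) :
  measurable_fun [set: T] f <-> forall i, measurable_fun [set: T] (fun x => f x 0 i).
Proof.
apply: (@iff_trans _ (g_sigma_preimage
    (fun i => rV_coord i \o f) `<=` measurable)).
  rewrite g_sigma_preimage_comp; split=> [mf A [/= C preC <-]|prefS].
    exact: mf.
  by move=> _ A mA; apply: prefS; exists A.
split=> [cfS i|mf].
- move=> _ A mA; apply: cfS; apply: sub_sigma_algebra.
  case: n i => [[] []//|n i] in f *.
  rewrite -bigcup_mkord_ord; exists i; first exact: ltn_ord.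
  by exists A => //; rewrite inord_val.
- apply: smallest_sub; first exact: sigma_algebra_measurable.
  case: n => [|n] in f mf *; first by rewrite big_ord0.
  rewrite -bigcup_mkord_ord; apply: bigcup_sub => i Ii.
  by move=> A [B mB <-]; exact: mf.
Qed.

Definition rV_cons n (p : measurableTypeR R * 'rV[R]_n) : 'rV[R]_n.+1 :=
  \row_j (if unlift ord0 j is Some k then p.2 0 k else p.1).

Definition rV_uncons n (x : 'rV[R]_n.+1) : measurableTypeR R * 'rV[R]_n :=
  (x 0 0, \row_j x 0 (lift ord0 j)).

Lemma rV_consK n : cancel (@rV_cons n) (@rV_uncons n).
Proof.
move=> [a y]; congr pair; first by rewrite !mxE unlift_none.
by apply/rowP => j; rewrite !mxE liftK.
Qed.

Lemma measurable_rV_coord n (i : 'I_n) :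
  measurable_fun [set: 'rV[R]_n] (fun x : 'rV[R]_n => x 0 i).
Proof. by move: i; apply/measurable_fun_rVP/measurable_id. Qed.

Lemma measurable_rV_cons n : measurable_fun setT (@rV_cons n).
Proof.
apply/measurable_fun_rVP => i; rewrite /rV_cons.
have [k ->|->] := unliftP ord0 i.
- under eq_fun do rewrite mxE liftK.
  exact: (measurableT_comp (measurable_rV_coord k) measurable_snd).
- under eq_fun do rewrite mxE unlift_none.
  exact: measurable_fst.
Qed.

Lemma measurable_rV_uncons n : measurable_fun setT (@rV_uncons n).
Proof.
apply: measurable_fun_pair; first exact: measurable_rV_coord.
apply/measurable_fun_rVP => i; under eq_fun do rewrite mxE.
exact: measurable_rV_coord.
Qed.

Section cons_measure.
Variables (n : nat) (m : {sigma_finite_measure set 'rV[R]_n -> \bar R}).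

Definition cons_measure : set 'rV[R]_n.+1 -> \bar R :=
  pushforward (lebesgue_measure \x m)%E (@rV_cons n).

Let mcons A : measurable A -> measurable (@rV_cons n @^-1` A).
Proof. by move=> mA; rewrite -[X in measurable X]setTI; exact: measurable_rV_cons. Qed.

Let cons0 : cons_measure set0 = 0%E.
Proof. by rewrite /cons_measure /pushforward preimage_set0 measure0. Qed.

Let cons_ge0 A : (0 <= cons_measure A)%E.
Proof. by rewrite /cons_measure /pushforward. Qed.

Let cons_sigma_additive : semi_sigma_additive cons_measure.
Proof.
move=> F mF tF mUF; rewrite /cons_measure /pushforward preimage_bigcup.
apply: measure_semi_sigma_additive.
- by move=> k; exact: mcons.
- apply/trivIsetP => /= i j _ _ ij; rewrite -preimage_setI.
  by move/trivIsetP : tF => /(_ _ _ _ _ ij) ->//; rewrite preimage_set0.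
- by rewrite -preimage_bigcup; exact: mcons.
Qed.

HB.instance Definition _ := isMeasure.Build _ _ _ cons_measure
  cons0 cons_ge0 cons_sigma_additive.

Let cons_sigma_finite : sigma_finite setT cons_measure.
Proof.
have /sigma_finiteP[F [TF ndF Foo]] := sigma_finiteT (@lebesgue_measure R).
have /sigma_finiteP[G [TG ndG Goo]] := sigma_finiteT m.
exists (fun k => @rV_uncons n @^-1` (F k `*` G k)).
  apply/seteqP; split=> // x _.
  have : [set: measurableTypeR R] (rV_uncons x).1 by [].
  have : [set: 'rV[R]_n] (rV_uncons x).2 by [].
  rewrite TF TG => -[k _ Gk] [l _ Fl]; exists (maxn k l) => //; split => /=.
  - by move: Fl; exact/subsetPset/ndF/leq_maxr.
  - by move: Gk; exact/subsetPset/ndG/leq_maxl.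
move=> k; have [mF Fk] := Foo k; have [mG Gk] := Goo k; split.
  rewrite -[X in measurable X]setTI; apply: measurable_rV_uncons => //.
  exact: measurableX.
rewrite /cons_measure /pushforward (_ : _ @^-1` _ = F k `*` G k).
  by rewrite product_measure1E// lte_mul_pinfty// ge0_fin_numE.
rewrite -comp_preimage (_ : @rV_uncons n \o @rV_cons n = id) ?preimage_id//.
by apply/funext => x; exact: rV_consK.
Qed.

HB.instance Definition _ :=
  Measure_isSigmaFinite.Build _ _ _ cons_measure cons_sigma_finite.

End cons_measure.

End measurable_rV_fun.

(* dx_0 (x) ... (x) dx_(n-1), the factors being added one coordinate at a time. *)
Fixpoint lebesgue_rV (R : realType) (n : nat) :
    {sigma_finite_measure set 'rV[R]_n -> \bar R} :=
  if n is n'.+1 then cons_measure (lebesgue_rV R n') else \d_(0 : 'rV[R]_0).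

Lemma lebesgue_rV_box (R : realType) (n : nat)
    (A : 'I_n -> set (measurableTypeR R)) : (forall i, measurable (A i)) ->
  lebesgue_rV R n [set x : 'rV[R]_n | forall i, A i (x 0 i)] =
  (\prod_(i < n) lebesgue_measure (A i))%E.
Proof.
elim: n A => [|n IHn] A mA /=.
  rewrite big_ord0 /= diracE mem_set//.
  by case.
rewrite big_ord_recl -IHn; last by move=> i; exact: mA.
rewrite /cons_measure /pushforward.
pose B := [set x : 'rV[R]_n | forall i, A (lift ord0 i) (x 0 i)].
have mB : measurable B.
  rewrite [X in measurable X](_ : _ =
      \bigcap_(i in [set: 'I_n]) ((fun x : 'rV[R]_n => x 0 i) @^-1` A (lift ord0 i))).
    apply: fin_bigcap_measurable => [|i _]; first exact: finite_finset.
    rewrite -[X in measurable X]setTI.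
    by apply: measurable_rV_coord => //; exact: mA.
  by apply/seteqP; split=> [x Bx i _|x Bx i]; [exact: Bx|exact: (Bx i I)].
rewrite (_ : _ @^-1` _ = A ord0 `*` B); first by rewrite product_measure1E.
apply/seteqP; split=> -[a y] /=.
  move=> H; split; first by have := H ord0; rewrite mxE unlift_none.
  by move=> i; have := H (lift ord0 i); rewrite mxE liftK.
move=> [Aa By] i; rewrite mxE.
by have [k ->|->] := unliftP ord0 i; rewrite ?liftK ?unlift_none//; exact: By.
Qed.

Notation normc := ComplexField.Normc.normc.

Section complex_functions.
Context (R : realType) d (T : measurableType d).
Variable mu : {measure set T -> \bar R}.
Implicit Types f : T -> R[i].

Definition cmeasurable f :=
  measurable_fun [set: T] (fun x => complex.Re (f x)) /\
  measurable_fun [set: T] (fun x => complex.Im (f x)).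

Definition cintegral f : R[i] :=
  Complex (\int[mu]_x complex.Re (f x)) (\int[mu]_x complex.Im (f x)).

Definition L2norm f : \bar R :=
  ('N[mu]_(2%:E)[(fun x => (normc (f x))%:E)])%E.

Definition in_L2 f := cmeasurable f /\ (L2norm f < +oo)%E.

End complex_functions.

Definition cexp (R : realType) (z : R[i]) : R[i] :=
  ((expR (complex.Re z))%:C * (cos (complex.Im z) +i* sin (complex.Im z)))%C.

Section test_functions.
Context (R : realType) (V : normedModType R).
Implicit Types phi : V -> R.

Definition iter_derive (vs : seq V) phi : V -> R :=
  foldr (fun v g => (fun x => 'D_v g x)) phi vs.

(* On a finite-dimensional V this is C^oo: every iterated directional
   derivative exists and is continuous. *)
Definition smooth phi := forall vs : seq V,
  continuous (iter_derive vs phi) /\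
  forall x v, derivable (iter_derive vs phi) x v.

Definition test_function phi := smooth phi /\
  exists2 K : set V, compact K & forall x, ~ K x -> phi x = 0.

End test_functions.

Section log_schrodinger.
Context (R : realType) (n : nat).
Local Notation Rn := 'rV[R]_n.
Local Notation leb := (lebesgue_rV R n).
Local Notation leb_tx := ((@lebesgue_measure R \x leb)%E).
Implicit Types (f g : Rn -> R[i]) (phi : R * Rn -> R).

(* The library norm on row vectors is the sup norm; |x| is the Euclidean one. *)
Definition sqr_eucl (x : Rn) : R := \sum_(j < n) x 0 j ^+ 2.

Definition unit_vec (j : 'I_n) : Rn := delta_mx 0 j.

Definition gaussian (x : Rn) : R := expR (- (sqr_eucl x / 2)).

Definition weight f : Rn -> R[i] :=
  fun x => ((Num.sqrt (sqr_eucl x))%:C)%C * f x.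

Definition weak_partial (j : 'I_n) f g :=
  forall psi : Rn -> R, test_function psi ->
    cintegral leb (fun x => f x * (('D_(unit_vec j) psi x)%:C)%C) =
    - cintegral leb (fun x => g x * ((psi x)%:C)%C).

Definition weak_gradient f (G : 'I_n -> Rn -> R[i]) :=
  forall j, in_L2 leb (G j) /\ weak_partial j f (G j).

Definition in_H1 f := in_L2 leb f /\ exists G, weak_gradient f G.

Definition in_Sigma f := in_H1 f /\ in_L2 leb (weight f).

(* ||f||_Sigma^2 = ||f||^2 + ||grad f||^2 + || |x| f ||^2; the weak gradient is
   unique almost everywhere, so the choice of G is immaterial. *)
Definition Sigma_sqnorm_le f (M : R) := exists2 G, weak_gradient f G &
  (L2norm leb f ^+ 2 + \sum_(j < n) L2norm leb (G j) ^+ 2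
    + L2norm leb (weight f) ^+ 2 <= M%:E)%E.

Implicit Type u : R -> Rn -> R[i].

Definition Linfty_loc_Sigma u :=
  cmeasurable (fun p : measurableTypeR R * Rn => u p.1 p.2) /\
  forall T : R, exists M : R, {ae @lebesgue_measure R, forall t : R,
    `|t| <= T -> in_Sigma (u t) /\ Sigma_sqnorm_le (u t) M}.

Definition continuous_L2 u := (forall t, in_L2 leb (u t)) /\
  forall t0 : R,
    L2norm leb (fun x => u t x - u t0 x) @[t --> t0] --> 0%E.

Definition dt phi : R * Rn -> R := fun p => 'D_((1, 0) : R * Rn) phi p.

Definition dx (j : 'I_n) phi : R * Rn -> R :=
  fun p => 'D_((0, unit_vec j) : R * Rn) phi p.

Definition laplacian phi : R * Rn -> R :=
  fun p => \sum_(j < n) dx j (dx j phi) p.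

(* i u_t + (1/2) Delta u = lam ln(|u|^2) u in D'(R x R^n). Real-valued test
   functions suffice by complex linearity, and ln 0 = 0 in the library. *)
Definition logNLS (lam : R) u := forall phi, test_function phi ->
  cintegral leb_tx (fun p => u p.1 p.2 *
    (- ((0 +i* 1) * (dt phi p)%:C) + (2^-1 * laplacian phi p)%:C)%C) =
  cintegral leb_tx (fun p => ((lam * ln (normc (u p.1 p.2) ^+ 2))%:C)%C
    * u p.1 p.2 * ((phi p)%:C)%C).

Definition logNLS_solution (lam : R) (u0 : Rn -> R[i]) u :=
  [/\ Linfty_loc_Sigma u, continuous_L2 u, logNLS lam u &
      {ae leb, forall x, u 0 x = u0 x}].

Definition unique_logNLS_solution (lam : R) (u0 : Rn -> R[i]) u :=
  logNLS_solution lam u0 u /\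
  forall w, logNLS_solution lam u0 w ->
    forall t, {ae leb, forall x, w t x = u t x}.

End log_schrodinger.

Section dispersion.
Context (R : realType).

(* df is the derivative of f on [0, +oo[, one-sided at 0. *)
Definition deriv_halfline (f df : R -> R) := forall t, 0 <= t ->
  (s - t)^-1 * (f s - f t) @[s --> within `[0, +oo[ t^'] --> df t.

Definition is_tau (lam : R) (tau dtau : R -> R) :=
  [/\ tau 0 = 1, dtau 0 = 0, (forall t, 0 <= t -> 0 < tau t),
      deriv_halfline tau dtau &
      deriv_halfline dtau (fun t => 2 * lam / tau t)].

End dispersion.

(* Main.v *)
(* The ansatz of a product of Gaussians
   exp (amp - sum_j (x_j - x0_j)^2 / (2 s_j^2) + i (th + sum_j (s_j' / s_j) (x_j - x0_j)^2 / 2))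
   turns the equation into the decoupled system s_j'' = 1 / s_j^3 + 2 lam / s_j, plus
   a quadrature for the global phase th.  The system has global positive solutions by
   conservation of energy, so by uniqueness u is this wave and |v(t, .)|^2 is an explicit
   Gaussian with widths s_j / tau and centers x0_j / tau.  Solutions of
   s'' = kap / s^3 + 2 lam / s tend to infinity and are equivalent to one another for
   all kap >= 0 and all initial data; tau is the case kap = 0.  Hence the widths tend
   to 1 and the centers to 0, and both limits follow by dominated convergence. *)

Require Import Defs.
From HB Require Import structures.
From mathcomp Require Import all_boot all_order all_algebra.
From mathcomp Require Import all_classical all_reals all_analysis.
From mathcomp Require Import measurable_realfun complex ring lra.

Set Implicit Arguments.
Unset Strict Implicit.
Unset Printing Implicit Defensive.

Import Order.TTheory GRing.Theory Num.Theory.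
Import numFieldTopology.Exports numFieldNormedType.Exports.

Local Open Scope classical_set_scope.
Local Open Scope ring_scope.

(** * Ordinary differential equations *)

(** Since [u] is identified with the explicit wave by the uniqueness hypothesis alone, the wave must
    be a solution in the full sense required there: weakly on all of [R x R^n], locally bounded in
    [Sigma], continuous in [L^2]. Hence the width equations are solved for negative times too, and
    one Gaussian envelope, uniform for [|t| <= T], supplies all the integrability. With
    [a_j = s_j^-2 - i s_j' / s_j] as complex coefficients, the equation becomes
    [i a_j' = a_j^2 + 2 lam Re a_j]; the unknown [s_j] linearises the quadratic part of this Riccati
    system into the second-order equation of the overview. The equivalence of two solutions rests on
    the energy: [s'^2] is [4 lam ln s] plus a bounded remainder, and only the remainder contains
    [kap] and the data. The comparison is made on [ln s - ln (ln s) / 2 - ln t], so no expansion of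
    [s] in terms of [t] is ever inverted. Uniqueness yields equality only for almost every [x] at
    each [t]; null sets are therefore carried through the scaling [x = tau y], and [v] is known only
    through its modulus almost everywhere. *)

Section derivation_rules.
Context {R : realType} {V : normedModType R}.
Implicit Types (f g : V -> R) (x v : V).

(** Lets the rules below produce a derivative in whatever shape they yield; matching it with the
    wanted value is left to [ring] or [field]. *)
Lemma der_eq f x v a b : is_derive x v f a -> a = b -> is_derive x v f b.
Proof. by move=> h <-. Qed.

Lemma der_cst (c : R) x v : is_derive x v (fun=> c) (0 : R).
Proof. exact: is_derive_cst. Qed.

Lemma derD f g x v a b : is_derive x v f a -> is_derive x v g b ->
  is_derive x v (fun y => f y + g y) (a + b).
Proof. by move=> ? ?; exact: is_deriveD. Qed.

Lemma derN f x v a : is_derive x v f a -> is_derive x v (fun y => - f y) (- a).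
Proof. by move=> ?; exact: is_deriveN. Qed.

Lemma derB f g x v a b : is_derive x v f a -> is_derive x v g b ->
  is_derive x v (fun y => f y - g y) (a - b).
Proof. by move=> ? ?; exact: is_deriveB. Qed.

Lemma derM f g x v a b : is_derive x v f a -> is_derive x v g b ->
  is_derive x v (fun y => f y * g y) (a * g x + f x * b).
Proof.
move=> fa gb; apply: (der_eq (is_deriveM fa gb)).
by rewrite /GRing.scale/= addrC mulrC [f x * b]mulrC mulrC.
Qed.

Lemma derMl k f x v a : is_derive x v f a ->
  is_derive x v (fun y => k * f y) (k * a).
Proof. by move=> ?; exact: is_deriveZ. Qed.

Lemma derMr k f x v a : is_derive x v f a ->
  is_derive x v (fun y => f y * k) (a * k).
Proof.
move=> fa; under eq_fun do rewrite mulrC.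
by rewrite mulrC; exact: derMl.
Qed.

Lemma derX2 f x v a : is_derive x v f a ->
  is_derive x v (fun y => f y ^+ 2) (2 * f x * a).
Proof.
move=> df; under eq_fun do rewrite expr2.
by apply: der_eq (derM df df) _; ring.
Qed.

Lemma der_sum n (h : 'I_n -> V -> R) (dh : 'I_n -> R) x v :
  (forall i, is_derive x v (h i) (dh i)) ->
  is_derive x v (fun y => \sum_(i < n) h i y) (\sum_(i < n) dh i).
Proof.
move=> hd; rewrite (_ : (fun y => _) = \sum_(i < n) h i); last first.
  by apply/funext => y; rewrite fct_sumE.
exact: is_derive_sum.
Qed.

(** Both sides are limits of the same difference quotient. This moves one-variable rules to
    directional derivatives, and compares derivatives on different spaces when the restrictions to a
    line agree. *)
Lemma is_derive_line f x v a :
  is_derive x v f a <-> is_derive (0 : R) 1 (fun h : R => f (h *: v + x)) a.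
Proof.
have e : (fun h : R => h^-1 *: ((f \o shift x) (h *: v) - f x)) =
    (fun h => h^-1 *: (((fun h : R => f (h *: v + x)) \o shift (0 : R)) (h *: (1 : R)) -
      f (0 *: v + x))).
  by apply/funext => h /=; rewrite scale0r add0r addr0 /GRing.scale/= mulr1.
by split=> -[df dfE]; apply: DeriveDef;
  rewrite /derivable /derive in df dfE *; rewrite ?e// -?e.
Qed.

Lemma der_comp f (h : R -> R) x v a b : is_derive (f x) 1 h b ->
  is_derive x v f a -> is_derive x v (fun y => h (f y)) (b * a).
Proof.
move=> hb /is_derive_line fa; apply/is_derive_line.
apply: (@is_derive1_comp R h (fun t => f (t *: v + x)) 0 b a) => //.
by rewrite scale0r add0r.
Qed.

Lemma derV f x v a : f x != 0 -> is_derive x v f a ->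
  is_derive x v (fun y => (f y)^-1) (- a / f x ^+ 2).
Proof.
move=> fx0 fa; have idf : is_derive (f x) (1:R) id (1:R) by exact: is_derive_id.
have := @is_deriveV R id (f x) 1 1 fx0 idf.
move=> /der_comp -/(_ _ _ fa) h; apply: der_eq h _.
by rewrite /GRing.scale/= mulr1 mulrC mulNr mulrN.
Qed.

Lemma der_expR f x v a : is_derive x v f a ->
  is_derive x v (fun y => expR (f y)) (expR (f x) * a).
Proof. by move=> ?; exact: (der_comp (is_derive_expR (f x))). Qed.

Lemma der_ln f x v a : 0 < f x -> is_derive x v f a ->
  is_derive x v (fun y => ln (f y)) (a / f x).
Proof. by move=> f0 ?; rewrite mulrC; exact: (der_comp (is_derive1_ln f0)). Qed.

Lemma der_cos f x v a : is_derive x v f a ->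
  is_derive x v (fun y => cos (f y)) (- sin (f x) * a).
Proof. by move=> ?; exact: (der_comp (is_derive_cos (f x))). Qed.

Lemma der_sin f x v a : is_derive x v f a ->
  is_derive x v (fun y => sin (f y)) (cos (f x) * a).
Proof. by move=> ?; exact: (der_comp (is_derive_sin (f x))). Qed.

End derivation_rules.

Section one_variable.
Context {R : realType}.
Implicit Types f g : R -> R.

Lemma der_continuous f (x a : R) : is_derive x 1 f a -> {for x, continuous f}.
Proof.
by move=> [df _]; apply: differentiable_continuous; exact/derivable1_diffP.
Qed.

Lemma mean_value f (df : R -> R) (a b : R) : a <= b ->
  (forall x, a <= x <= b -> is_derive x 1 f (df x)) ->
  exists2 c, a <= c <= b & f b - f a = df c * (b - a).
Proof.
move=> ab fdf; have [||c cab ->] := @MVT_segment R f df a b ab.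
- by move=> x; rewrite in_itv/= => /andP[/ltW ? /ltW ?]; apply: fdf; apply/andP.
- apply: derivable_within_continuous => x; rewrite in_itv/= => xab.
  by have [] := fdf x xab.
- by exists c => //; move: cab; rewrite in_itv.
Qed.

Lemma der_ge0_le f (df : R -> R) (a b : R) : a <= b ->
  (forall x, a <= x <= b -> is_derive x 1 f (df x)) ->
  (forall x, a <= x <= b -> 0 <= df x) -> f a <= f b.
Proof.
move=> ab fdf df0; have [c cab] := mean_value ab fdf.
by move=> e; rewrite -subr_ge0 e mulr_ge0 ?df0 ?subr_ge0.
Qed.

Lemma der0_eq f (a b : R) : a <= b ->
  (forall x, a <= x <= b -> is_derive x 1 f 0) -> f b = f a.
Proof.
move=> ab /(mean_value ab)[c _]; rewrite mul0r => /eqP.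
by rewrite subr_eq0 => /eqP.
Qed.

(** The fundamental theorem differentiates [G a] only to the right of [a], while the derivative is
    wanted on the whole line. The base point therefore slides to the left of both [t] and 0, and
    subtracting the value at 0 removes the dependence on it. *)
Lemma antiderivative f : continuous f ->
  exists2 F : R -> R, F 0 = 0 & forall t : R, is_derive t 1 F (f t).
Proof.
move=> cf; pose mu := @lebesgue_measure R.
pose G (a x : R) := (\int[mu]_(t in `[a, x]) f t)%R.
have intf (a b : R) : mu.-integrable `[a, b] (EFin \o f).
  apply: continuous_compact_integrable; first exact: segment_compact.
  exact: continuous_subspaceT.
have dG (a x : R) : a < x -> is_derive x 1 (G a) (f x).
  move=> ax; have x1 : x < x + 1 by rewrite ltrDl.
  have [dG <-] := continuous_FTC1_closed x1 (intf a (x + 1)) ax (cf x).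
  by rewrite derive1E; exact: derivableP.
have GB (a' a t : R) : a' <= a -> a < 0 -> a < t ->
    G a' t - G a' 0 = G a t - G a 0.
  move=> a'a a0 at0.
  have h (b : R) : a < b -> G a' b = G a' a + G a b.
    move=> ab; apply/eqP; rewrite addrC -subr_eq; apply/eqP.
    rewrite /G Rintegral_itvB ?bnd_simp//; last exact: ltW.
    rewrite Rintegral_itv_obnd_cbnd//.
    by apply: integrableS (intf a b) => //; exact: subset_itv_oc_cc.
  by rewrite (h t)// (h 0)// opprD addrACA subrr add0r.
pose F t := G (- (`|t| + 1)) t - G (- (`|t| + 1)) 0.
exists F; first by rewrite /F subrr.
(* For [x] near [t] the sliding base point [- (|x| + 1)] stays to the right of [a], so the fixed
   base point [a] gives the same function there. *)
move=> t; pose a := - (`|t| + 2).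
have at0 : a < t.
  by rewrite /a ltrNl (le_lt_trans (ler_norm _))// normrN ltrDl.
apply: (@near_eq_is_derive R _ _ (fun x => G a x - G a 0)).
  near=> x; rewrite /F.
  have xt : `|x| < `|t| + 1.
    near: x; have := @norm_continuous R R^o t.
    move=> /cvgr_lt /(_ (`|t| + 1)); apply.
    by rewrite ltrDl.
  apply: GB.
  - by rewrite /a lerN2; move: xt; lra.
  - by rewrite oppr_lt0 ltr_wpDl.
  - by rewrite ltrNl (le_lt_trans (ler_norm _))// normrN ltrDl.
apply: der_eq (derB (dG a t at0) (der_cst _ _ _)) _.
by rewrite subr0.
Unshelve. all: by end_near. Qed.

End one_variable.

(** * Global solutions of second-order equations with a bounded Lipschitz force *)

Section second_order_ode.
Context {R : realType}.

Lemma convex_min (h h1 h2 : R -> R) :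
  (forall t : R, is_derive t 1 h (h1 t)) ->
  (forall t : R, is_derive t 1 h1 (h2 t)) ->
  h1 0 = 0 -> (forall t, 0 <= h2 t) -> forall t, h 0 <= h t.
Proof.
move=> dh dh1 h10 h20 t.
have h1S x y : x <= y -> h1 x <= h1 y by move=> xy; apply: (der_ge0_le xy).
have [t0|t0] := leP 0 t.
  apply: (der_ge0_le t0 (df := h1)) => // x /andP[x0 _].
  by rewrite -h10 h1S.
have : - h t <= - h 0.
  apply: (der_ge0_le (ltW t0) (f := fun x => - h x) (df := fun x => - h1 x)).
  by move=> x /andP[_ x0]; rewrite oppr_ge0 -h10 h1S.
by rewrite lerN2.
Qed.

Definition cosh (x : R) : R := (expR x + expR (- x)) / 2.

Lemma cosh_ge1 x : 1 <= cosh x.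
Proof.
rewrite /cosh expRN; have := expR_gt0 x; move: (expR x) => y y0.
rewrite ler_pdivlMr// mul1r -subr_ge0.
have -> : y + y^-1 - 2 = (y - 1) ^+ 2 / y by field; exact: lt0r_neq0.
by rewrite divr_ge0 ?sqr_ge0 // ltW.
Qed.

Lemma cosh0 : cosh 0 = 1.
Proof. by rewrite /cosh oppr0 expR0; lra. Qed.

Lemma cosh_le (k x M : R) : 0 <= k -> `|x| <= M -> cosh (k * x) <= expR (k * M).
Proof.
move=> k0 xM; have [xl xr] : x <= M /\ - x <= M.
  by move: xM; rewrite ler_norml => /andP[? ?]; split; lra.
have : expR (k * x) <= expR (k * M) by rewrite ler_expR ler_wpM2l.
have : expR (- (k * x)) <= expR (k * M) by rewrite -mulrN ler_expR ler_wpM2l.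
by rewrite /cosh; lra.
Qed.

Lemma der_cosh (k t : R) : is_derive t (1:R) (fun t => cosh (k * t))
  (k * ((expR (k * t) - expR (- (k * t))) / 2)).
Proof.
have dk : is_derive t (1:R) (fun t => k * t) (k * 1) by exact: derMl.
rewrite /cosh; apply: (der_eq (derMr _ (derD (der_expR dk) (der_expR (derN dk))))).
by rewrite /=; field.
Qed.

Lemma der_dcosh (k t : R) :
  is_derive t (1:R) (fun t => k * ((expR (k * t) - expR (- (k * t))) / 2))
    (k ^+ 2 * cosh (k * t)).
Proof.
have dk : is_derive t (1:R) (fun t => k * t) (k * 1) by exact: derMl.
apply: (der_eq (derMl k (derMr _ (derB (der_expR dk) (der_expR (derN dk)))))).
by rewrite /cosh; field.
Qed.

(** The function [B / k ^ 2 * cosh (k t)] has second derivative [B * cosh (k t)], so adding or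
    subtracting [D] leaves it convex with a critical point at 0, where it is nonnegative.
    Integrating twice from 0 thus costs a factor [k ^ -2] in the weighted norm, in both time
    directions at once. *)
Lemma cosh_bound (D D1 D2 : R -> R) (k B : R) : 0 < k ->
  (forall t : R, is_derive t 1 D (D1 t)) ->
  (forall t : R, is_derive t 1 D1 (D2 t)) ->
  D 0 = 0 -> D1 0 = 0 -> (forall t, `|D2 t| <= B * cosh (k * t)) ->
  forall t, `|D t| <= B / k ^+ 2 * cosh (k * t).
Proof.
move=> k0 dD dD1 D0 D10 D2B.
have B0 : 0 <= B.
  by have := D2B 0; rewrite mulr0 cosh0 mulr1; apply: le_trans.
have k20 : 0 < k ^+ 2 by rewrite exprn_gt0.
have key s : s ^+ 2 = 1 -> forall t, s * D t <= B / k ^+ 2 * cosh (k * t).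
  move=> s1 t.
  have := @convex_min (fun t => B / k ^+ 2 * cosh (k * t) - s * D t)
    (fun t => B / k ^+ 2 * (k * ((expR (k * t) - expR (- (k * t))) / 2)) - s * D1 t)
    (fun t => B / k ^+ 2 * (k ^+ 2 * cosh (k * t)) - s * D2 t).
  move=> /(_ _ _ _ _ t) h; rewrite -subr_ge0.
  apply: (le_trans _ (h _ _ _ _)) => [|x|x||x].
  - by rewrite mulr0 cosh0 D0 mulr1 mulr0 subr0 divr_ge0 // ltW.
  - by apply: derB; apply: derMl => //; exact: der_cosh.
  - by apply: derB; apply: derMl => //; exact: der_dcosh.
  - by rewrite D10 mulr0 oppr0 subrr mul0r !mulr0 subr0.
  - rewrite mulrA divfK ?gt_eqF // subr_ge0 (le_trans _ (D2B x)) //.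
    rewrite (le_trans (ler_norm _)) // normrM.
    have -> : `|s| = 1 by apply/eqP; rewrite -sqrp_eq1 // real_normK ?num_real // s1.
    by rewrite mul1r.
move=> t; rewrite ler_norml; apply/andP; split.
  by have := key (-1) _ t; rewrite mulN1r lerNl; apply; rewrite sqrrN expr1n.
by have := key 1 _ t; rewrite mul1r; apply; rewrite expr1n.
Qed.

Lemma expn2_large (K e : R) : 0 < e -> exists n, K / 2 ^+ n < e.
Proof.
move=> e0; exists (Num.truncn `|K / e|).+1; set n := _.+1.
rewrite ltr_pdivrMr ?exprn_gt0 // mulrC -ltr_pdivrMr //.
rewrite (le_lt_trans (ler_norm _)) // (lt_trans (truncnS_gt _)) //.
by rewrite -natrX ltr_nat ltn_expl.
Qed.

(** The radius [2 C / 2 ^ n] is the sum of the remaining increments, so the intervals around [Y n]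
    are nested and the supremum of their left ends lies in all of them. The explicit rate is what
    later gives local uniformity in [t]. *)
Lemma geometric_limit (Y : nat -> R) (C : R) :
  (forall n, `|Y n.+1 - Y n| <= C / 2 ^+ n) ->
  exists y, forall n, `|y - Y n| <= 2 * C / 2 ^+ n.
Proof.
move=> YC; pose e n := 2 * C / 2 ^+ n.
have C0 : 0 <= C by have := YC 0%N; rewrite expr0 divr1; apply: le_trans.
have e0 n : 0 <= e n by rewrite divr_ge0 ?mulr_ge0 ?exprn_ge0.
have eS n : e n = e n.+1 + C / 2 ^+ n.
  by rewrite /e exprS; field; rewrite expf_neq0.
have W n m : (n <= m)%N -> Y n - e n <= Y m - e m /\ Y m + e m <= Y n + e n.
  elim: m => [|m IH]; first by rewrite leqn0 => /eqP ->.
  rewrite leq_eqVlt => /predU1P[-> //|/IH[]].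
  have := YC m; rewrite ler_norml => /andP[]; rewrite (eS m); lra.
have WU n m : Y n - e n <= Y m + e m.
  have [nm|/ltnW nm] := leqP n m; have [] := W _ _ nm; have := e0 m; have := e0 n; lra.
exists (sup (range (fun n => Y n - e n))) => n.
rewrite -/(e n) ler_norml; apply/andP; split.
  rewrite lerBrDr addrC; apply: sup_ubound; last by exists n.
  by exists (Y 0%N + e 0%N) => _ [m _ <-].
rewrite lerBlDl; apply: ge_sup; first by exists (Y 0%N - e 0%N); exists 0%N.
by move=> _ [m _ <-].
Qed.

Lemma lipschitz_continuous (F : R -> R) (L : R) : 0 < L ->
  (forall x y, `|F x - F y| <= L * `|x - y|) -> continuous F.
Proof.
move=> L0 FL t; apply/cvgrPdist_lt => e e0.
have /cvgrPdist_lt/(_ (e / L)) h := @cvg_id _ (nbhs t).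
have {h} := h (divr_gt0 e0 L0).
apply: filterS => x /=; rewrite ltr_pdivlMr // mulrC.
exact: le_lt_trans (FL _ _).
Qed.

(* Picard iteration: for [k ^ 2 = 2 L] the integral operator halves distances in
   the sup norm weighted by [1 / cosh (k t)]. *)
Lemma ode2_lipschitz (F : R -> R) (L M s0 s1 : R) : 0 < L ->
  (forall x y, `|F x - F y| <= L * `|x - y|) -> (forall x, `|F x| <= M) ->
  exists s ds : R -> R, [/\ s 0 = s0, ds 0 = s1,
    forall t : R, is_derive t 1 s (ds t) &
    forall t : R, is_derive t 1 ds (F (s t))].
Proof.
move=> L0 FL FM.
have cF (f : R -> R) : continuous f -> continuous (F \o f).
  by move=> cf t; apply: continuous_comp; [exact: cf|exact: (lipschitz_continuous L0 FL)].
(* [step y z] says that [z] is the Picard image of [y]: two integrations of [F (y t)] with the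
   prescribed data at 0. *)
pose step (y z : R -> R) := exists dz : R -> R, [/\ z 0 = s0, dz 0 = s1,
    forall t : R, is_derive t 1 z (dz t) &
    forall t : R, is_derive t 1 dz (F (y t))].
have [T HT] : exists T : (R -> R) -> (R -> R), forall y, continuous y -> step y (T y).
  suff /choice[T HT] : forall y, exists z, continuous y -> step y z by exists T.
  move=> y; have [cy|ncy] := pselect (continuous y); last by exists y.
  have [g g0 dg] := antiderivative (cF _ cy).
  have [|h h0 dh] := @antiderivative R (fun t => s1 + g t).
    by move=> t; exact: (der_continuous (derD (der_cst _ _ _) (dg t))).
  exists (fun t => s0 + h t) => _; exists (fun t => s1 + g t); split.
  - by rewrite h0 addr0.
  - by rewrite g0 addr0.
  - by move=> t; apply: (der_eq (derD (der_cst _ _ _) (dh t))); rewrite add0r.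
  - by move=> t; apply: (der_eq (derD (der_cst _ _ _) (dg t))); rewrite add0r.
pose Y n := iter n T (fun t => s0 + s1 * t).
have dY0 (t : R) : is_derive t 1 (Y 0%N) s1.
  apply: (der_eq (derD (der_cst _ _ _) (derMl s1 (is_derive_id _ _)))).
  by rewrite add0r mulr1.
have cY n : continuous (Y n).
  elim: n => [t|n IH t]; first exact: der_continuous (dY0 t).
  by have [dz [_ _ dYn _]] := HT _ IH; exact: der_continuous (dYn t).
have HY n : step (Y n) (Y n.+1) by exact: HT.
pose k := Num.sqrt (2 * L).
have L20 : 0 < 2 * L by rewrite mulr_gt0.
have k0 : 0 < k by rewrite sqrtr_gt0.
have k2 : k ^+ 2 = 2 * L by rewrite sqr_sqrtr // ltW.
pose C := M / k ^+ 2.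
have diffstep (y z y' z' : R -> R) (B : R) : step y z -> step y' z' ->
    (forall t, `|y' t - y t| <= B * cosh (k * t)) ->
    forall t, `|z' t - z t| <= B / 2 * cosh (k * t).
  move=> [dz [z0 dz0 dzE ddz]] [dz' [z'0 dz'0 dz'E ddz']] yB t.
  have -> : B / 2 = L * B / k ^+ 2 by rewrite k2; field; rewrite gt_eqF.
  apply: (@cosh_bound (fun t => z' t - z t) (fun t => dz' t - dz t)
    (fun t => F (y' t) - F (y t)) k _ k0) => [||x].
  - by rewrite z0 z'0 subrr.
  - by rewrite dz0 dz'0 subrr.
  - by rewrite (le_trans (FL _ _)) // -mulrA ler_pM2l.
have YC n t : `|Y n.+1 t - Y n t| <= C * cosh (k * t) / 2 ^+ n.
  elim: n t => [|n IH] t.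
    rewrite expr0 divr1; have [dz [z0 dz0 dzE ddz]] := HY 0%N.
    apply: (@cosh_bound (fun t => Y 1%N t - Y 0%N t) (fun t => dz t - s1)
      (fun t => F (Y 0%N t) - 0) k _ k0) => [||x].
    - by rewrite z0 /Y /= mulr0 addr0 subrr.
    - by rewrite dz0 subrr.
    - rewrite subr0 (le_trans (FM _)) // ler_peMr ?cosh_ge1 //.
      by apply: le_trans (FM 0); rewrite normr_ge0.
  have := diffstep _ _ _ _ (C / 2 ^+ n) (HY n) (HY n.+1) _ t.
  have -> : C * cosh (k * t) / 2 ^+ n.+1 = C / 2 ^+ n / 2 * cosh (k * t).
    by rewrite exprS; field; rewrite expf_neq0.
  by apply=> x; rewrite mulrAC.
have /choice[y yY] : forall t, exists y, forall n,
    `|y - Y n t| <= 2 * (C * cosh (k * t)) / 2 ^+ n.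
  by move=> t; apply: geometric_limit => n; exact: YC.
have cy : continuous y.
  move=> t; apply/cvgrPdist_lt => e e0.
  (* Largest weight on [|x| <= |t| + 1]: there the convergence is uniform, and three errors of size
     [e / 3] give continuity of the limit. *)
  pose K := 2 * (C * expR (k * (`|t| + 1))).
  have [n nK] := @expn2_large K (e / 3) (divr_gt0 e0 (ltr0Sn _ _)).
  have C0 : 0 <= C.
    by rewrite divr_ge0 ?(ltW L20) ?k2 ?(ltW L20) // (le_trans _ (FM 0)).
  have yK x : `|x| <= `|t| + 1 -> `|y x - Y n x| < e / 3.
    move=> xt; apply: le_lt_trans nK; apply: le_trans (yY x n) _.
    rewrite ler_pM2r ?invr_gt0 ?exprn_gt0 // /K ler_pM2l // ler_wpM2l //.
    by apply: cosh_le => //; exact: ltW.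
  have e3 : 0 < e / 3 by rewrite divr_gt0.
  have /cvgrPdist_lt/(_ _ e3) hY := cY n t.
  near=> x; have xt : `|x| <= `|t| + 1.
    near: x; have /cvgr_le := @norm_continuous R R^o t.
    by apply; rewrite ltrDl.
  have tt : `|t| <= `|t| + 1 by rewrite lerDl.
  have Yx : `|Y n t - Y n x| < e / 3 by near: x; exact: hY.
  have := yK x xt; have := yK t tt; move: Yx.
  rewrite !ltr_norml => /andP[? ?] /andP[? ?] /andP[? ?].
  by apply/andP; split; lra.
have [dz [z0 dz0 dzE ddz]] := HT y cy.
(* Both [y] and [T y] lie within [C * cosh (k * t) / 2 ^ n] of [Y n.+1], so they coincide. *)
suff zy : T y = y.
  by rewrite zy in z0 dzE; exists y, dz; split; [exact: z0|exact: dz0|exact: dzE|exact: ddz].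
apply/funext => t; apply/eqP; rewrite -subr_eq0 -normr_le0; apply/ler_addgt0Pr => e e0.
have [n nK] := @expn2_large (3 * (C * cosh (k * t))) e e0.
rewrite add0r ltW // (le_lt_trans _ nK) //.
have zY : `|T y t - Y n.+1 t| <= (C * cosh (k * t)) / 2 ^+ n.
  have := diffstep (Y n) (Y n.+1) y (T y) (2 * C / 2 ^+ n) (HY n) (HT y cy) _ t.
  have -> : C * cosh (k * t) / 2 ^+ n = 2 * C / 2 ^+ n / 2 * cosh (k * t).
    by field; rewrite expf_neq0.
  by apply=> x; move: (yY x n); rewrite mulrA [X in _ <= X -> _]mulrAC.
have yYn := yY t n.+1.
rewrite (_ : 2 * (C * cosh (k * t)) / 2 ^+ n.+1 = C * cosh (k * t) / 2 ^+ n) in yYn; last first.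
  by rewrite exprS; field; rewrite expf_neq0.
have : 0 <= C * cosh (k * t) / 2 ^+ n by apply: le_trans (normr_ge0 _) zY.
have -> : 3 * (C * cosh (k * t)) / 2 ^+ n = 3 * (C * cosh (k * t) / 2 ^+ n).
  by rewrite -mulrA.
move: zY yYn; rewrite !ler_norml => /andP[? ?] /andP[? ?] ?.
by apply/andP; split; lra.
Unshelve. all: by end_near. Qed.

End second_order_ode.

Section dispersive_ode.
Context {R : realType}.

Definition force (kap lam x : R) : R := kap * x^-1 ^+ 3 + 2 * lam / x.

(* The force is frozen below a level that conservation of energy forbids the
   solution to cross; freezing makes it globally Lipschitz. *)
Lemma dispersion_solution (lam s0 s1 : R) : 0 < lam -> 0 < s0 ->
  exists s ds : R -> R, [/\ s 0 = s0, ds 0 = s1, forall t, 0 < s t,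
    forall t : R, is_derive t 1 s (ds t) &
    forall t : R, is_derive t 1 ds (force 1 lam (s t))].
Proof.
move=> lam0 s00.
(* Potential of the force, [W' = - force 1 lam], and [E] is the energy of the initial data. *)
pose W (x : R) := x^-1 ^+ 2 / 2 - 2 * lam * ln x.
pose E := s1 ^+ 2 / 2 + W s0.
(* The barrier. From [d^-1 >= 1 + 2 |E|] the singular term alone exceeds [E], and [d <= 1] makes the
   logarithmic term nonnegative; hence [E <= W d]. *)
pose d := Num.min s0 (1 + 2 * `|E|)^-1.
have E1 : 1 <= 1 + 2 * `|E| by rewrite lerDl mulr_ge0.
have d0 : 0 < d by rewrite lt_min s00 invr_gt0 (lt_le_trans ltr01).
have ds0 : d <= s0 by rewrite ge_min lexx.
have dE : 1 + 2 * `|E| <= d^-1.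
  rewrite -[leLHS]invrK lef_pV2 ?posrE ?invr_gt0 //.
    by rewrite ge_min lexx orbT.
have d1 : d <= 1 by rewrite ge_min invf_le1 ?E1 ?orbT // (lt_le_trans ltr01).
have WE : E <= W d.
  have lnd : 0 <= - (2 * lam * ln d).
    by rewrite -mulrN mulr_ge0 ?oppr_ge0 ?ln_le0 // mulr_ge0 // ltW.
  rewrite /W; apply: le_trans (ler_norm _) _; rewrite -[leLHS]addr0 lerD //.
  have : (1 + 2 * `|E|) ^+ 2 <= d^-1 ^+ 2.
    by rewrite ler_pXn2r ?nnegrE ?invr_ge0 ?(ltW d0) // (le_trans ler01).
  have := normr_ge0 E; move: (`|E|) (d^-1) => p q; nra.
pose F (x : R) := force 1 lam (Num.max x d).
have Mge x : d <= Num.max x d by rewrite le_max lexx orbT.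
have M0 x : 0 < Num.max x d by exact: lt_le_trans d0 (Mge x).
have F0 x : 0 < F x.
  by rewrite /F /force mul1r addr_gt0 // ?exprn_gt0 ?invr_gt0 // divr_gt0 // mulr_gt0.
have Mle x : (Num.max x d)^-1 <= d^-1 by rewrite lef_pV2 ?posrE.
have FM x : `|F x| <= force 1 lam d.
  rewrite ger0_norm; last exact: ltW.
  rewrite /F /force !mul1r lerD //.
    by rewrite lerXn2r ?nnegrE ?invr_ge0 // ltW.
  by rewrite ler_pM2l // mulr_gt0.
pose L := (3 * d^-1 ^+ 2 + 2 * lam) * d^-1 ^+ 2.
have L0 : 0 < L.
  by rewrite mulr_gt0 ?exprn_gt0 ?invr_gt0 // addr_gt0 ?mulr_gt0 // ?exprn_gt0 ?invr_gt0.
have maxL (x y : R) : `|Num.max x d - Num.max y d| <= `|x - y|.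
  rewrite !maxEle; case: (leP x d) => xd; case: (leP y d) => yd.
  - by rewrite subrr normr0.
  - by rewrite !ler0_norm; lra.
  - by rewrite !ger0_norm; lra.
  - by [].
have FL x y : `|F x - F y| <= L * `|x - y|.
  apply: (@le_trans _ _ (L * `|Num.max x d - Num.max y d|)); last by rewrite ler_pM2l.
  rewrite /F /force; move: (Mle x) (Mle y) (M0 x) (M0 y).
  move: (Num.max x d) (Num.max y d) => {}x {}y xd yd x0 y0.
  have -> : 1 * x^-1 ^+ 3 + 2 * lam / x - (1 * y^-1 ^+ 3 + 2 * lam / y) =
    - (((x^-1 ^+ 2 + x^-1 * y^-1 + y^-1 ^+ 2) + 2 * lam) * (x^-1 * y^-1)) * (x - y).
    by field; rewrite !gt_eqF.
  rewrite normrM normrN ler_wpM2r //.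
  have x0' : 0 < x^-1 by rewrite invr_gt0.
  have y0' : 0 < y^-1 by rewrite invr_gt0.
  rewrite ger0_norm; last first.
    by rewrite mulr_ge0 ?addr_ge0 ?mulr_ge0 ?sqr_ge0 // ltW.
  have xyd : x^-1 * y^-1 <= d^-1 ^+ 2 by rewrite expr2 ler_pM // ltW.
  have xxd : x^-1 ^+ 2 <= d^-1 ^+ 2.
    by rewrite ler_pXn2r ?nnegrE ?(ltW x0') // (le_trans _ xd) // ltW.
  have yyd : y^-1 ^+ 2 <= d^-1 ^+ 2.
    by rewrite ler_pXn2r ?nnegrE ?(ltW y0') // (le_trans _ yd) // ltW.
  apply: ler_pM => //; try by rewrite ?addr_ge0 ?mulr_ge0 ?sqr_ge0 // ltW.
  lra.
have [s [ds [s_0 ds_0 dsE dds]]] := ode2_lipschitz s0 s1 L0 FL FM.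
have [G G0 dG] := antiderivative (lipschitz_continuous L0 FL).
have GW : G s0 - G d = W d - W s0.
  apply/eqP; rewrite subr_eq addrAC -subr_eq opprK [X in _ == X]addrC; apply/eqP.
  apply: (@der0_eq _ (fun x => G x + W x)) => // x /andP[dx xs0].
  have x0 : 0 < x by exact: lt_le_trans dx.
  have idx := is_derive_id x (1:R).
  have xn0 : x != 0 by rewrite gt_eqF.
  apply: (der_eq (derD (dG x) (derB (derMr _ (derX2 (derV (f := id) xn0 idx)))
     (derMl (2 * lam) (der_ln (f := id) x0 idx))))).
  by rewrite /F /force (max_l dx) /=; field.
have energy t : ds t ^+ 2 / 2 - G (s t) = s1 ^+ 2 / 2 - G s0.
  have dEn (x : R) : is_derive x (1:R) (fun x => ds x ^+ 2 / 2 - G (s x)) 0.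
    apply: (der_eq (derB (derMr _ (derX2 (dds x))) (der_comp (dG _) (dsE x)))).
    by field.
  by rewrite -ds_0 -s_0; apply: (is_derive_0_is_cst _ _ dEn).
have sd t : d <= s t.
  rewrite leNgt; apply/negP => std.
  have : G (s t) < G d.
    have [c _ e] := mean_value (ltW std) (fun x _ => dG x).
    by rewrite -subr_gt0 e mulr_gt0 // subr_gt0.
  have := energy t; have := sqr_ge0 (ds t); move: GW WE; rewrite /E; lra.
exists s, ds; split => //; first by move=> t; exact: lt_le_trans d0 (sd t).
by move=> t; have := dds t; rewrite /F (max_l (sd t)).
Qed.

End dispersive_ode.

(** * Growth at infinity of the widths and of [tau] *)

Section dispersive_asymptotics.
Context {R : realType}.
Implicit Types (f s ds : R -> R) (kap lam : R).

(** By the mean value theorem the slope beyond [U] is within [e / 2] of [c]; the fixed deviation [K]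
    at [U] becomes negligible once [t > 2 K / e]. *)
Lemma cvg_ratio_derive f (df : R -> R) (T c : R) :
  (forall t : R, T <= t -> is_derive t 1 f (df t)) ->
  df t @[t --> +oo] --> c -> f t / t @[t --> +oo] --> c.
Proof.
move=> fdf dfc; apply/cvgrPdist_lt => e e0.
have e2 : 0 < e / 2 by rewrite divr_gt0.
have /cvgrPdist_lt/(_ _ e2) [S [_ hS]] := dfc.
pose U := Num.max (Num.max T 1) (S + 1).
have UT : T <= U by rewrite !le_max lexx.
have U1 : 1 <= U by rewrite !le_max lexx orbT.
have US : S < U by rewrite lt_max ltrDl ltr01 orbT.
pose K := `|f U - c * U|.
near=> t.
have Ut : U <= t by near: t; exact: (nbhs_pinfty_ge (num_real _)).
have t0 : 0 < t by rewrite (lt_le_trans _ Ut) // (lt_le_trans ltr01).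
have tK : 2 * K / e < t by near: t; exact: (nbhs_pinfty_gt (num_real _)).
have [x /andP[Ux xt] fE] := mean_value Ut
  (fun x (xU : U <= x <= t) => fdf x (le_trans UT (andP xU).1)).
have dx : `|c - df x| < e / 2 by apply: hS; exact: lt_le_trans Ux.
have -> : c - f t / t = (- (f U - c * U) + (c - df x) * (t - U)) / t.
  rewrite -[f t](subrK (f U)) fE; field; exact: lt0r_neq0.
rewrite normrM [`|t^-1|]gtr0_norm ?invr_gt0 // ltr_pdivrMr //.
rewrite (le_lt_trans (ler_normD _ _)) // normrN -/K normrM (ger0_norm (x := t - U)) ?subr_ge0 //.
have h1 : K < e / 2 * t by move: tK; rewrite ltr_pdivrMr //; lra.
have h2 : `|c - df x| * (t - U) <= e / 2 * t.
  apply: ler_pM => //; [by rewrite subr_ge0|exact: ltW|lra].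
by move: h1 h2; lra.
Unshelve. all: by end_near. Qed.

(** Restricted to [t > 0] because [is_tau] gives only one-sided derivatives at 0 and no information
    for negative times. *)
Definition dispersive kap lam s ds :=
  [/\ forall t, 0 < t -> 0 < s t,
      forall t : R, 0 < t -> is_derive t 1 s (ds t) &
      forall t : R, 0 < t -> is_derive t 1 ds (force kap lam (s t))].

Variables (kap lam : R) (s ds : R -> R).
Hypotheses (kap0 : 0 <= kap) (lam0 : 0 < lam) (sds : dispersive kap lam s ds).

(* [(s^2)'' >= 4 lam]. *)
Lemma dispersive_cvgy :
  s t @[t --> +oo] --> +oo /\ \forall t \near +oo, 0 < ds t.
Proof.
have [s0 dsE dds] := sds.
(* Half the derivative of [s ^ 2]; its own derivative is at least [2 * lam]. *)
pose h t := s t * ds t.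
have dh (t : R) : 0 < t ->
    is_derive t 1 h (ds t ^+ 2 + kap * (s t)^-1 ^+ 2 + 2 * lam).
  move=> t0; apply: (der_eq (derM (dsE t t0) (dds t t0))).
  by rewrite /force; field; rewrite gt_eqF ?s0.
have h_ge a b : 0 < a -> a <= b -> h a + 2 * lam * (b - a) <= h b.
  move=> a0 ab.
  have := @der_ge0_le _ (fun t => h t - 2 * lam * t)
     (fun t => ds t ^+ 2 + kap * (s t)^-1 ^+ 2 + 2 * lam - 2 * lam * 1) a b ab.
  move=> H; suff : h a - 2 * lam * a <= h b - 2 * lam * b by lra.
  apply: H => x /andP[ax xb]; have x0 := lt_le_trans a0 ax.
    exact: (derB (dh x x0) (derMl _ (is_derive_id x (1:R)))).
  by rewrite mulr1 addrK addr_ge0 ?sqr_ge0 // mulr_ge0 ?sqr_ge0.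
(* Growth at rate [2 * lam] from time 1 makes up for a possibly negative [h 1] by time [T]. *)
pose T := 1 + `|h 1| / (2 * lam).
have L0 : 0 < 2 * lam by rewrite mulr_gt0.
have T1 : 1 <= T by rewrite lerDl divr_ge0 // ltW.
have T0 : 0 < T by exact: lt_le_trans ltr01 T1.
have hT : 0 <= h T.
  apply: le_trans (h_ge 1 T ltr01 T1).
  rewrite /T addrAC subrr add0r mulrC divfK ?gt_eqF //.
  by have := ler_norm (- h 1); rewrite normrN; lra.
have hTt t : T <= t -> 2 * lam * (t - T) <= h t.
  by move=> Tt; have := h_ge T t T0 Tt; lra.
have s2 t : T <= t -> 2 * lam * (t - T) ^+ 2 <= s t ^+ 2.
  move=> Tt.
  rewrite -subr_ge0.
  apply: (@le_trans _ _ (s T ^+ 2 - 2 * lam * (T - T) ^+ 2)).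
    by rewrite subrr expr0n mulr0 subr0 sqr_ge0.
  apply: (@der_ge0_le _ (fun t => s t ^+ 2 - 2 * lam * (t - T) ^+ 2)
     (fun t => 2 * s t * ds t - 2 * lam * (2 * (t - T) * (1 - 0))) T t Tt) => x /andP[Tx _].
    exact: (derB (derX2 (dsE x (lt_le_trans T0 Tx)))
      (derMl _ (derX2 (derB (is_derive_id x (1:R)) (der_cst T x _))))).
  by have := hTt x Tx; rewrite /h; lra.
split.
  apply/cvgryPge => A; near=> t.
  have Tt : T <= t by near: t; exact: (nbhs_pinfty_ge (num_real _)).
  have t0 : 0 < t by exact: lt_le_trans Tt.
  have tA : T + (A ^+ 2 + 1) / (2 * lam) + 1 <= t by near: t; exact: (nbhs_pinfty_ge (num_real _)).
  apply: le_trans (ler_norm A) _; rewrite -ler_sqr ?nnegrE ?(ltW (s0 t t0)) //.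
  rewrite real_normK ?num_real //; apply: le_trans (s2 t Tt).
  have tT1 : 1 <= t - T.
    by have : 0 <= (A ^+ 2 + 1) / (2 * lam) by [rewrite divr_ge0 ?addr_ge0 ?sqr_ge0 // ltW]; lra.
  have : 2 * lam * (t - T) <= 2 * lam * (t - T) ^+ 2.
    by rewrite ler_pM2l // expr2 ler_peMr // (le_trans ler01).
  apply: le_trans.
  have : (A ^+ 2 + 1) / (2 * lam) <= t - T by lra.
  by rewrite ler_pdivrMr // mulrC; lra.
near=> t.
have Tt : T < t by near: t; exact: (nbhs_pinfty_gt (num_real _)).
have t0 : 0 < t by exact: lt_trans Tt.
rewrite -(pmulr_rgt0 _ (s0 t t0)) (lt_le_trans _ (hTt t (ltW Tt))) //.
by rewrite mulr_gt0 // subr_gt0.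
Unshelve. all: by end_near. Qed.

(** The first integral obtained by multiplying the equation by [2 * ds]. Its value is read at time
    1, since nothing is assumed at 0. *)
Lemma dispersive_energy : exists C, forall t, 0 < t ->
  ds t ^+ 2 = C - kap * (s t)^-1 ^+ 2 + 4 * lam * ln (s t).
Proof.
have [s0 dsE dds] := sds.
pose e t := ds t ^+ 2 + kap * (s t)^-1 ^+ 2 - 4 * lam * ln (s t).
exists (e 1) => t t0.
have de (x : R) : 0 < x -> is_derive x 1 e 0.
  move=> x0; have sx := s0 x x0; have sn0 : s x != 0 by rewrite gt_eqF.
  apply: (der_eq (derB (derD (derX2 (dds x x0)) (derMl kap (derX2 (derV sn0 (dsE x x0)))))
    (derMl _ (der_ln sx (dsE x x0))))).
  by rewrite /force; field.
have <- : e t = e 1.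
  have [t1|/ltW t1] := leP t 1.
    by apply/esym/(der0_eq t1) => x /andP[tx _]; apply: de; exact: lt_le_trans tx.
  by apply/(der0_eq t1) => x /andP[tx _]; apply: de; exact: lt_le_trans tx.
by rewrite /e; lra.
Qed.

(* Energy conservation gives [ds ~ sqrt (4 lam ln s)], so [s / sqrt (ln s)] has a
   derivative tending to [sqrt (4 lam)]; the statement is the logarithm of
   [s / (t sqrt (ln s))]. *)
Lemma dispersive_ln_cvg :
  ln (s t) - 2^-1 * ln (ln (s t)) - ln t @[t --> +oo] --> ln (Num.sqrt (4 * lam)).
Proof.
have [s0 dsE dds] := sds.
have [soo dspos] := dispersive_cvgy.
have [C energy] := dispersive_energy.
have lnoo : ln (s t) @[t --> +oo] --> +oo.
  apply/cvgryPge => A.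
  move/cvgryPge : soo => /(_ (expR A)); apply: filterS => t.
  by move=> As; rewrite -[A]expRK ler_ln ?posrE ?expR_gt0 // (lt_le_trans _ As) // expR_gt0.
have lninv : (ln (s t))^-1 @[t --> +oo] --> (0 : R).
  apply/gtr0_cvgV0; last exact: lnoo.
  by move/cvgryPgt : lnoo => /(_ 0).
have sinv : (s t)^-1 @[t --> +oo] --> (0 : R).
  apply/gtr0_cvgV0; last exact: soo.
  by move/cvgryPgt : soo => /(_ 0).
(* The derivative of [s / sqrt (ln s)] with [ds] eliminated by the energy: only [1 / s] and
   [1 / ln s] remain, and both tend to 0, so neither [kap] nor [C] survives in the limit. *)
pose dphi t := Num.sqrt ((C - kap * (s t)^-1 ^+ 2) * (ln (s t))^-1 + 4 * lam) *
  (1 - 2^-1 * (ln (s t))^-1).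
have dphic : dphi t @[t --> +oo] --> Num.sqrt (4 * lam).
  have -> : Num.sqrt (4 * lam) =
      Num.sqrt ((C - kap * (0 * 0)) * 0 + 4 * lam) * (1 - 2^-1 * 0).
    by rewrite !mulr0 add0r subr0 mulr1.
  apply: cvgM; last by apply: cvgB; [exact: cvg_cst|apply: cvgM => //; exact: cvg_cst].
  apply: (continuous_cvg _ (@sqrt_continuous R _)).
  apply: cvgD; last exact: cvg_cst.
  apply: cvgM => //; apply: cvgB; first exact: cvg_cst.
  by apply: cvgM; [exact: cvg_cst|under eq_fun do rewrite expr2; exact: cvgM].
pose phi t := s t * expR (- (2^-1 * ln (ln (s t)))).
have [T0 [_ hT0]] : \forall t \near +oo, [/\ 0 < t, 0 < ds t & 1 < s t].
  near=> t; split; near: t; [exact: (nbhs_pinfty_gt (num_real _))|exact: dspos|].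
  by move/cvgryPgt : soo; apply.
have dphiE (t : R) : T0 + 1 <= t -> is_derive t 1 phi (dphi t).
  move=> Tt; have [t0 dst s1] := hT0 t (lt_le_trans (ltr_pwDr ltr01 (lexx _)) Tt).
  have sn0 : s t != 0 by rewrite gt_eqF ?s0.
  have l0 : 0 < ln (s t) by rewrite ln_gt0.
  have dl := der_ln (s0 t t0) (dsE t t0).
  apply: (der_eq (derM (dsE t t0)
    (der_expR (derN (derMl 2^-1 (der_ln (f := fun t => ln (s t)) l0 dl)))))).
  set E := expR _.
  have -> : dphi t = ds t * E * (1 - 2^-1 * (ln (s t))^-1).
    congr (_ * _); rewrite -[RHS]ger0_norm; last by rewrite mulr_ge0 ?expR_ge0 // ltW.
    rewrite -sqrtr_sqr; congr (Num.sqrt _).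
    have -> : (ds t * E) ^+ 2 = ds t ^+ 2 * (ln (s t))^-1.
      rewrite exprMn; congr (_ * _); rewrite /E -expRM_natr.
      have -> : - (2^-1 * ln (ln (s t))) * 2%:R = - ln (ln (s t)) by field.
      by rewrite expRN lnK.
    by rewrite (energy t t0); field; rewrite gt_eqF.
  by field; rewrite sn0 gt_eqF.
have phic := cvg_ratio_derive dphiE dphic.
have sq0 : 0 < Num.sqrt (4 * lam) by rewrite sqrtr_gt0 mulr_gt0.
have := continuous_cvg _ (continuous_ln sq0) phic.
move=> /(_ _) h; apply: cvg_trans h; apply: near_eq_cvg; near=> t.
have [t0 dst s1] : [/\ 0 < t, 0 < ds t & 1 < s t].
  by apply: hT0; near: t; exact: (nbhs_pinfty_gt (num_real _)).
by rewrite /= /phi ln_div ?lnM ?posrE ?mulr_gt0 ?expR_gt0 ?s0 // expRK.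
Unshelve. all: by end_near. Qed.

End dispersive_asymptotics.

(** With [X = ln s] and [Y = ln s'], the two limits in [dispersive_ln_cvg] agree, so
    [(X - Y) - (ln X - ln Y) / 2] tends to 0. The logarithm is 1-Lipschitz on [[1, +oo[], hence this
    quantity dominates [|X - Y| / 2], and [X - Y] tends to 0. *)
Lemma dispersive_ratio {R : realType} (kap kap' lam : R) (s ds s' ds' : R -> R) :
  0 <= kap -> 0 <= kap' -> 0 < lam ->
  dispersive kap lam s ds -> dispersive kap' lam s' ds' ->
  s t / s' t @[t --> +oo] --> (1 : R).
Proof.
move=> k0 k'0 lam0 H H'.
have [soo _] := dispersive_cvgy k0 lam0 H.
have [soo' _] := dispersive_cvgy k'0 lam0 H'.
have c := dispersive_ln_cvg k0 lam0 H.
have c' := dispersive_ln_cvg k'0 lam0 H'.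
have d0 : ln (s t) - ln (s' t) @[t --> +oo] --> (0 : R).
  have /cvgrPdist_lt h : (ln (s t) - 2^-1 * ln (ln (s t)) - ln t) -
      (ln (s' t) - 2^-1 * ln (ln (s' t)) - ln t) @[t --> +oo] --> (0 : R).
    by rewrite -(subrr (ln (Num.sqrt (4 * lam)))); exact: cvgB.
  apply/cvgrPdist_lt => e e0.
  have /h : 0 < e / 2 by rewrite divr_gt0.
  apply: filterS2 (_ : \forall t \near +oo, expR 1 <= s t /\ expR 1 <= s' t).
    move=> t [s1 s'1]; rewrite !sub0r !normrN.
    have X1 : 1 <= ln (s t).
      by rewrite -[1]expRK ler_ln ?posrE ?expR_gt0 // (lt_le_trans (expR_gt0 1)).
    have Y1 : 1 <= ln (s' t).
      by rewrite -[1]expRK ler_ln ?posrE ?expR_gt0 // (lt_le_trans (expR_gt0 1)).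
    move: (ln (s t)) (ln (s' t)) X1 Y1 => X Y X1 Y1.
    have lip (x y : R) : 1 <= x -> x <= y -> ln y - ln x <= y - x.
      move=> x1 xy; have x0 : 0 < x by exact: lt_le_trans ltr01 x1.
      have y0 : 0 < y by exact: lt_le_trans xy.
      rewrite -ln_div ?posrE // (_ : y / x = 1 + (y - x) / x); last by field; rewrite gt_eqF.
      apply: le_trans (le_ln1Dx _) _.
        by rewrite (lt_le_trans (ltrN10 _)) // divr_ge0 ?subr_ge0 // ltW.
      by rewrite ler_pdivrMr // ler_peMr // subr_ge0.
    have -> : X - 2^-1 * ln X - ln t - (Y - 2^-1 * ln Y - ln t) =
      X - Y - 2^-1 * (ln X - ln Y) by ring.
    rewrite !ltr_norml => /andP[h1 h2]; apply/andP.
    have [XY|/ltW YX] := leP X Y.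
      by have := lip X Y X1 XY; split; lra.
    by have := lip Y X Y1 YX; split; lra.
  near=> t; split; near: t; [move/cvgryPge : soo|move/cvgryPge : soo']; exact.
have := continuous_cvg _ (@continuous_expR R 0) d0; rewrite expR0.
move=> /(_ _) h; apply: cvg_trans h; apply: near_eq_cvg; near=> t.
have t0 : 0 < t by near: t; exact: (nbhs_pinfty_gt (num_real _)).
have [[s0 _ _] [s'0 _ _]] := (H, H').
by rewrite /= -ln_div ?posrE ?s0 ?s'0 // lnK // posrE divr_gt0 ?s0 ?s'0.
Unshelve. all: by end_near. Qed.

(** * Integration over row vectors *)

Section continuity_rules.
Context {R : realType} {T : topologicalType}.
Implicit Types f g : T -> R.

Lemma ct_cst (c : R) : continuous (fun _ : T => c).
Proof. by move=> x; exact: cvg_cst. Qed.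

Lemma ctD f g : continuous f -> continuous g -> continuous (fun x => f x + g x).
Proof. by move=> cf cg x; apply: cvgD; [exact: cf|exact: cg]. Qed.

Lemma ctN f : continuous f -> continuous (fun x => - f x).
Proof. by move=> cf x; apply: cvgN; exact: cf. Qed.

Lemma ctM f g : continuous f -> continuous g -> continuous (fun x => f x * g x).
Proof. by move=> cf cg x; apply: cvgM; [exact: cf|exact: cg]. Qed.

Lemma ctX f n : continuous f -> continuous (fun x => f x ^+ n).
Proof.
move=> cf; elim: n => [|n IH]; first by under eq_fun do rewrite expr0; exact: ct_cst.
by under eq_fun do rewrite exprS; exact: ctM.
Qed.

Lemma ctV f : (forall x, f x != 0) -> continuous f -> continuous (fun x => (f x)^-1).
Proof. by move=> f0 cf x; apply: cvgV => //; exact: cf. Qed.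

Lemma ct_sum n (f : 'I_n -> T -> R) : (forall i, continuous (f i)) ->
  continuous (fun x => \sum_(i < n) f i x).
Proof.
elim: n f => [|n IH] f cf.
  by under eq_fun do rewrite big_ord0; exact: ct_cst.
by under eq_fun do rewrite big_ord_recl; apply: ctD => //; exact: IH.
Qed.

Lemma ct_comp {S : topologicalType} (h : S -> R) (f : T -> S) :
  continuous h -> continuous f -> continuous (fun x => h (f x)).
Proof. by move=> ch cf x; apply: continuous_comp; [exact: cf|exact: ch]. Qed.

Lemma ct_expR f : continuous f -> continuous (fun x => expR (f x)).
Proof. by apply: ct_comp; exact: continuous_expR. Qed.

Lemma ct_cos f : continuous f -> continuous (fun x => cos (f x)).
Proof. by apply: ct_comp; exact: continuous_cos. Qed.

Lemma ct_sin f : continuous f -> continuous (fun x => sin (f x)).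
Proof. by apply: ct_comp; exact: continuous_sin. Qed.

Lemma ct_sqrt f : continuous f -> continuous (fun x => Num.sqrt (f x)).
Proof. by apply: ct_comp; exact: sqrt_continuous. Qed.

Lemma ct_norm f : continuous f -> continuous (fun x => `|f x|).
Proof. by apply: ct_comp; exact: (@norm_continuous R R^o). Qed.

Lemma ct_ln f : (forall x, 0 < f x) -> continuous f -> continuous (fun x => ln (f x)).
Proof.
by move=> f0 cf x; apply: continuous_comp; [exact: cf|exact: continuous_ln].
Qed.

End continuity_rules.

Section row_vectors.
Context {R : realType}.

Lemma ct_coord n (i : 'I_n) : continuous (fun x : 'rV[R]_n => x 0 i).
Proof. exact: coord_continuous. Qed.

Lemma ct_row {T : topologicalType} n (f : T -> 'rV[R]_n) :
  (forall i, continuous (fun x => f x 0 i)) -> continuous f.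
Proof.
move=> cf x; apply/cvg_ballP => e e0.
have : \forall y \near x, forall j, ball (f x 0 j) e (f y 0 j).
  by apply: filter_forall => j; have /cvg_ballP/(_ e e0) := cf j x.
by apply: filterS => y fy; split => // i j; rewrite (ord1 i).
Qed.

(** Links the topology to the sigma-algebra generated by the coordinates: an open set is the union
    of the rational cubes [box qk] it contains, and there are countably many of these. Indices whose
    cube is not contained in [U] contribute the empty set. *)
Lemma open_measurable_rV n (U : set 'rV[R]_n) : open U -> measurable U.
Proof.
move=> oU.
pose box (qk : 'rV[rat]_n * nat) := [set x : 'rV[R]_n |
  forall i, `|x 0 i - ratr (qk.1 0 i)| < qk.2.+1%:R^-1].
have mbox qk : measurable (box qk).
  rewrite (_ : box qk = \bigcap_(i in [set: 'I_n]) ((fun x : 'rV[R]_n => x 0 i) @^-1`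
      [set y | `|y - ratr (qk.1 0 i)| < qk.2.+1%:R^-1])); last first.
    by apply/seteqP; split=> [x Bx i _|x Bx i]; [exact: Bx|exact: (Bx i I)].
  apply: fin_bigcap_measurable => [|i _]; first exact: finite_finset.
  rewrite -[X in measurable X]setTI; apply: measurable_rV_coord => //.
  rewrite (_ : [set y | _] = ball (ratr (qk.1 0 i) : R) qk.2.+1%:R^-1); last first.
    by apply/seteqP; split => y; rewrite /ball/= distrC.
  by rewrite ball_itv; exact: measurable_itv.
rewrite (_ : U = \bigcup_(qk in [set: 'rV[rat]_n * nat])
    (if `[< box qk `<=` U >] then box qk else set0)).
  apply: countable_bigcupT_measurable => // qk.
  by case: ifP => _; [exact: mbox|exact: measurable0].
apply/seteqP; split => [x Ux|x [qk _]]; last first.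
  by case: ifPn => // /asboolP; apply.
have /nbhs_ballP[e /= e0 eU] := open_nbhs_nbhs (conj oU Ux).
(* Two points of a cube of half-side [1 / (k + 1)] differ by less than [2 / (k + 1) < e] in each
   coordinate. *)
pose k := Num.truncn (2 / e).
have ke : 2 / k.+1%:R < e by rewrite ltr_pdivrMr // mulrC -ltr_pdivrMr // truncnS_gt.
have k0 : 0 < k.+1%:R^-1 :> R by rewrite invr_gt0.
have /choice[q hq] (i : 'I_n) : exists q : rat, `|x 0 i - ratr q| < k.+1%:R^-1.
  have xk : x 0 i < x 0 i + k.+1%:R^-1 by rewrite ltrDl.
  have [q] := rat_in_itvoo xk; rewrite in_itv/= => /andP[? ?].
  by exists q; rewrite distrC ger0_norm ?subr_ge0 ?ltW // ltrBlDl.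
exists (\row_i q i, k) => //.
have xbox : box (\row_i q i, k) x by move=> i; rewrite mxE.
rewrite ifT //; apply/asboolP => y ybox; apply: eU; split => // i j.
rewrite (ord1 i) /ball/=; apply: lt_trans ke.
have -> : x 0 j - y 0 j = (x 0 j - ratr (q j)) - (y 0 j - ratr (q j)) by ring.
have := ybox j; rewrite mxE /= => yq.
rewrite (_ : 2 / _ = k.+1%:R^-1 + k.+1%:R^-1); last by rewrite -mulr2n mulrC mulr_natr.
exact: le_lt_trans (ler_normB _ _) (ltrD (hq j) yq).
Qed.

Lemma continuous_measurable_rV n (f : 'rV[R]_n -> R) :
  continuous f -> measurable_fun setT f.
Proof.
move=> /continuousP cf; apply: (measurability _ (RGenOpens.measurableE R)).
move=> _ [_ [a [b ->] <-]]; rewrite setTI; apply: open_measurable_rV.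
exact/cf/interval_open.
Qed.

Lemma ct_uncons n : continuous (fun x : 'rV[R]_n.+1 =>
  (x 0 0, \row_j x 0 (lift ord0 j)) : R * 'rV[R]_n).
Proof.
have cl : continuous (fun x : 'rV[R]_n.+1 => \row_j x 0 (lift ord0 j)).
  apply: ct_row => i; under eq_fun do rewrite mxE.
  exact: ct_coord.
by move=> x; exact: (cvg_pair (@ct_coord n.+1 0 x) (cl x)).
Qed.

(** Reduced to row vectors of length [n + 1] through the bijection [rV_cons], which is measurable
    and has a continuous inverse. *)
Lemma continuous_measurable_pair n (f : R * 'rV[R]_n -> R) : continuous f ->
  measurable_fun [set: measurableTypeR R * 'rV[R]_n] f.
Proof.
move=> cf; rewrite (_ : f = (fun x => f (rV_uncons x)) \o @rV_cons R n); last first.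
  by apply/funext => p /=; rewrite rV_consK.
apply: measurableT_comp; last exact: measurable_rV_cons.
by apply: continuous_measurable_rV; exact: (ct_comp cf (@ct_uncons n)).
Qed.

Lemma continuous_measurable_R (f : R -> R) : continuous f ->
  measurable_fun [set: measurableTypeR R] f.
Proof. exact: continuous_measurable_fun. Qed.

Lemma ct_cons n : continuous (fun p : R * 'rV[R]_n => @rV_cons R n p).
Proof.
apply: ct_row => i; have [k ->|->] := unliftP ord0 i.
  under eq_fun do rewrite mxE liftK.
  by apply: (ct_comp (@ct_coord n k)) => p; exact: cvg_snd.
under eq_fun do rewrite mxE unlift_none.
by move=> p; exact: cvg_fst.
Qed.

End row_vectors.

Section gaussian_integrals.
Context {R : realType}.
Local Notation leb := (@lebesgue_measure R).

(** This is the normalisation of the normal density with mean [m] and variance [(2 a)^-1]. *)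
Lemma integral_gaussian1 (a m : R) : 0 < a ->
  (\int[leb]_x (expR (- (a * (x - m) ^+ 2)))%:E)%E = (Num.sqrt (pi / a))%:E.
Proof.
move=> a0; pose s := Num.sqrt (2 * a)^-1.
have a20 : 0 < (2 * a)^-1 by rewrite invr_gt0 mulr_gt0.
have s0 : s != 0 by rewrite gt_eqF // sqrtr_gt0.
have s2 : s ^+ 2 = (2 * a)^-1 by rewrite sqr_sqrtr // ltW.
have pa0 : 0 < Num.sqrt (pi / a) by rewrite sqrtr_gt0 divr_gt0 // pi_gt0.
transitivity (\int[leb]_x ((Num.sqrt (pi / a))%:E * (normal_pdf m s x)%:E))%E.
  apply: eq_integral => x _; rewrite normal_pdfE //= -EFinM; congr EFin.
  rewrite /normal_peak /normal_fun s2.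
  have -> : (2 * a)^-1 * pi *+ 2 = pi / a.
    by rewrite -mulr_natr; field; rewrite gt_eqF.
  rewrite mulVKf ?gt_eqF //; congr expR.
  by rewrite -mulr_natr; field; rewrite gt_eqF.
rewrite ge0_integralZl_EFin ?ltW //; first by rewrite integral_normal_pdf mule1.
- by move=> x _; rewrite lee_fin normal_pdf_ge0.
- by apply/measurable_EFinP; exact: measurable_normal_pdf.
Qed.

Lemma ge0_integral_cons n (f : 'rV[R]_n.+1 -> \bar R) :
  measurable_fun setT f -> (forall x, 0 <= f x)%E ->
  (\int[lebesgue_rV R n.+1]_x f x =
   \int[leb]_x \int[lebesgue_rV R n]_y f (rV_cons (x, y)))%E.
Proof.
move=> mf f0; rewrite /= /cons_measure ge0_integral_pushforward //.
- rewrite preimage_setT fubini_tonelli1 //; last by move=> p; exact: f0.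
  by apply: measurableT_comp => //; exact: measurable_rV_cons.
- exact: measurable_rV_cons.
Qed.

Definition qform n (a m : 'I_n -> R) (x : 'rV[R]_n) : R :=
  \sum_(j < n) a j * (x 0 j - m j) ^+ 2.

Lemma ct_qform n (a m : 'I_n -> R) : continuous (qform a m).
Proof.
apply: ct_sum => i; apply: ctM; first exact: ct_cst.
by apply: ctX; apply: ctD; [exact: ct_coord|exact: ct_cst].
Qed.

Lemma qform_cons n (a m : 'I_n.+1 -> R) x y :
  qform a m (rV_cons (x, y)) = a ord0 * (x - m ord0) ^+ 2 +
    qform (fun j => a (lift ord0 j)) (fun j => m (lift ord0 j)) y.
Proof.
rewrite /qform big_ord_recl mxE unlift_none; congr (_ + _).
by apply: eq_bigr => j _; rewrite mxE liftK.
Qed.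

Lemma measurable_gaussian n (a m : 'I_n -> R) :
  measurable_fun setT (fun x : 'rV[R]_n => (expR (- qform a m x))%:E).
Proof.
apply/measurable_EFinP; apply: continuous_measurable_rV.
exact: (ct_expR (ctN (@ct_qform n a m))).
Qed.

Lemma integral_gaussian n (a m : 'I_n -> R) : (forall j, 0 < a j) ->
  (\int[lebesgue_rV R n]_x (expR (- qform a m x))%:E)%E =
  (\prod_(j < n) Num.sqrt (pi / a j))%:E.
Proof.
elim: n a m => [|n IH] a m a0.
  rewrite big_ord0 integral_dirac //; last exact: measurable_gaussian.
  by rewrite diracT mul1e /qform big_ord0 oppr0 expR0.
rewrite ge0_integral_cons; first last.
- by move=> x; rewrite lee_fin expR_ge0.
- exact: measurable_gaussian.
rewrite big_ord_recl EFinM.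
transitivity (\int[leb]_x ((\prod_(j < n) Num.sqrt (pi / a (lift ord0 j)))%:E *
    (expR (- (a ord0 * (x - m ord0) ^+ 2)))%:E))%E.
  apply: eq_integral => x _;
  rewrite -(IH _ (fun j => m (lift ord0 j))) // muleC -ge0_integralZl_EFin ?expR_ge0 //.
  - by apply: eq_integral => y _; rewrite qform_cons opprD expRD EFinM.
  - exact: measurable_gaussian.
rewrite ge0_integralZl_EFin ?prodr_ge0 //.
- by rewrite integral_gaussian1 // muleC.
- apply/measurable_EFinP; apply: continuous_measurable_R.
  apply: ct_expR; apply: ctN; apply: ctM; first exact: ct_cst.
  by apply: ctX; apply: ctD; [move=> x; exact: cvg_id|exact: ct_cst].
Qed.

Lemma integrable_gaussian n (a m : 'I_n -> R) : (forall j, 0 < a j) ->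
  (lebesgue_rV R n).-integrable setT (fun x => (expR (- qform a m x))%:E).
Proof.
move=> a0; apply/integrableP; split; first exact: measurable_gaussian.
under eq_integral do rewrite gee0_abs ?lee_fin ?expR_ge0 //.
by rewrite integral_gaussian // ltry.
Qed.

End gaussian_integrals.

Section scaling.
Context {R : realType}.
Local Notation leb := (@lebesgue_measure R).

Lemma measurable_scale n (c : R) :
  measurable_fun setT (fun x : 'rV[R]_n => c *: x).
Proof.
apply/measurable_fun_rVP => i; under eq_fun do rewrite mxE.
by apply: continuous_measurable_rV; apply: ctM; [exact: ct_cst|exact: ct_coord].
Qed.

Lemma measurable_mull (c : R) :
  measurable_fun [set: measurableTypeR R] (fun x : R => c * x : measurableTypeR R).
Proof.
by apply: continuous_measurable_R; apply: ctM; [exact: ct_cst|move=> x; exact: cvg_id].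
Qed.

(** The image of Lebesgue measure under [x -> c x], multiplied by [c], gives every interval its
    length, so it is Lebesgue measure by uniqueness. *)
Lemma ge0_integral_scale1 (c : R) (f : R -> \bar R) : 0 < c ->
  measurable_fun [set: measurableTypeR R] f -> (forall x, 0 <= f x)%E ->
  (\int[leb]_x f x = c%:E * \int[leb]_x f (c * x)%R)%E.
Proof.
move=> c0 mf f0.
have mc := @measurable_mull c.
have c0' : 0 <= c by exact: ltW.
pose push_ := (pushforward leb (fun x : measurableTypeR R => c * x : measurableTypeR R)
  : {measure set (measurableTypeR R) -> \bar R}).
pose push := push_ mc.
pose nu := (mscale (NngNum c0') push : {measure set (measurableTypeR R) -> \bar R}).
have lebnu : forall A, measurable A -> leb A = nu A.
  apply: lebesgue_measure_unique => _ [[a b] _ <-].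
  transitivity (c%:E * leb `]a / c, b / c]%classic%R)%E; last first.
    congr (_ * leb _)%E.
    apply/seteqP; split => x /=; rewrite !in_itv/= ltr_pdivrMr // ler_pdivlMr //.
      by rewrite [x * c]mulrC.
    by rewrite [x * c]mulrC.
  rewrite !lebesgue_measure_itv/= !lte_fin ltr_pM2r ?invr_gt0 //.
  case: ifPn => _; last by rewrite mule0.
  by rewrite -!EFinD -EFinM -mulrBl mulrC divfK ?gt_eqF.
rewrite (eq_measure_integral nu) => [|A mA _]; last exact: lebnu.
by rewrite ge0_integral_mscale //= ge0_integral_pushforward.
Qed.

Lemma ge0_integral_scale n (c : R) (f : 'rV[R]_n -> \bar R) : 0 < c ->
  measurable_fun setT f -> (forall x, 0 <= f x)%E ->
  (\int[lebesgue_rV R n]_x f x =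
    (c ^+ n)%:E * \int[lebesgue_rV R n]_x f (c *: x)%R)%E.
Proof.
move=> c0; elim: n f => [|n IH] f mf f0.
  rewrite expr0 mul1e; apply: eq_integral => x _.
  by congr f; apply/rowP => -[].
have mfc (x : R) : measurable_fun setT (fun y : 'rV[R]_n => f (rV_cons (x, y))).
  have := measurableT_comp mf (@measurable_rV_cons R n).
  by move=> /(measurableT_comp); apply; exact: measurable_pair1.
rewrite ge0_integral_cons // [X in (_ * X)%E]ge0_integral_cons //; last first.
  by apply: measurableT_comp => //; exact: measurable_scale.
have mF : measurable_fun [set: measurableTypeR R]
    (fun x => \int[lebesgue_rV R n]_y f (rV_cons (x, y)))%E.
  have := @measurable_fun_fubini_tonelli_F _ _ (measurableTypeR R) _ R (lebesgue_rV R n)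
    (fun p => f (rV_cons p)).
  by apply=> //; apply: measurableT_comp => //; exact: measurable_rV_cons.
rewrite [LHS](ge0_integral_scale1 c0) //; last by move=> x; exact: integral_ge0.
have e (x : R) : (\int[lebesgue_rV R n]_y f (rV_cons ((c * x)%R, y)) =
    (c ^+ n)%:E * \int[lebesgue_rV R n]_y f (c *: rV_cons (x, y))%R)%E.
  rewrite IH //; congr (_ * _)%E; apply: eq_integral => y _; congr f.
  by apply/rowP => j; rewrite !mxE; case: (unlift ord0 j) => [k|]; rewrite ?mxE.
under eq_integral do rewrite e.
rewrite ge0_integralZl_EFin ?exprn_ge0 ?ltW //.
- by rewrite muleA -EFinM exprS.
- by move=> x _; exact: integral_ge0.
- have := @measurable_fun_fubini_tonelli_F _ _ (measurableTypeR R) _ R (lebesgue_rV R n)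
    (fun p => f (c *: rV_cons p)).
  apply=> //; apply: (measurableT_comp mf).
  by apply: (measurableT_comp (@measurable_scale _ c)); exact: measurable_rV_cons.
Qed.

(** The scaling formula applied to the indicator of a null set shows that its preimage is null.
    Needed because [v] at [y] is read from [u] at [tau y]. *)
Lemma ae_scale n (c : R) (P : 'rV[R]_n -> Prop) : 0 < c ->
  {ae lebesgue_rV R n, forall x, P x} ->
  {ae lebesgue_rV R n, forall x, P (c *: x)}.
Proof.
move=> c0 [N [mN N0 PN]].
exists ((fun x => c *: x) @^-1` N); split.
- by rewrite -[X in measurable X]setTI; exact: measurable_scale.
- have mI : measurable_fun setT (fun x => (\1_N x)%:E : \bar R).
    by apply/measurable_EFinP; exact: measurable_indic.
  have I0 x : (0 <= (\1_N x)%:E :> \bar R)%E by rewrite lee_fin.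
  have i1 : (\int[lebesgue_rV R n]_x (\1_N x)%:E)%E = 0%E.
    by rewrite integral_indic // setIT.
  have i2 : (\int[lebesgue_rV R n]_x (\1_N (c *: x))%:E)%E =
      lebesgue_rV R n ((fun x => c *: x) @^-1` N).
    rewrite -[X in lebesgue_rV R n X]setIT -integral_indic //.
    by rewrite -[X in measurable X]setTI; exact: measurable_scale.
  have /esym/eqP := ge0_integral_scale c0 mI I0; rewrite i1 i2.
  by rewrite mule_eq0 eqe expf_eq0 (gt_eqF c0) andbF /= => /eqP.
- by move=> x nP; apply: PN.
Qed.

End scaling.

(** * Integrals of derivatives of compactly supported functions *)

Section divergence.
Context {R : realType}.
Local Notation leb := (@lebesgue_measure R).

Lemma divergence1 (F G : R -> R) (M : R) :
  (forall x : R, is_derive x 1 F (G x)) -> continuous G ->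
  (forall x, M < `|x| -> F x = 0) -> (forall x, M < `|x| -> G x = 0) ->
  (\int[leb]_x (G x)%:E)%E = 0%E.
Proof.
(* [N] is positive and strictly larger than [M], whatever the sign of [M], so [F] already vanishes
   at both ends of [[-N, N]]. *)
move=> dF cG F0 G0; pose N := `|M| + 1.
have MN : M < N by rewrite (le_lt_trans (ler_norm M)) // ltrDl.
have N0 : 0 < N by rewrite ltr_wpDl.
have NN : - N < N by lra.
transitivity (\int[leb]_(x in `[(- N)%R, N]) (G x)%:E)%E.
  rewrite [RHS]integral_mkcond; apply: eq_integral => x _.
  rewrite patchE; case: ifPn => //; rewrite notin_setE /= in_itv/= => /negP.
  by rewrite -ler_norml -ltNge => xN; rewrite G0 // (lt_trans MN).
rewrite (continuous_FTC2 (F := F)) //.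
- by rewrite !F0 ?normrN ?gtr0_norm // subee.
- exact: continuous_subspaceT.
- have cF x : {for x, continuous F} by exact: der_continuous (dF x).
  split.
  + by move=> x _; have [] := dF x.
  + by apply: cvg_at_right_filter; exact: cF.
  + by apply: cvg_at_left_filter; exact: cF.
- by move=> x _; rewrite derive1E; have [_ ->] := dF x.
Qed.

(** A cube is used as support because slices along coordinates inherit the same constants [C] and
    [M], which the induction on the dimension needs. *)
Definition box_supported n (f : 'rV[R]_n -> R) (C M : R) :=
  [/\ continuous f, forall x, `|f x| <= C &
    forall (x : 'rV[R]_n) i, M < `|x 0 i| -> f x = 0].

Lemma box_supported_measurable n (f : 'rV[R]_n -> R) C M :
  box_supported f C M -> measurable_fun setT f.
Proof. by move=> [cf _ _]; exact: continuous_measurable_rV. Qed.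

Lemma integrable_box_supported n (f : 'rV[R]_n -> R) C M :
  box_supported f C M -> (lebesgue_rV R n).-integrable setT (EFin \o f).
Proof.
move=> bf; have [cf fC f0] := bf.
pose A := [set x : 'rV[R]_n | forall i, `[- M, M]%classic (x 0 i)].
have mA : measurable A.
  rewrite (_ : A = \bigcap_(i in [set: 'I_n]) ((fun x : 'rV[R]_n => x 0 i) @^-1` `[- M, M])).
    apply: fin_bigcap_measurable => [|i _]; first exact: finite_finset.
    rewrite -[X in measurable X]setTI; apply: measurable_rV_coord => //.
  by apply/seteqP; split=> [x Bx i _|x Bx i]; [exact: Bx|exact: (Bx i I)].
have mf := box_supported_measurable bf.
have fA : (lebesgue_rV R n).-integrable A (EFin \o f).
  apply: measurable_bounded_integrable => //.
  - have := @lebesgue_rV_box R n (fun=> `[- M, M]%classic) (fun=> measurable_itv _).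
    rewrite [X in X = _ -> _](_ : _ = lebesgue_rV R n A) // => AE.
    rewrite [X in (X < _)%E]AE.
    rewrite lebesgue_measure_itv/=; set c := (if _ then _ else _).
    have cfin : c \is a fin_num by rewrite /c; case: ifPn.
    have : (\prod_(i < n) c)%E \is a fin_num.
      by apply: (big_ind (fun z => z \is a fin_num)) => // a b; exact: fin_numM.
    by move=> /fineK <-; exact: ltry.
  - exact: measurable_funTS.
  - exists C; split; first exact: num_real.
    by move=> K CK x _; exact: le_trans (fC x) (ltW CK).
have := (integrable_mkcond (EFin \o f) mA).1 fA.
congr (_.-integrable _ _); apply/funext => x; rewrite patchE.
case: ifPn => //; rewrite notin_setE => nA.
have /existsNP[i xi] : ~ forall i, `[- M, M]%classic (x 0 i) by [].
apply/esym; congr EFin; apply: (f0 x i).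
by rewrite ltNge ler_norml; apply/negP => h; apply: xi; rewrite /= in_itv.
Qed.

Let cons_coord0 n (a : R) (y : 'rV[R]_n) : (rV_cons (a, y)) 0 ord0 = a.
Proof. by rewrite mxE unlift_none. Qed.

Let cons_coordS n (a : R) (y : 'rV[R]_n) j : (rV_cons (a, y)) 0 (lift ord0 j) = y 0 j.
Proof. by rewrite mxE liftK. Qed.

Lemma ct_consl n (a : R) : continuous (fun y : 'rV[R]_n => rV_cons (a, y)).
Proof.
apply: ct_row => i; have [k ->|->] := unliftP ord0 i.
  by under eq_fun do rewrite cons_coordS; exact: ct_coord.
by under eq_fun do rewrite cons_coord0; exact: ct_cst.
Qed.

Lemma ct_consr n (y : 'rV[R]_n) : continuous (fun a : R => rV_cons (a, y)).
Proof.
apply: ct_row => i; have [k ->|->] := unliftP ord0 i.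
  by under eq_fun do rewrite cons_coordS; exact: ct_cst.
by under eq_fun do rewrite cons_coord0; move=> a; exact: cvg_id.
Qed.

(** Induction on the dimension with Fubini. If [j] is the first coordinate, it is integrated
    innermost and [divergence1] applies; otherwise the first coordinate is frozen and the inner
    integral vanishes by induction. *)
Lemma divergence_rV n (j : 'I_n) (F G : 'rV[R]_n -> R) (C M : R) :
  (forall x, is_derive x (unit_vec R j) F (G x)) ->
  box_supported G C M -> (forall (x : 'rV[R]_n) i, M < `|x 0 i| -> F x = 0) ->
  (\int[lebesgue_rV R n]_x (G x)%:E)%E = 0%E.
Proof.
elim: n j F G => [[]//|n IH] j F G dF bG F0.
have [cG GC G0] := bG.
have iG := integrable_box_supported bG.
have mG := box_supported_measurable bG.
have mGc : measurable_fun setT ((EFin \o G) \o @rV_cons R n).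
  by apply: measurableT_comp; [exact/measurable_EFinP|exact: measurable_rV_cons].
have iGc : (leb \x lebesgue_rV R n)%E.-integrable setT ((EFin \o G) \o @rV_cons R n).
  apply/integrableP; split => //.
  move/integrableP : iG => [_]; rewrite /= /cons_measure ge0_integral_pushforward //.
  - exact: measurable_rV_cons.
  - by apply/measurable_EFinP; exact: measurableT_comp.
rewrite /= /cons_measure (integral_pushforward (@measurable_rV_cons R n)) //=; last first.
  exact/measurable_EFinP.
rewrite preimage_setT.
have [k jE|jE] := unliftP ord0 j; rewrite jE in dF.
  rewrite -integral12_prod_meas1 // -[RHS](@integral0 _ _ _ leb setT).
  apply: eq_integral => a _; apply: (IH k (fun y => F (rV_cons (a, y)))).
  - move=> y; apply/is_derive_line; move/is_derive_line : (dF (rV_cons (a, y))).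
    congr is_derive; apply/funext => h; congr F; apply/rowP => i; rewrite !mxE.
    case: (unliftP ord0 i) => [l ->|->].
      by rewrite !mxE (inj_eq lift_inj).
    by rewrite mulr0 add0r.
  - split => [|y|y i Mi]; [|exact: GC|].
      by move=> y; apply: continuous_comp; [exact: ct_consl|exact: cG].
    by apply: (G0 _ (lift ord0 i)); rewrite cons_coordS.
  - by move=> y i Mi; apply: (F0 _ (lift ord0 i)); rewrite cons_coordS.
rewrite -integral21_prod_meas1 // -[RHS](@integral0 _ _ _ (lebesgue_rV R n) setT).
apply: eq_integral => y _.
apply: (@divergence1 (fun a => F (rV_cons (a, y))) (fun a => G (rV_cons (a, y))) M).
- move=> a; apply/is_derive_line; move/is_derive_line : (dF (rV_cons (a, y))).
  congr is_derive; apply/funext => h; congr F; apply/rowP => i; rewrite !mxE.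
  case: (unliftP ord0 i) => [l ->|->]; last by [].
  by rewrite mulr0 add0r.
- by move=> a; apply: continuous_comp; [exact: ct_consr|exact: cG].
- by move=> a Ma; apply: (F0 _ ord0); rewrite cons_coord0.
- by move=> a Ma; apply: (G0 _ ord0); rewrite cons_coord0.
Qed.

Lemma compact_bound {T : topologicalType} (K : set T) (g : T -> R) :
  compact K -> continuous g -> exists C, forall x, K x -> `|g x| <= C.
Proof.
move=> cK cg; have cgK : compact (g @` K).
  by apply: continuous_compact => //; exact: continuous_subspaceT.
have [N [_ hN]] := compact_bounded cgK.
exists (N + 1) => x Kx; apply: hN; last by exists x.
by rewrite ltrDl.
Qed.

Lemma supported_bound {T : topologicalType} (K : set T) (f : T -> R) :
  compact K -> continuous f -> (forall x, ~ K x -> f x = 0) ->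
  exists C, forall x, `|f x| <= C.
Proof.
move=> cK cf f0; have [C HC] := compact_bound cK cf.
exists `|C| => x; have [Kx|nKx] := pselect (K x).
  exact: le_trans (HC x Kx) (ler_norm C).
by rewrite f0 // normr0.
Qed.

Lemma supported_box {T : topologicalType} n (K : set T) (f : T -> R)
    (g : 'I_n -> T -> R) :
  compact K -> (forall i, continuous (g i)) -> (forall x, ~ K x -> f x = 0) ->
  exists M, forall x i, M < `|g i x| -> f x = 0.
Proof.
move=> cK cg f0.
have /choice[C HC] : forall i, exists C, forall x, K x -> `|g i x| <= C.
  by move=> i; exact: compact_bound.
exists (\sum_i `|C i|) => x i Mx; apply: f0 => Kx.
move: Mx; rewrite ltNge => /negP; apply.
rewrite (le_trans (HC i x Kx)) // (le_trans (ler_norm _)) // (bigD1 i) //=.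
by rewrite lerDl sumr_ge0.
Qed.

Lemma compactly_supported_box n (K : set 'rV[R]_n) (f : 'rV[R]_n -> R) :
  compact K -> continuous f -> (forall x, ~ K x -> f x = 0) ->
  exists C M, box_supported f C M.
Proof.
move=> cK cf f0.
have [C HC] := supported_bound cK cf f0.
have [M HM] := supported_box cK (@ct_coord R n) f0.
by exists C, M; split.
Qed.

Lemma compactly_supported_box2 n (K : set (R * 'rV[R]_n)) (f : R * 'rV[R]_n -> R) :
  compact K -> continuous f -> (forall x, ~ K x -> f x = 0) ->
  exists C M, box_supported (fun x => f (@rV_uncons R n x)) C M.
Proof.
move=> cK cf f0.
have [C HC] := supported_bound cK cf f0.
have [M HM] := supported_box cK
  (fun i => ct_comp (@ct_coord R n.+1 i) (@ct_cons R n)) f0.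
exists C, M; split => // [|x i Mx].
  by move=> x; apply: continuous_comp; [exact: ct_uncons|exact: cf].
apply: (HM _ i); rewrite (_ : rV_cons _ = x) //; apply/rowP => k.
by rewrite mxE /=; case: (unliftP ord0 k) => [l ->|->]; rewrite ?mxE.
Qed.

Section space_time.
Variables (n : nat) (f : R * 'rV[R]_n -> R) (C M : R).
Hypothesis bf : box_supported (fun x => f (@rV_uncons R n x)) C M.
Local Notation leb_tx := ((leb \x lebesgue_rV R n)%E).

Let fE : f = (fun x => f (@rV_uncons R n x)) \o @rV_cons R n.
Proof. by apply/funext => p /=; rewrite rV_consK. Qed.

Lemma measurable_space_time : measurable_fun setT f.
Proof.
rewrite fE; apply: measurableT_comp; last exact: measurable_rV_cons.
exact: box_supported_measurable bf.
Qed.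

Lemma integrable_space_time : leb_tx.-integrable setT (EFin \o f).
Proof.
apply/integrableP; split; first by apply/measurable_EFinP; exact: measurable_space_time.
have /integrableP[_] := integrable_box_supported bf.
rewrite /= /cons_measure ge0_integral_pushforward //.
- rewrite preimage_setT; congr (_ < _)%E; apply: eq_integral => p _ /=.
  by rewrite rV_consK.
- exact: measurable_rV_cons.
- apply/measurable_EFinP; apply: measurableT_comp => //.
  exact: box_supported_measurable bf.
Qed.

Lemma integral_space_time :
  (\int[leb_tx]_p (f p)%:E)%E =
  (\int[lebesgue_rV R n.+1]_x (f (rV_uncons x))%:E)%E.
Proof.
rewrite /= /cons_measure (integral_pushforward (@measurable_rV_cons R n)) //=.
- by rewrite preimage_setT; apply: eq_integral => p _ /=; rewrite rV_consK.
- by apply/measurable_EFinP; exact: box_supported_measurable bf.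
- rewrite preimage_setT; congr (_.-integrable _ _) : integrable_space_time.
  by apply/funext => p /=; rewrite rV_consK.
Qed.

End space_time.

(** Space-time is read as row vectors of length [n + 1] with time as coordinate 0, so time and space
    derivatives are both instances of [divergence_rV]. *)
Lemma divergence_space_time n (v : R * 'rV[R]_n) (j : 'I_n.+1)
    (F G : R * 'rV[R]_n -> R) (C M : R) :
  v = @rV_uncons R n (unit_vec R j) ->
  (forall p, is_derive p v F (G p)) ->
  box_supported (fun x => G (@rV_uncons R n x)) C M ->
  (forall (x : 'rV[R]_n.+1) i, M < `|x 0 i| -> F (rV_uncons x) = 0) ->
  (\int[(leb \x lebesgue_rV R n)%E]_p (G p)%:E)%E = 0%E.
Proof.
move=> vE dF bG F0; rewrite (integral_space_time bG).
apply: (divergence_rV (F := fun x => F (rV_uncons x)) (j := j) _ bG) => // x.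
apply/is_derive_line; move/is_derive_line : (dF (rV_uncons x)).
congr is_derive; apply/funext => h; congr F; rewrite vE /rV_uncons.
congr pair; first by rewrite /= !mxE.
by apply/rowP => k; rewrite !mxE.
Qed.

End divergence.

(** * Dominated convergence with a real parameter *)

Section dominated.
Context {R : realType} d (T : measurableType d) (mu : {measure set T -> \bar R}).

Lemma Rintegral_EFin (f : T -> R) : mu.-integrable setT (EFin \o f) ->
  (\int[mu]_x (f x)%:E)%E = (\int[mu]_x f x)%:E.
Proof. by move=> intf; rewrite /Rintegral fineK //; exact: integrable_fin_num. Qed.

Lemma dominated_integrable (f g : T -> R) : measurable_fun setT f ->
  mu.-integrable setT (EFin \o g) -> (forall x, `|f x| <= g x) ->
  mu.-integrable setT (EFin \o f).
Proof.
move=> mf ig fg; apply: le_integrable ig => //; first exact/measurable_EFinP.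
move=> x _ /=; rewrite lee_fin (le_trans (fg x)) //; exact: ler_norm.
Qed.

Variables (F : set_system R).
Context {FF : Filter F}.
(* Dominated convergence is available for sequences only. *)
Hypothesis seqF : forall (h : R -> R) (l : R),
  (forall u : nat -> R, u n @[n --> \oo] --> F -> h (u n) @[n --> \oo] --> l) ->
  h t @[t --> F] --> l.

Lemma dominated_cvg_param (f : R -> T -> R) (l g : T -> R) :
  (forall t, measurable_fun setT (f t)) -> measurable_fun setT l ->
  mu.-integrable setT (EFin \o g) ->
  (\forall t \near F, forall x, `|f t x| <= g x) ->
  (forall x, f t x @[t --> F] --> l x) ->
  (\int[mu]_x f t x)%R @[t --> F] --> (\int[mu]_x l x)%R.
Proof.
move=> mf ml ig fg fl; apply: seqF => u uF.
(* The domination is only eventual along [F]; dropping the first [N] terms makes it hold at every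
   index. *)
have [N _ hN] := uF _ fg.
pose h n x := f (u (n + N)%N) x.
have hg n x : `|h n x| <= g x by apply: hN => /=; exact: leq_addl.
have hl x : h n x @[n --> \oo] --> l x.
  rewrite (_ : (fun n => h n x) = (fun n => (f ^~ x \o u) (n + N)%N)) //.
  by rewrite (cvg_shiftn N); apply: (cvg_comp _ _ uF); exact: fl.
have hlE x : (h n x)%:E @[n --> \oo] --> (l x)%:E.
  by apply: cvg_EFin; [exact: nearW|exact: hl].
have [il _ cl] := @dominated_convergence _ _ _ mu setT measurableT
  (fun n => EFin \o h n) (EFin \o l) (EFin \o g)
  (fun n => (measurable_EFinP _ _).2 (mf _)) ((measurable_EFinP _ _).2 ml)
  (aeW mu (fun x _ => hlE x)) ig
  (aeW mu (fun x n _ => hg n x)).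
rewrite -(cvg_shiftn N); apply: fine_cvg; rewrite fineK //.
exact: (integrable_fin_num _ il).
Qed.

End dominated.

Section dominated_instances.
Context {R : realType} d (T : measurableType d) (mu : {measure set T -> \bar R}).
Variables (f : R -> T -> R) (l g : T -> R).
Hypotheses (mf : forall t, measurable_fun setT (f t)) (ml : measurable_fun setT l).
Hypothesis ig : mu.-integrable setT (EFin \o g).

Lemma dominated_cvg_at (t0 : R) :
  (\forall t \near t0, forall x, `|f t x| <= g x) ->
  (forall x, f t x @[t --> t0] --> l x) ->
  (\int[mu]_x f t x)%R @[t --> t0] --> (\int[mu]_x l x)%R.
Proof.
move=> fg fl.
have seq (h : R -> R) (a : R) : (forall u : nat -> R,
    u n @[n --> \oo] --> t0 -> h (u n) @[n --> \oo] --> a) -> h t @[t --> t0] --> a.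
  exact: (@cvg_nbhsP R R^o h t0 a).2.
exact: (dominated_cvg_param seq mf ml ig fg fl).
Qed.

Lemma dominated_cvgy :
  (\forall t \near +oo, forall x, `|f t x| <= g x) ->
  (forall x, f t x @[t --> +oo] --> l x) ->
  (\int[mu]_x f t x)%R @[t --> +oo] --> (\int[mu]_x l x)%R.
Proof.
move=> fg fl.
exact: (dominated_cvg_param (fun h a => (cvg_pinftyP h a).2) mf ml ig fg fl).
Qed.

End dominated_instances.

(** * Weak formulations *)

Section L2norm.
Context {R : realType} d (T : measurableType d) (mu : {measure set T -> \bar R}).
Implicit Types f : T -> R[i].

Lemma normc_ge0 (z : R[i]) : 0 <= normc z.
Proof. by case: z => a b; exact: sqrtr_ge0. Qed.

Lemma sqr_normc (z : R[i]) : normc z ^+ 2 = complex.Re z ^+ 2 + complex.Im z ^+ 2.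
Proof. by case: z => a b /=; rewrite sqr_sqrtr // addr_ge0 ?sqr_ge0. Qed.

Lemma L2norm_poweR f :
  (L2norm mu f `^ 2 = \int[mu]_x (normc (f x) ^+ 2)%:E)%E.
Proof.
rewrite /L2norm poweR_Lnorm ?pnatr_eq0 //; apply: eq_integral => x _.
by rewrite gee0_abs ?lee_fin ?normc_ge0 // poweR_EFin powR_mulrn ?normc_ge0.
Qed.

Lemma L2norm_sqr f : (L2norm mu f ^+ 2 = \int[mu]_x (normc (f x) ^+ 2)%:E)%E.
Proof.
rewrite -L2norm_poweR; have : (0 <= L2norm mu f)%E by exact: Lnorm_ge0.
case: (L2norm mu f) => [r| |] //.
  by rewrite lee_fin => r0; rewrite poweR_EFin powR_mulrn // EFin_expe.
by rewrite poweRyr ?pnatr_eq0.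
Qed.

Lemma L2norm_EFin f (r : R) : (\int[mu]_x (normc (f x) ^+ 2)%:E = r%:E)%E ->
  L2norm mu f = (Num.sqrt r)%:E.
Proof.
move=> fr; have N0 : (0 <= L2norm mu f)%E by exact: Lnorm_ge0.
have := L2norm_sqr f; rewrite fr; case: (L2norm mu f) N0 => [a| |] //.
rewrite lee_fin -EFin_expe => a0 [<-].
by rewrite sqrtr_sqr ger0_norm.
Qed.

End L2norm.

Section test_function_theory.
Context {R : realType} (V : normedModType R) (phi : V -> R).
Hypothesis tphi : test_function phi.

Lemma test_function_continuous vs : continuous (iter_derive vs phi).
Proof. by have [/(_ vs)[]] := tphi. Qed.

Lemma test_function_derive vs (x v : V) :
  is_derive x v (iter_derive vs phi) (iter_derive (v :: vs) phi x).
Proof. by have [/(_ vs)[_ h] _] := tphi; exact/derivableP/h. Qed.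

(** One compact set serves all derivatives: its complement is open, so [phi] vanishes in a
    neighbourhood of each outside point and every derivative is zero there. *)
Lemma test_function_supported : exists2 K : set V, compact K &
  forall vs x, ~ K x -> iter_derive vs phi x = 0.
Proof.
have [_ [K cK K0]] := tphi; exists K => //.
have oK : open (~` K) by apply: closed_openC; apply: compact_closed => //; exact: norm_hausdorff.
elim=> [|v vs IH] x Kx; first exact: K0.
rewrite /= -(@derive_val _ _ _ x v (cst 0) 0).
apply: near_eq_derive; have : nbhs x (~` K) by exact: open_nbhs_nbhs.
by apply: filterS => y /IH.
Qed.

End test_function_theory.

Section supported.
Context {R : realType} (n : nat).
Local Notation leb := (@lebesgue_measure R).
Local Notation leb_tx := ((leb \x lebesgue_rV R n)%E).

Definition supported {V : topologicalType} (K : set V) (f : V -> R) :=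
  continuous f /\ forall x, ~ K x -> f x = 0.

Lemma supportedM {V : topologicalType} (K : set V) (f g : V -> R) :
  continuous f -> supported K g -> supported K (fun x => f x * g x).
Proof.
move=> cf [cg g0]; split; first exact: ctM.
by move=> x Kx; rewrite g0 // mulr0.
Qed.

Lemma supportedD {V : topologicalType} (K : set V) (f g : V -> R) :
  supported K f -> supported K g -> supported K (fun x => f x + g x).
Proof.
move=> [cf f0] [cg g0]; split; first exact: ctD.
by move=> x Kx; rewrite f0 // g0 // addr0.
Qed.

Lemma supported_sum {V : topologicalType} (K : set V) m (f : 'I_m -> V -> R) :
  (forall i, supported K (f i)) -> supported K (fun x => \sum_(i < m) f i x).
Proof.
move=> fK; split; first by apply: ct_sum => i; have [] := fK i.
by move=> x Kx; rewrite big1 // => i _; have [_ ->] := fK i.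
Qed.

Variable K : set (R * 'rV[R]_n).
Hypothesis cK : compact K.

Lemma integrable_supported_space_time (f : R * 'rV[R]_n -> R) :
  supported K f -> leb_tx.-integrable setT (EFin \o f).
Proof.
move=> [cf f0]; have [C [M bf]] := compactly_supported_box2 cK cf f0.
exact: integrable_space_time bf.
Qed.

Lemma divergence_supported_space_time (v : R * 'rV[R]_n) (j : 'I_n.+1)
    (F G : R * 'rV[R]_n -> R) : v = @rV_uncons R n (unit_vec R j) ->
  (forall p, is_derive p v F (G p)) -> supported K F -> supported K G ->
  (\int[leb_tx]_p (G p) = 0)%R.
Proof.
move=> vE dF [cF F0] [cG G0].
have [C [M [cG' GC G'0]]] := compactly_supported_box2 cK cG G0.
have [C' [M' [_ _ F'0]]] := compactly_supported_box2 cK cF F0.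
rewrite /Rintegral (@divergence_space_time R n v j F G C (Num.max M M') vE dF) //.
- split => // x i; rewrite gt_max => /andP[Mx _]; exact: (G'0 x i).
- by move=> x i; rewrite gt_max => /andP[_ Mx]; exact: (F'0 x i).
Qed.

Lemma Rintegral0D (f g : R * 'rV[R]_n -> R) : supported K f -> supported K g ->
  (\int[leb_tx]_p g p = 0)%R ->
  (\int[leb_tx]_p (f p + g p) = \int[leb_tx]_p f p)%R.
Proof.
move=> sf sg g0; rewrite RintegralD ?g0 ?addr0 //.
- exact: integrable_supported_space_time.
- exact: integrable_supported_space_time.
Qed.

Lemma Rintegral0_sum m (f : 'I_m -> R * 'rV[R]_n -> R) :
  (forall i, supported K (f i)) -> (forall i, (\int[leb_tx]_p f i p = 0)%R) ->
  (\int[leb_tx]_p (\sum_(i < m) f i p) = 0)%R.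
Proof.
elim: m f => [|m IH] f sf f0.
  by rewrite /Rintegral; under eq_integral do rewrite big_ord0; rewrite integral0.
rewrite -[RHS](f0 ord0); under eq_Rintegral do rewrite big_ord_recl.
apply: Rintegral0D => //; last exact: IH.
exact: supported_sum.
Qed.

End supported.

Section weak_form.
Context {R : realType} (n : nat).
Local Notation leb_tx := ((@lebesgue_measure R \x lebesgue_rV R n)%E).
Local Notation et := ((1, 0) : R * 'rV[R]_n).
Local Notation ex j := ((0, unit_vec R j) : R * 'rV[R]_n).
Variables (P Q S Qt : R * 'rV[R]_n -> R) (Pj Pjj : 'I_n -> R * 'rV[R]_n -> R).
Hypotheses (cP : continuous P) (cQ : continuous Q) (cS : continuous S)
  (cQt : continuous Qt) (cPj : forall j, continuous (Pj j))
  (cPjj : forall j, continuous (Pjj j)).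
Hypotheses (dQ : forall p, is_derive p et Q (Qt p))
  (dP : forall j p, is_derive p (ex j) P (Pj j p))
  (dPj : forall j p, is_derive p (ex j) (Pj j) (Pjj j p)).
Hypothesis pde : forall p, - Qt p + 2^-1 * \sum_(j < n) Pjj j p = S p.

Let et_uncons : et = @rV_uncons R n (unit_vec R ord0).
Proof.
rewrite /rV_uncons; congr pair; first by rewrite mxE.
by apply/rowP => k; rewrite !mxE.
Qed.

Let ex_uncons j : ex j = @rV_uncons R n (unit_vec R (lift ord0 j)).
Proof.
rewrite /rV_uncons; congr pair; first by rewrite mxE.
by apply/rowP => k; rewrite !mxE (inj_eq lift_inj).
Qed.

(** The equation [pde] is the real part of [i u_t + Delta u / 2] for [u = P + i Q]. Stated for real
    functions so that the imaginary part follows by using it with [Im u] and [- Re u] in place of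
    [P] and [Q]. *)
Lemma weak_form phi : test_function phi ->
  (\int[leb_tx]_p (P p * (2^-1 * laplacian phi p) + Q p * dt phi p) =
   \int[leb_tx]_p (S p * phi p))%R.
Proof.
move=> tphi; have [K cK K0] := test_function_supported tphi.
have sd vs : supported K (iter_derive vs phi).
  by split; [exact: test_function_continuous|exact: K0].
have dphi vs p v := test_function_derive tphi vs p v.
(* The two integrands differ by exact derivatives: [G j] is half the derivative of
   [P phi_j - P_j phi] along [x_j], and [G0] is the time derivative of [Q phi]. *)
pose G j p := 2^-1 * (P p * dx j (dx j phi) p - Pjj j p * phi p).
pose G0 p := Qt p * phi p + Q p * dt phi p.
have sG j : supported K (G j).
  apply: supportedM; first exact: ct_cst.
  apply: supportedD; first exact: supportedM (sd [:: ex j; ex j]).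
  under eq_fun do rewrite -mulNr.
  by apply: supportedM (sd [::]); exact: ctN.
have sG0 : supported K G0.
  by apply: supportedD; [exact: supportedM (sd [::])|exact: supportedM (sd [:: et])].
have iG j : (\int[leb_tx]_p G j p = 0)%R.
  apply: (divergence_supported_space_time cK (ex_uncons j)
    (F := fun p => 2^-1 * (P p * dx j phi p - Pj j p * phi p))) => //.
  - move=> p; apply: (der_eq (derMl 2^-1 (derB (derM (dP j p) (dphi [:: ex j] p (ex j)))
      (derM (dPj j p) (dphi [::] p (ex j)))))).
    by rewrite /G /dx /=; ring.
  - apply: supportedM; first exact: ct_cst.
    apply: supportedD; first exact: supportedM (sd [:: ex j]).
    under eq_fun do rewrite -mulNr.
    by apply: supportedM (sd [::]); exact: ctN.
have iG0 : (\int[leb_tx]_p G0 p = 0)%R.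
  apply: (divergence_supported_space_time cK et_uncons (F := fun p => Q p * phi p)) => //.
    by move=> p; exact: (derM (dQ p) (dphi [::] p et)).
  exact: supportedM (sd [::]).
have sS : supported K (fun p => S p * phi p) by exact: supportedM (sd [::]).
rewrite -[RHS](Rintegral0D cK sS (supportedD (supported_sum sG) sG0)); last first.
  rewrite -[RHS]iG0; under eq_Rintegral do rewrite addrC.
  by apply: (Rintegral0D cK sG0 (supported_sum sG)); exact: (Rintegral0_sum cK).
apply: eq_Rintegral => p _; rewrite -pde /G /G0 -mulr_sumr big_split /= sumrN.
by rewrite -mulr_sumr -mulr_suml /laplacian; ring.
Qed.

End weak_form.

Section product_derivatives.
Context {R : realType} (n : nat).
Implicit Types (p v : R * 'rV[R]_n).

Lemma der_affine (a b t : R) : is_derive t 1 (fun h : R => h * a + b) a.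
Proof.
apply: (der_eq (derD (derMr a (is_derive_id t (1:R))) (der_cst b t _))).
by rewrite addr0 mul1r.
Qed.

Lemma der_fst p v : is_derive p v (fun p => p.1 : R) v.1.
Proof. by apply/is_derive_line; exact: der_affine. Qed.

Lemma der_coord p v j : is_derive p v (fun p => p.2 0 j) (v.2 0 j).
Proof.
apply/is_derive_line; rewrite (_ : (fun _ => _) = fun h : R => h * v.2 0 j + p.2 0 j).
  exact: der_affine.
by apply/funext => h /=; rewrite !mxE.
Qed.

Lemma der_time (f : R -> R) (a : R) p v : is_derive p.1 1 f a ->
  is_derive p v (fun p => f p.1) (a * v.1).
Proof. by move=> fa; exact: (der_comp fa (der_fst p v)). Qed.

Lemma ct_time (f : R -> R) : continuous f ->
  continuous (fun p : R * 'rV[R]_n => f p.1).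
Proof. by move=> cf; apply: ct_comp => // p; exact: cvg_fst. Qed.

Lemma ct_space (f : 'rV[R]_n -> R) : continuous f ->
  continuous (fun p : R * 'rV[R]_n => f p.2).
Proof. by move=> cf; apply: ct_comp => // p; exact: cvg_snd. Qed.

End product_derivatives.

(** * Gaussian waves *)

Section wave_equation.
Context {R : realType} (n : nat).
Local Notation Rn := 'rV[R]_n.
Local Notation et := ((1, 0) : R * Rn).
Local Notation ex j := ((0, unit_vec R j) : R * Rn).
Variables (lam c0 : R) (x0 : 'I_n -> R) (s ds : 'I_n -> R -> R) (th : R -> R).
Hypotheses (s0 : forall j t, 0 < s j t)
  (dsE : forall j (t : R), is_derive t 1 (s j) (ds j t))
  (dds : forall j (t : R), is_derive t 1 (ds j) (force 1 lam (s j t))).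

(* The wave is [exp (logmod + i phase)], with
   [|wave| ^ 2 = exp (2 c0) \prod_j exp (- (x_j - x0_j) ^ 2 / s_j ^ 2) / s_j]. *)
Definition wdt (t : R) (j : 'I_n) : R := (s j t)^-1 ^+ 2.
(** The sum [wdt t j + i chirp t j] is the complex coefficient [a_j] of [- (x_j - x0_j) ^ 2 / 2] in
    the exponent; at time 0 it has to equal the given coefficient. *)
Definition chirp (t : R) (j : 'I_n) : R := - ds j t / s j t.
Definition amp (t : R) : R := c0 - 2^-1 * \sum_(j < n) ln (s j t).

(** The part of the equation that is constant in [x]: the real part of [i u_t / u] is minus the time
    derivative of the phase, half the Laplacian contributes [- wdt / 2] per coordinate, and the
    nonlinearity contributes [2 * lam * amp]. *)
Hypothesis dth : forall t : R, is_derive t 1 th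
  (- (2^-1 * \sum_(j < n) wdt t j) - 2 * lam * amp t).

Definition logmod (p : R * Rn) : R := amp p.1 - 2^-1 * qform (wdt p.1) x0 p.2.
Definition phase (p : R * Rn) : R := th p.1 - 2^-1 * qform (chirp p.1) x0 p.2.
Definition rpart (p : R * Rn) : R := expR (logmod p) * cos (phase p).
Definition ipart (p : R * Rn) : R := expR (logmod p) * sin (phase p).

Local Notation z p j := (p.2 0 j - x0 j).

Let sn0 j t : s j t != 0. Proof. by rewrite gt_eqF. Qed.

Let cs j : continuous (s j). Proof. by move=> t; exact: der_continuous (dsE j t). Qed.
Let cds j : continuous (ds j). Proof. by move=> t; exact: der_continuous (dds j t). Qed.

Lemma ct_wdt j : continuous (wdt ^~ j).
Proof. by apply: ctX; apply: ctV. Qed.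

Lemma ct_chirp j : continuous (chirp ^~ j).
Proof. by apply: ctM; [exact: ctN|exact: ctV]. Qed.

Lemma ct_amp : continuous amp.
Proof.
apply: ctD; first exact: ct_cst.
by apply: ctN; apply: ctM; [exact: ct_cst|apply: ct_sum => j; exact: ct_ln].
Qed.

Lemma ct_sqform (a : R -> 'I_n -> R) : (forall j, continuous (a ^~ j)) ->
  continuous (fun p : R * Rn => qform (a p.1) x0 p.2).
Proof.
move=> ca; apply: ct_sum => j; apply: ctM; first exact: (ct_time (ca j)).
apply: ctX; apply: ctD; last exact: ct_cst.
exact: (ct_space (@ct_coord R n j)).
Qed.

Lemma ct_logmod : continuous logmod.
Proof.
apply: ctD; first exact: (ct_time ct_amp).
by apply: ctN; apply: ctM; [exact: ct_cst|exact/ct_sqform/ct_wdt].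
Qed.

Lemma ct_phase : continuous phase.
Proof.
apply: ctD.
  by apply: ct_time => t; exact: der_continuous (dth t).
by apply: ctN; apply: ctM; [exact: ct_cst|exact/ct_sqform/ct_chirp].
Qed.

Lemma ct_rpart : continuous rpart.
Proof. by apply: ctM; [exact/ct_expR/ct_logmod|exact/ct_cos/ct_phase]. Qed.

Lemma ct_ipart : continuous ipart.
Proof. by apply: ctM; [exact/ct_expR/ct_logmod|exact/ct_sin/ct_phase]. Qed.

(** With [der_chirp], this is the real form of the Riccati equation [i a' = a^2 + 2 lam Re a] for
    [a = wdt + i chirp]. The force on [s] enters only through [der_chirp]. *)
Lemma der_wdt j (t : R) : is_derive t 1 (wdt ^~ j) (2 * wdt t j * chirp t j).
Proof.
apply: (der_eq (derX2 (derV (sn0 j t) (dsE j t)))).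
by rewrite /wdt /chirp; field.
Qed.

Lemma der_chirp j (t : R) : is_derive t 1 (chirp ^~ j)
  (chirp t j ^+ 2 - wdt t j ^+ 2 - 2 * lam * wdt t j).
Proof.
apply: (der_eq (derM (derN (dds j t)) (derV (sn0 j t) (dsE j t)))).
by rewrite /wdt /chirp /force; field.
Qed.

Lemma der_amp (t : R) : is_derive t 1 amp (2^-1 * \sum_(j < n) chirp t j).
Proof.
apply: (der_eq (derB (der_cst c0 t _) (derMl 2^-1 (der_sum (fun j => der_ln (s0 j t) (dsE j t)))))).
rewrite sub0r -mulrN -sumrN; congr (_ * _); apply: eq_bigr => j _.
by rewrite /chirp mulNr.
Qed.

(** Taken along an arbitrary space-time vector [v], so that time and space derivatives come out of a
    single computation. *)
Lemma der_qform (a da : R -> 'I_n -> R) p v :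
  (forall j (t : R), is_derive t 1 (a ^~ j) (da t j)) ->
  is_derive p v (fun p : R * Rn => qform (a p.1) x0 p.2)
    (v.1 * qform (da p.1) x0 p.2 + 2 * \sum_(j < n) a p.1 j * z p j * v.2 0 j).
Proof.
move=> dda.
apply: (der_eq (der_sum (fun j => derM (der_time v (dda j p.1))
  (derX2 (derB (der_coord p v j) (der_cst (x0 j) p v)))))).
rewrite /qform !mulr_sumr -big_split /=; apply: eq_bigr => j _; ring.
Qed.

Lemma der_logmod p v : is_derive p v logmod
  (v.1 * (2^-1 * \sum_(j < n) chirp p.1 j -
     qform (fun j => wdt p.1 j * chirp p.1 j) x0 p.2)
   - \sum_(j < n) wdt p.1 j * z p j * v.2 0 j).
Proof.
have h := der_qform (a := wdt) (da := fun t j => 2 * wdt t j * chirp t j) p v der_wdt.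
apply: (der_eq (derB (der_time v (der_amp p.1)) (derMl 2^-1 h))).
have -> : qform (fun j => 2 * wdt p.1 j * chirp p.1 j) x0 p.2 =
    2 * qform (fun j => wdt p.1 j * chirp p.1 j) x0 p.2.
  by rewrite /qform mulr_sumr; apply: eq_bigr => j _; rewrite !mulrA.
by field.
Qed.

Lemma der_phase p v : is_derive p v phase
  (v.1 * (- (2^-1 * \sum_(j < n) wdt p.1 j) - 2 * lam * amp p.1 -
     2^-1 * qform (fun j => chirp p.1 j ^+ 2 - wdt p.1 j ^+ 2 - 2 * lam * wdt p.1 j) x0 p.2)
   - \sum_(j < n) chirp p.1 j * z p j * v.2 0 j).
Proof.
have h := der_qform (a := chirp)
  (da := fun t j => chirp t j ^+ 2 - wdt t j ^+ 2 - 2 * lam * wdt t j) p v der_chirp.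
apply: (der_eq (derB (der_time v (dth p.1)) (derMl 2^-1 h))).
by field.
Qed.

Let sum_ex (f : 'I_n -> R) j : \sum_(k < n) f k * (ex j).2 0 k = f j.
Proof.
rewrite (bigD1 j) //= big1 => [|k kj]; rewrite !mxE ?eqxx ?mulr1 ?addr0 //.
by rewrite (negbTE kj) mulr0.
Qed.

Let sum_et (f : 'I_n -> R) : \sum_(k < n) f k * et.2 0 k = 0.
Proof. by rewrite big1 // => k _; rewrite mxE mulr0. Qed.

Definition logmod_t p := 2^-1 * \sum_(j < n) chirp p.1 j -
  qform (fun j => wdt p.1 j * chirp p.1 j) x0 p.2.
Definition phase_t p := - (2^-1 * \sum_(j < n) wdt p.1 j) - 2 * lam * amp p.1 -
  2^-1 * qform (fun j => chirp p.1 j ^+ 2 - wdt p.1 j ^+ 2 - 2 * lam * wdt p.1 j) x0 p.2.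
Definition logmod_x j (p : R * Rn) := - (wdt p.1 j * z p j).
Definition phase_x j (p : R * Rn) := - (chirp p.1 j * z p j).

Lemma der_logmod_t p : is_derive p et logmod (logmod_t p).
Proof. by apply: (der_eq (der_logmod p et)); rewrite sum_et mul1r subr0. Qed.

Lemma der_phase_t p : is_derive p et phase (phase_t p).
Proof. by apply: (der_eq (der_phase p et)); rewrite sum_et mul1r subr0. Qed.

Lemma der_logmod_x j p : is_derive p (ex j) logmod (logmod_x j p).
Proof.
apply: (der_eq (der_logmod p (ex j))).
by rewrite mul0r (sum_ex (fun k => wdt p.1 k * z p k)) sub0r.
Qed.

Lemma der_phase_x j p : is_derive p (ex j) phase (phase_x j p).
Proof.
apply: (der_eq (der_phase p (ex j))).
by rewrite mul0r (sum_ex (fun k => chirp p.1 k * z p k)) sub0r.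
Qed.

Lemma der_linear_x (a : R -> 'I_n -> R) (da : R -> 'I_n -> R) j p :
  (forall j (t : R), is_derive t 1 (a ^~ j) (da t j)) ->
  is_derive p (ex j) (fun p : R * Rn => - (a p.1 j * z p j)) (- a p.1 j).
Proof.
move=> dda; apply: (der_eq (derN (derM (der_time (ex j) (dda j p.1))
  (derB (der_coord p (ex j) j) (der_cst (x0 j) p (ex j)))))).
by rewrite /= !mxE !eqxx mulr0 mul0r add0r subr0 mulr1.
Qed.

Lemma der_rpart p v a b : is_derive p v logmod a -> is_derive p v phase b ->
  is_derive p v rpart (rpart p * a - ipart p * b).
Proof.
move=> da db; apply: (der_eq (derM (der_expR da) (der_cos db))).
by rewrite /rpart /ipart; ring.
Qed.

Lemma der_ipart p v a b : is_derive p v logmod a -> is_derive p v phase b ->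
  is_derive p v ipart (ipart p * a + rpart p * b).
Proof.
move=> da db; apply: (der_eq (derM (der_expR da) (der_sin db))).
by rewrite /rpart /ipart; ring.
Qed.

Definition rpart_x j p := rpart p * logmod_x j p - ipart p * phase_x j p.
Definition ipart_x j p := ipart p * logmod_x j p + rpart p * phase_x j p.
Definition rpart_xx j p := rpart_x j p * logmod_x j p - rpart p * wdt p.1 j
  - (ipart_x j p * phase_x j p - ipart p * chirp p.1 j).
Definition ipart_xx j p := ipart_x j p * logmod_x j p - ipart p * wdt p.1 j
  + (rpart_x j p * phase_x j p - rpart p * chirp p.1 j).

Lemma der_rpart_x j p : is_derive p (ex j) rpart (rpart_x j p).
Proof. exact: (der_rpart (der_logmod_x j p) (der_phase_x j p)). Qed.

Lemma der_ipart_x j p : is_derive p (ex j) ipart (ipart_x j p).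
Proof. exact: (der_ipart (der_logmod_x j p) (der_phase_x j p)). Qed.

Lemma der_rpart_xx j p : is_derive p (ex j) (rpart_x j) (rpart_xx j p).
Proof.
apply: (der_eq (derB (derM (der_rpart_x j p) (der_linear_x j p der_wdt))
  (derM (der_ipart_x j p) (der_linear_x j p der_chirp)))).
by rewrite /rpart_xx !mulrN.
Qed.

Lemma der_ipart_xx j p : is_derive p (ex j) (ipart_x j) (ipart_xx j p).
Proof.
apply: (der_eq (derD (derM (der_ipart_x j p) (der_linear_x j p der_wdt))
  (derM (der_rpart_x j p) (der_linear_x j p der_chirp)))).
by rewrite /ipart_xx !mulrN.
Qed.

(** The real part of [Delta w = (sum_j (a_j^2 z_j^2 - a_j)) w] with [a_j = wdt + i chirp] and
    [z_j = x_j - x0_j]; [sum_ipart_xx] is its imaginary part. *)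
Lemma sum_rpart_xx p : \sum_(j < n) rpart_xx j p =
  rpart p * (qform (fun j => wdt p.1 j ^+ 2 - chirp p.1 j ^+ 2) x0 p.2
    - \sum_(j < n) wdt p.1 j)
  + ipart p * (\sum_(j < n) chirp p.1 j
    - 2 * qform (fun j => wdt p.1 j * chirp p.1 j) x0 p.2).
Proof.
rewrite /qform !mulr_sumr -!sumrN -!big_split /= !mulr_sumr -big_split /=.
apply: eq_bigr => j _.
by rewrite /rpart_xx /rpart_x /ipart_x /logmod_x /phase_x; ring.
Qed.

Lemma sum_ipart_xx p : \sum_(j < n) ipart_xx j p =
  ipart p * (qform (fun j => wdt p.1 j ^+ 2 - chirp p.1 j ^+ 2) x0 p.2
    - \sum_(j < n) wdt p.1 j)
  - rpart p * (\sum_(j < n) chirp p.1 j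
    - 2 * qform (fun j => wdt p.1 j * chirp p.1 j) x0 p.2).
Proof.
rewrite -mulrN /qform !mulr_sumr -!sumrN -!big_split /= -sumrN !mulr_sumr -big_split /=.
apply: eq_bigr => j _.
by rewrite /ipart_xx /rpart_x /ipart_x /logmod_x /phase_x; ring.
Qed.

Let qform_split p :
  qform (fun j => chirp p.1 j ^+ 2 - wdt p.1 j ^+ 2 - 2 * lam * wdt p.1 j) x0 p.2 =
  - qform (fun j => wdt p.1 j ^+ 2 - chirp p.1 j ^+ 2) x0 p.2
  - 2 * lam * qform (wdt p.1) x0 p.2.
Proof.
rewrite /qform mulr_sumr -sumrN -sumrB; apply: eq_bigr => j _; ring.
Qed.

Definition rpart_t p := rpart p * logmod_t p - ipart p * phase_t p.
Definition ipart_t p := ipart p * logmod_t p + rpart p * phase_t p.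

(* [gaussian_wave] has [ln (|u| ^ 2) = 2 logmod]; the two lemmas below are the real
   and imaginary parts of the equation. *)
Lemma rpart_pde p : - ipart_t p + 2^-1 * \sum_(j < n) rpart_xx j p =
  lam * (2 * logmod p) * rpart p.
Proof.
rewrite sum_rpart_xx /ipart_t /logmod_t /phase_t qform_split /logmod.
by field.
Qed.

Lemma ipart_pde p : rpart_t p + 2^-1 * \sum_(j < n) ipart_xx j p =
  lam * (2 * logmod p) * ipart p.
Proof.
rewrite sum_ipart_xx /rpart_t /logmod_t /phase_t qform_split /logmod.
by field.
Qed.

Let ct_coordz j : continuous (fun p : R * Rn => z p j).
Proof. by apply: ctD; [exact: (ct_space (@ct_coord R n j))|exact: ct_cst]. Qed.

Lemma ct_logmod_x j : continuous (logmod_x j).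
Proof. by apply: ctN; apply: ctM; [exact: (ct_time (@ct_wdt j))|]. Qed.

Lemma ct_phase_x j : continuous (phase_x j).
Proof. by apply: ctN; apply: ctM; [exact: (ct_time (@ct_chirp j))|]. Qed.

Lemma ct_rpart_x j : continuous (rpart_x j).
Proof.
apply: ctD; first by apply: ctM; [exact: ct_rpart|exact: ct_logmod_x].
by apply: ctN; apply: ctM; [exact: ct_ipart|exact: ct_phase_x].
Qed.

Lemma ct_ipart_x j : continuous (ipart_x j).
Proof.
apply: ctD; first by apply: ctM; [exact: ct_ipart|exact: ct_logmod_x].
by apply: ctM; [exact: ct_rpart|exact: ct_phase_x].
Qed.

Lemma ct_rpart_xx j : continuous (rpart_xx j).
Proof.
have := (@ct_rpart_x j, @ct_ipart_x j, @ct_logmod_x j, @ct_phase_x j, ct_rpart, ct_ipart).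
have := (ct_time (n := n) (@ct_wdt j), ct_time (n := n) (@ct_chirp j)).
move=> [cw cc] [[[[[cr ci] cl] cp] crr] cii].
apply: ctD; first by apply: ctD; [exact: ctM|apply: ctN; exact: ctM].
by apply: ctN; apply: ctD; [exact: ctM|apply: ctN; exact: ctM].
Qed.

Lemma ct_ipart_xx j : continuous (ipart_xx j).
Proof.
have := (@ct_rpart_x j, @ct_ipart_x j, @ct_logmod_x j, @ct_phase_x j, ct_rpart, ct_ipart).
have := (ct_time (n := n) (@ct_wdt j), ct_time (n := n) (@ct_chirp j)).
move=> [cw cc] [[[[[cr ci] cl] cp] crr] cii].
apply: ctD; first by apply: ctD; [exact: ctM|apply: ctN; exact: ctM].
by apply: ctD; [exact: ctM|apply: ctN; exact: ctM].
Qed.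

Lemma ct_logmod_t : continuous logmod_t.
Proof.
apply: ctD.
  apply: ctM; first exact: ct_cst.
  by apply: ct_sum => j; exact: (ct_time (@ct_chirp j)).
apply: ctN; apply: (ct_sqform (a := fun t j => wdt t j * chirp t j)) => j.
by apply: ctM; [exact: ct_wdt|exact: ct_chirp].
Qed.

Lemma ct_phase_t : continuous phase_t.
Proof.
apply: ctD.
  apply: ctD.
    apply: ctN; apply: ctM; first exact: ct_cst.
    by apply: ct_sum => j; exact: (ct_time (@ct_wdt j)).
  by apply: ctN; apply: ctM; [exact: ct_cst|exact: (ct_time ct_amp)].
apply: ctN; apply: ctM; first exact: ct_cst.
apply: (ct_sqform (a := fun t j => chirp t j ^+ 2 - wdt t j ^+ 2 - 2 * lam * wdt t j)) => j.
apply: ctD; last by apply: ctN; apply: ctM; [exact: ct_cst|exact: ct_wdt].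
apply: ctD; first exact/ctX/ct_chirp.
by apply: ctN; exact/ctX/ct_wdt.
Qed.

Lemma ct_rpart_t : continuous rpart_t.
Proof.
apply: ctD; first by apply: ctM; [exact: ct_rpart|exact: ct_logmod_t].
by apply: ctN; apply: ctM; [exact: ct_ipart|exact: ct_phase_t].
Qed.

Lemma ct_ipart_t : continuous ipart_t.
Proof.
apply: ctD; first by apply: ctM; [exact: ct_ipart|exact: ct_logmod_t].
by apply: ctM; [exact: ct_rpart|exact: ct_phase_t].
Qed.

Definition gaussian_wave (t : R) (x : Rn) : R[i] :=
  Complex (rpart (t, x)) (ipart (t, x)).

Lemma sqr_normc_wave t x : normc (gaussian_wave t x) ^+ 2 = expR (2 * logmod (t, x)).
Proof.
rewrite sqr_normc /= /rpart /ipart !exprMn -mulrDr cos2Dsin2 mulr1.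
by rewrite mulrC expRM_natr.
Qed.

(** The wave never vanishes, so [ln (|w| ^ 2) = 2 logmod] is smooth and the pointwise equation holds
    everywhere. It passes to the weak form by [weak_form], once for the pair [(Re w, Im w)] and once
    for [(Im w, - Re w)]. *)
Lemma gaussian_wave_logNLS : logNLS lam gaussian_wave.
Proof.
move=> phi tphi.
have cS (f : R * Rn -> R) : continuous f ->
    continuous (fun p => lam * (2 * logmod p) * f p).
  move=> cf; apply: ctM => //; apply: ctM; first exact: ct_cst.
  by apply: ctM; [exact: ct_cst|exact: ct_logmod].
have E1 := weak_form ct_rpart ct_ipart (cS _ ct_rpart) ct_ipart_t ct_rpart_x ct_rpart_xx
  (fun p => der_ipart (der_logmod_t p) (der_phase_t p)) der_rpart_x der_rpart_xx
  rpart_pde tphi.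
have pde2 p : - - rpart_t p + 2^-1 * \sum_(j < n) ipart_xx j p =
  lam * (2 * logmod p) * ipart p by rewrite opprK ipart_pde.
have E2 := weak_form ct_ipart (ctN ct_rpart) (cS _ ct_ipart) (ctN ct_rpart_t)
  ct_ipart_x ct_ipart_xx
  (fun p => derN (der_rpart (der_logmod_t p) (der_phase_t p))) der_ipart_x der_ipart_xx
  pde2 tphi.
have lnE p : ln (normc (gaussian_wave p.1 p.2) ^+ 2) = 2 * logmod p.
  by rewrite sqr_normc_wave expRK; case: p.
rewrite /cintegral; congr Complex.
- transitivity (\int[(lebesgue_measure \x lebesgue_rV R n)%E]_p
    (rpart p * (2^-1 * laplacian phi p) + ipart p * dt phi p))%R.
    by apply: eq_Rintegral => -[t x] _ /=; ring.
  rewrite E1; apply: eq_Rintegral => -[t x] _; rewrite lnE /=; ring.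
- transitivity (\int[(lebesgue_measure \x lebesgue_rV R n)%E]_p
    (ipart p * (2^-1 * laplacian phi p) + - rpart p * dt phi p))%R.
    by apply: eq_Rintegral => -[t x] _ /=; ring.
  rewrite E2; apply: eq_Rintegral => -[t x] _; rewrite lnE /=; ring.
Qed.

End wave_equation.

Section weak_derivatives.
Context {R : realType} (n : nat).
Local Notation Rn := 'rV[R]_n.
Local Notation leb := (lebesgue_rV R n).

Lemma weak_partial_real (j : 'I_n) (f g psi : Rn -> R) : continuous f -> continuous g ->
  (forall x, is_derive x (unit_vec R j) f (g x)) -> test_function psi ->
  (\int[leb]_x (f x * 'D_(unit_vec R j) psi x) = - \int[leb]_x (g x * psi x))%R.
Proof.
move=> cf cg df tpsi; have [K cK K0] := test_function_supported tpsi.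
have cpsi vs := test_function_continuous tpsi (vs := vs).
have psi0 x : ~ K x -> psi x = 0 by exact: (K0 [::]).
have dpsi0 x : ~ K x -> 'D_(unit_vec R j) psi x = 0 by exact: (K0 [:: unit_vec R j]).
pose G x := g x * psi x + f x * 'D_(unit_vec R j) psi x.
have cgp : continuous (fun x => g x * psi x) by exact: ctM cg (cpsi [::]).
have cfp : continuous (fun x => f x * 'D_(unit_vec R j) psi x).
  exact: ctM cf (cpsi [:: unit_vec R j]).
have gp0 x : ~ K x -> g x * psi x = 0.
  by move=> Kx; rewrite psi0 // mulr0.
have fp0 x : ~ K x -> f x * 'D_(unit_vec R j) psi x = 0.
  by move=> Kx; rewrite dpsi0 // mulr0.
have G0 x : ~ K x -> G x = 0 by move=> Kx; rewrite /G gp0 // fp0 // addr0.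
have [C [M [cG GC GM]]] := compactly_supported_box cK (ctD cgp cfp) G0.
have F0 x : ~ K x -> f x * psi x = 0 by move=> Kx; rewrite psi0 // mulr0.
have [C' [M' [_ _ FM]]] := compactly_supported_box cK (ctM cf (cpsi [::])) F0.
have iG : (\int[leb]_x G x = 0)%R.
  have dF x : is_derive x (unit_vec R j) (fun x => f x * psi x) (G x).
    exact: (derM (df x) (test_function_derive tpsi [::] x (unit_vec R j))).
  have bG : box_supported G C (Num.max M M').
    by split => // x i; rewrite gt_max => /andP[Mx _]; exact: (GM x i).
  rewrite /Rintegral (divergence_rV dF bG) // => x i.
  by rewrite gt_max => /andP[_ Mx]; exact: (FM x i).
have [C1 [M1 b1]] := compactly_supported_box cK cgp gp0.
have [C2 [M2 b2]] := compactly_supported_box cK cfp fp0.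
apply/eqP; rewrite -subr_eq0 opprK addrC -RintegralD //.
- exact/eqP.
- exact: integrable_box_supported b1.
- exact: integrable_box_supported b2.
Qed.

Lemma weak_partial_complex (j : 'I_n) (f g f' g' : Rn -> R) : continuous f -> continuous g ->
  continuous f' -> continuous g' ->
  (forall x, is_derive x (unit_vec R j) f (g x)) ->
  (forall x, is_derive x (unit_vec R j) f' (g' x)) ->
  weak_partial j (fun x => Complex (f x) (f' x)) (fun x => Complex (g x) (g' x)).
Proof.
move=> cf cg cf' cg' df df' psi tpsi.
rewrite /cintegral; congr Complex.
- rewrite (_ : (\int[leb]_x _ = \int[leb]_x (f x * 'D_(unit_vec R j) psi x))%R); last first.
    by apply: eq_Rintegral => x _ /=; ring.
  rewrite (weak_partial_real cf cg df tpsi); congr (- _).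
  by apply: eq_Rintegral => x _ /=; ring.
- rewrite (_ : (\int[leb]_x _ = \int[leb]_x (f' x * 'D_(unit_vec R j) psi x))%R); last first.
    by apply: eq_Rintegral => x _ /=; ring.
  rewrite (weak_partial_real cf' cg' df' tpsi); congr (- _).
  by apply: eq_Rintegral => x _ /=; ring.
Qed.

Lemma measurable_sqr_normc d (T : measurableType d) (f : T -> R[i]) : cmeasurable f ->
  measurable_fun setT (fun x => normc (f x) ^+ 2).
Proof.
move=> [mr mi]; under eq_fun do rewrite sqr_normc.
by apply: measurable_funD; exact: measurable_funX.
Qed.

Lemma envelope_L2 (f : Rn -> R[i]) (x0 : 'I_n -> R) (k C : R) : 0 < k -> cmeasurable f ->
  (forall x, normc (f x) ^+ 2 <= C * expR (- qform (fun=> k) x0 x)) ->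
  in_L2 leb f /\ (L2norm leb f ^+ 2 <= (C * \prod_(j < n) Num.sqrt (pi / k))%:E)%E.
Proof.
move=> k0 mf fC; have C0 : 0 <= C.
  rewrite -(pmulr_lge0 _ (expR_gt0 (- qform (fun=> k) x0 0))).
  by apply: le_trans (fC 0); exact: sqr_ge0.
have le : (L2norm leb f ^+ 2 <= (C * \prod_(j < n) Num.sqrt (pi / k))%:E)%E.
  rewrite L2norm_sqr EFinM -(integral_gaussian x0 (fun=> k0)) // -ge0_integralZl_EFin //.
  - apply: ge0_le_integral => //.
    + by move=> x _; rewrite lee_fin sqr_ge0.
    + by apply/measurable_EFinP; exact: measurable_sqr_normc.
    + by apply: measurable_funeM; exact: measurable_gaussian.
    + by move=> x _; rewrite -EFinM lee_fin.
  - exact: measurable_gaussian.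
split => //; split => //.
rewrite ltey; apply/eqP => fy; move: le; rewrite fy.
by rewrite leye_eq.
Qed.

End weak_derivatives.

(** * The Gaussian wave in [Sigma] and its continuity in [L^2] *)

Section wave_regularity.
Context {R : realType} (n : nat).
Local Notation Rn := 'rV[R]_n.
Local Notation leb := (lebesgue_rV R n).
Variables (lam c0 : R) (x0 : 'I_n -> R) (s ds : 'I_n -> R -> R) (th : R -> R).
Hypotheses (s0 : forall j t, 0 < s j t)
  (dsE : forall j (t : R), is_derive t 1 (s j) (ds j t))
  (dds : forall j (t : R), is_derive t 1 (ds j) (force 1 lam (s j t)))
  (dth : forall t : R, is_derive t 1 th
  (- (2^-1 * \sum_(j < n) wdt s t j) - 2 * lam * amp c0 s t)).

Local Notation w := (gaussian_wave c0 x0 s ds th).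
Local Notation lm := (logmod c0 x0 s).
Local Notation rp := (rpart c0 x0 s ds th).
Local Notation ip := (ipart c0 x0 s ds th).
Local Notation H x := (\sum_(j < n) (x 0 j - x0 j) ^+ 2).

Definition wave_x (j : 'I_n) (t : R) (x : Rn) : R[i] :=
  Complex (rpart_x c0 x0 s ds th j (t, x)) (ipart_x c0 x0 s ds th j (t, x)).

Lemma sqr_normc_wave_x j t x : normc (wave_x j t x) ^+ 2 =
  (wdt s t j ^+ 2 + chirp s ds t j ^+ 2) * (x 0 j - x0 j) ^+ 2 * expR (2 * lm (t, x)).
Proof.
rewrite -(sqr_normc_wave c0 x0 s ds th) !sqr_normc /=.
by rewrite /rpart_x /ipart_x /logmod_x /phase_x /=; ring.
Qed.

Let cw j : continuous (wdt s ^~ j). Proof. exact: (@ct_wdt R n s ds s0 dsE j). Qed.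
Let cc j : continuous (chirp s ds ^~ j). Proof. exact: (@ct_chirp R n lam s ds s0 dsE dds j). Qed.
Let cs j : continuous (s j). Proof. by move=> t; exact: der_continuous (dsE j t). Qed.
Let cr := ct_rpart (x0 := x0) s0 dsE dds dth.
Let ci := ct_ipart (x0 := x0) s0 dsE dds dth.

(** By compactness of [[-T, T]] a single [D] bounds the amplitude, the squared widths and
    [wdt ^ 2 + chirp ^ 2]. Then [wdt >= D^-1] gives uniform Gaussian decay, while the gradient and
    the weight cost only polynomial factors. This one bound serves both the [Sigma] estimate and the
    dominated convergence for [L^2] continuity. *)
Lemma wave_envelope (T : R) : exists k B, 0 < k /\
  forall t x, `|t| <= T ->
    [/\ normc (w t x) ^+ 2 <= B * expR (- qform (fun=> k) x0 x),
        forall j, normc (wave_x j t x) ^+ 2 <= B * expR (- qform (fun=> k) x0 x) &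
        normc (weight (w t) x) ^+ 2 <= B * expR (- qform (fun=> k) x0 x)].
Proof.
pose g t := `|amp c0 s t| + \sum_(j < n) s j t ^+ 2 +
  \sum_(j < n) (wdt s t j ^+ 2 + chirp s ds t j ^+ 2).
have cg : continuous g.
  apply: ctD; [apply: ctD|].
  - by apply: ct_norm; exact: (@ct_amp R n c0 s ds s0 dsE).
  - by apply: ct_sum => j; exact: ctX.
  - by apply: ct_sum => j; apply: ctD; exact: ctX.
have [D0 gD] := compact_bound (@segment_compact R (- T) T) cg.
pose D := `|D0| + 1.
have D1 : 1 <= D by rewrite lerDr.
have Dpos : 0 < D by exact: lt_le_trans ltr01 D1.
pose X := \sum_(j < n) x0 j ^+ 2.
have X0 : 0 <= X by apply: sumr_ge0 => j _; exact: sqr_ge0.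
(* Half the decay rate is kept; the other half absorbs [1 + H x], since [k H exp (- k H) <= 1]. This
   explains the factor [1 + k^-1] in [E1]. *)
pose k := D^-1 / 2.
have k0 : 0 < k by rewrite divr_gt0 // invr_gt0.
pose E1 := expR (2 * D) * (1 + k^-1).
(* The prefactors are 1 for the wave, [D] for its derivatives and [2 * (1 + X)] for the weight, the
   last from [|x|^2 <= 2 H + 2 X]; their sum covers all three. *)
exists k, ((1 + D + 2 * (1 + X)) * E1); split => // t x tT.
have gt : g t <= D.
  have /gD : [set` `[- T, T]] t by rewrite /= in_itv/= -ler_norml.
  move=> h; rewrite (le_trans (ler_norm _)) // (le_trans h) // (le_trans (ler_norm _)) //.
  by rewrite lerDl.
have S1 : 0 <= \sum_(j < n) s j t ^+ 2 by apply: sumr_ge0 => j _; exact: sqr_ge0.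
have S2 : 0 <= \sum_(j < n) (wdt s t j ^+ 2 + chirp s ds t j ^+ 2).
  by apply: sumr_ge0 => j _; rewrite addr_ge0 ?sqr_ge0.
have ampD : amp c0 s t <= D.
  by have := ler_norm (amp c0 s t); move: gt; rewrite /g; lra.
have sD j : s j t ^+ 2 <= D.
  apply: le_trans gt; rewrite /g (bigD1 j) //=.
  have : 0 <= \sum_(i < n | i != j) s i t ^+ 2 by apply: sumr_ge0 => i _; exact: sqr_ge0.
  by have := normr_ge0 (amp c0 s t); lra.
have pqD j : wdt s t j ^+ 2 + chirp s ds t j ^+ 2 <= D.
  apply: le_trans gt; rewrite /g (bigD1 j (F := fun j => wdt s t j ^+ 2 + _)) //=.
  have : 0 <= \sum_(i < n | i != j) (wdt s t i ^+ 2 + chirp s ds t i ^+ 2).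
    by apply: sumr_ge0 => i _; rewrite addr_ge0 ?sqr_ge0.
  by have := normr_ge0 (amp c0 s t); lra.
have H0 : 0 <= H x by apply: sumr_ge0 => j _; exact: sqr_ge0.
have qk : qform (fun=> k) x0 x = k * H x by rewrite /qform mulr_sumr.
have wD : D^-1 * H x <= qform (wdt s t) x0 x.
  rewrite mulr_sumr; apply: ler_sum => j _; rewrite ler_wpM2r ?sqr_ge0 //.
  by rewrite /wdt exprVn lef_pV2 ?posrE ?exprn_gt0.
have env : (1 + H x) * expR (2 * lm (t, x)) <= E1 * expR (- qform (fun=> k) x0 x).
  have e1 : expR (2 * lm (t, x)) <= expR (2 * D) * expR (- (D^-1 * H x)).
    rewrite -expRD ler_expR /logmod /=; move: ampD wD; lra.
  apply: (@le_trans _ _ ((1 + H x) * (expR (2 * D) * expR (- (D^-1 * H x))))).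
    by rewrite ler_wpM2l // addr_ge0.
  rewrite qk /E1 [leLHS]mulrCA -mulrA ler_wpM2l ?expR_ge0 //.
  have -> : - (D^-1 * H x) = - (k * H x) + - (k * H x) by rewrite /k; field; exact: lt0r_neq0.
  rewrite expRD mulrA ler_wpM2r ?expR_ge0 //.
  have h1 : k * H x * expR (- (k * H x)) <= 1.
    rewrite expRN ler_pdivrMr ?expR_gt0 // mul1r.
    by apply: le_trans (expR_ge1Dx _); rewrite lerDr.
  have h2 : expR (- (k * H x)) <= 1 by rewrite -expR0 ler_expR oppr_le0 mulr_ge0 // ltW.
  rewrite mulrDl mul1r lerD // -[leRHS]mul1r -ler_pdivrMr ?invr_gt0 // invrK.
  by rewrite mulrC mulrA.
have e0 : 0 <= expR (2 * lm (t, x)) by exact: expR_ge0.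
set EE := E1 * _ in env.
have EE0 : 0 <= EE.
  by apply: le_trans env; rewrite mulr_ge0 // addr_ge0.
have mono c y : 0 <= c -> c <= 1 + D + 2 * (1 + X) -> y <= c * EE ->
    y <= (1 + D + 2 * (1 + X)) * E1 * expR (- qform (fun=> k) x0 x).
  move=> _ cc' yc; rewrite -mulrA -/EE; apply: le_trans yc _.
  by rewrite ler_wpM2r.
split.
- apply: (mono 1) => //; first by lra.
  rewrite mul1r sqr_normc_wave; apply: le_trans env.
  by rewrite ler_peMl // lerDl.
- move=> j; apply: (mono D); [exact: ltW|lra|].
  rewrite sqr_normc_wave_x.
  apply: (@le_trans _ _ (D * ((1 + H x) * expR (2 * lm (t, x))))); last first.
    by rewrite ler_pM2l.
  rewrite [leRHS]mulrA ler_wpM2r //; apply: ler_pM; rewrite ?addr_ge0 ?sqr_ge0 //.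
  rewrite (bigD1 j) //=.
  have : 0 <= \sum_(i < n | i != j) (x 0 i - x0 i) ^+ 2 by apply: sumr_ge0 => i _; exact: sqr_ge0.
  by lra.
- apply: (mono (2 * (1 + X))); [by rewrite mulr_ge0 // addr_ge0|lra|].
  have se0 : 0 <= sqr_eucl x by apply: sumr_ge0 => j _; exact: sqr_ge0.
  have -> : normc (weight (w t) x) ^+ 2 = sqr_eucl x * expR (2 * lm (t, x)).
    rewrite -(sqr_normc_wave c0 x0 s ds th) !sqr_normc /weight /= !mul0r subr0 addr0.
    by rewrite !exprMn sqr_sqrtr //; ring.
  apply: (@le_trans _ _ (2 * (1 + X) * ((1 + H x) * expR (2 * lm (t, x))))); last first.
    by rewrite ler_pM2l // mulr_gt0 // ltr_pwDl.
  rewrite [leRHS]mulrA ler_wpM2r //.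
  have : sqr_eucl x <= 2 * H x + 2 * X.
    rewrite /sqr_eucl !mulr_sumr -big_split /=; apply: ler_sum => j _.
    by have := sqr_ge0 (x 0 j - 2 * x0 j); nra.
  by have := mulr_ge0 X0 H0; lra.
Qed.

Let ct_slice (f : R * Rn -> R) t : continuous f -> continuous (fun x => f (t, x)).
Proof.
move=> cf; rewrite (_ : (fun x => _) = fun x => f (rV_uncons (rV_cons (t, x)))).
  exact: (ct_comp (ct_comp cf (@ct_uncons R n)) (@ct_consl R n t)).
by apply/funext => x; rewrite rV_consK.
Qed.

Let ct_slice_time (f : R * Rn -> R) x : continuous f -> continuous (fun t => f (t, x)).
Proof.
move=> cf; rewrite (_ : (fun t => _) = fun t => f (rV_uncons (rV_cons (t, x)))).
  exact: (ct_comp (ct_comp cf (@ct_uncons R n)) (@ct_consr R n x)).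
by apply/funext => t; rewrite rV_consK.
Qed.

Lemma cmeasurable_continuous (f g : Rn -> R) : continuous f -> continuous g ->
  cmeasurable (fun x => Complex (f x) (g x)).
Proof. by move=> cf cg; split; exact: continuous_measurable_rV. Qed.

Lemma cmeasurable_wave t : cmeasurable (w t).
Proof. by apply: cmeasurable_continuous; exact: ct_slice. Qed.

Lemma wave_weak_partial j t : weak_partial j (w t) (wave_x j t).
Proof.
apply: weak_partial_complex.
- exact: ct_slice cr.
- exact: ct_slice (ct_rpart_x s0 dsE dds dth (j := j)).
- exact: ct_slice ci.
- exact: ct_slice (ct_ipart_x s0 dsE dds dth (j := j)).
- move=> x; apply/is_derive_line.
  move/is_derive_line : (der_rpart_x x0 s0 dsE dds dth j (t, x)).
  congr is_derive; apply/funext => h; congr rp; congr pair.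
  by rewrite /= scaler0 add0r.
- move=> x; apply/is_derive_line.
  move/is_derive_line : (der_ipart_x x0 s0 dsE dds dth j (t, x)).
  congr is_derive; apply/funext => h; congr ip; congr pair.
  by rewrite /= scaler0 add0r.
Qed.

Lemma wave_Sigma (T : R) : exists M : R, forall t, `|t| <= T ->
  in_Sigma (w t) /\ Sigma_sqnorm_le (w t) M.
Proof.
have [k [B [k0 env]]] := wave_envelope T.
pose N := B * \prod_(j < n) Num.sqrt (pi / k).
exists (N + \sum_(j < n) N + N) => t tT.
have [wL wN] := envelope_L2 k0 (cmeasurable_wave t)
  (fun x => let: And3 a _ _ := env t x tT in a).
have mx j : cmeasurable (wave_x j t).
  apply: cmeasurable_continuous.
    exact: ct_slice (ct_rpart_x s0 dsE dds dth (j := j)).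
  exact: ct_slice (ct_ipart_x s0 dsE dds dth (j := j)).
have xL j := envelope_L2 k0 (mx j) (fun x => let: And3 _ a _ := env t x tT in a j).
have cse : continuous (fun x : Rn => Num.sqrt (sqr_eucl x)).
  by apply: ct_sqrt; apply: ct_sum => j; apply: ctX; exact: ct_coord.
have mw : cmeasurable (weight (w t)).
  rewrite (_ : weight (w t) = fun x => Complex (Num.sqrt (sqr_eucl x) * rp (t, x))
      (Num.sqrt (sqr_eucl x) * ip (t, x))); last first.
    apply/funext => x; rewrite /weight /gaussian_wave.
    by congr Complex; ring.
  by apply: cmeasurable_continuous; apply: ctM => //; exact: ct_slice.
have [pL pN] := envelope_L2 k0 mw (fun x => let: And3 _ _ a := env t x tT in a).
have grad : weak_gradient (w t) (fun j => wave_x j t).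
  by move=> j; split; [have [] := xL j|exact: wave_weak_partial].
split; first by split => //; split => //; exists (fun j => wave_x j t).
exists (fun j => wave_x j t) => //; rewrite !EFinD; apply: leeD => //; apply: leeD => //.
rewrite -sumEFin; apply: lee_sum => j _; by have [] := xL j.
Qed.

Lemma wave_Linfty_loc_Sigma : Linfty_loc_Sigma w.
Proof.
split.
  split; apply: continuous_measurable_pair.
    by rewrite (_ : (fun _ => _) = rp) //; apply/funext => -[].
  by rewrite (_ : (fun _ => _) = ip) //; apply/funext => -[].
by move=> T; have [M HM] := wave_Sigma T; exists M; exact: aeW.
Qed.

Lemma wave_continuous_L2 : continuous_L2 w.
Proof.
split=> [t|t0]; first by have [M /(_ t (lexx _))[[[]]]] := wave_Sigma `|t|.
have [k [B [k0 env]]] := wave_envelope (`|t0| + 1).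
have mwt t : cmeasurable (fun x => w t x - w t0 x).
  have [mr mi] := cmeasurable_wave t; have [mr0 mi0] := cmeasurable_wave t0.
  by split; exact: measurable_funB.
(* The factor 4 comes from [|a - b|^2 <= 2 |a|^2 + 2 |b|^2], both terms lying under the same
   envelope. *)
have ig : leb.-integrable setT (EFin \o (fun x => 4 * B * expR (- qform (fun=> k) x0 x))).
  rewrite (_ : _ \o _ = (fun x => (4 * B)%:E * (expR (- qform (fun=> k) x0 x))%:E)%E) //.
  by apply: integrableZl => //; exact: integrable_gaussian.
have bound t x : `|t| <= `|t0| + 1 ->
    `|normc (w t x - w t0 x) ^+ 2| <= 4 * B * expR (- qform (fun=> k) x0 x).
  move=> tt; have [h1 _ _] := env t x tt.
  have tt0 : `|t0| <= `|t0| + 1 by rewrite lerDl.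
  have [h2 _ _] := env t0 x tt0.
  rewrite ger0_norm ?sqr_ge0 //; move: h1 h2; rewrite !sqr_normc /= -!mulrA.
  move: (rp (t, x)) (rp (t0, x)) (ip (t, x)) (ip (t0, x)) => a b c e.
  move: (B * _) => q h1 h2.
  have := sqr_ge0 (a + b); have := sqr_ge0 (c + e); nra.
have lim0 : (\int[leb]_x normc (w t x - w t0 x) ^+ 2)%R @[t --> t0] -->
    (\int[leb]_x (cst 0 : Rn -> R) x)%R.
  apply: (dominated_cvg_at (f := fun t x => normc (w t x - w t0 x) ^+ 2) _ _ ig).
  - by move=> t; exact: measurable_sqr_normc.
  - exact: measurable_cst.
  - near=> t; move=> x; apply: bound; near: t.
    have /cvgr_le := @norm_continuous R R^o t0; apply.
    by rewrite ltrDl.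
  - move=> x; have c1 := ct_slice_time (x := x) cr; have c2 := ct_slice_time (x := x) ci.
    have ch : continuous (fun t => (rp (t, x) - rp (t0, x)) ^+ 2 + (ip (t, x) - ip (t0, x)) ^+ 2).
      by apply: ctD; apply: ctX; apply: ctD => //; exact: ct_cst.
    have h := ch t0.
    rewrite /continuous_at !subrr expr0n addr0 /= in h; apply: cvg_trans h.
    by apply: near_eq_cvg; apply: nearW => t; rewrite sqr_normc.
rewrite /Rintegral integral0 /= in lim0.
(* Restricted to [t] near [t0], where the envelope makes the integral finite and hence a real
   number. *)
have L2E : \forall t \near t0, L2norm leb (fun x => w t x - w t0 x) =
    (Num.sqrt (\int[leb]_x normc (w t x - w t0 x) ^+ 2)%R)%:E.
  near=> t; apply: L2norm_EFin; apply: Rintegral_EFin.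
  apply: (dominated_integrable _ ig); first exact: measurable_sqr_normc.
  move=> x; apply: bound; near: t.
  have /cvgr_le := @norm_continuous R R^o t0; apply.
  by rewrite ltrDl.
have : (Num.sqrt (\int[leb]_x normc (w t x - w t0 x) ^+ 2)%R)%:E @[t --> t0] --> 0%E.
  apply: cvg_EFin; first exact: nearW.
  have h := continuous_cvg _ (@sqrt_continuous R 0) lim0.
  by rewrite sqrtr0 in h; exact: h.
apply: cvg_trans; apply: near_eq_cvg.
by apply: filterS L2E => t ->.
Unshelve. all: by end_near. Qed.

End wave_regularity.

(** * Matching the initial data *)

Section initial_data.
Context {R : realType}.

Lemma polar_form (b : R[i]) : b != 0 -> exists c a : R,
  b = Complex (expR c * cos a) (expR c * sin a).
Proof.
case: b => x y b0; pose r := Num.sqrt (x ^+ 2 + y ^+ 2).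
have r2 : r ^+ 2 = x ^+ 2 + y ^+ 2 by rewrite sqr_sqrtr // addr_ge0 ?sqr_ge0.
have rn0 : r != 0.
  apply: contra b0; rewrite -sqrf_eq0 r2 paddr_eq0 ?sqr_ge0 // !sqrf_eq0.
  by move=> /andP[/eqP -> /eqP ->].
have r0 : 0 < r by rewrite lt_neqAle eq_sym rn0 sqrtr_ge0.
have xr : -1 <= x / r <= 1.
  rewrite -ler_norml normrM [`|r^-1|]gtr0_norm ?invr_gt0 // ler_pdivrMr // mul1r.
  rewrite -ler_sqr ?nnegrE ?(ltW r0) // real_normK ?num_real // r2 lerDl sqr_ge0.
  by [].
have yr : 1 - (x / r) ^+ 2 = (y / r) ^+ 2.
  have : (x / r) ^+ 2 + (y / r) ^+ 2 = 1 by rewrite !exprMn -mulrDl -r2 -exprMn divff // expr1n.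
  by lra.
have xi : x / r \in `[-1, 1] by rewrite in_itv.
exists (ln r); have [y0|y0] := leP 0 y.
- exists (acos (x / r)); rewrite lnK // acosK // sin_acos // yr sqrtr_sqr.
  rewrite ger0_norm ?divr_ge0 // ?(ltW r0) //.
  by congr Complex; field.
- exists (- acos (x / r)); rewrite lnK // cosN sinN acosK // sin_acos // yr sqrtr_sqr.
  rewrite ltr0_norm; last by rewrite pmulr_llt0 // invr_gt0.
  by congr Complex; field.
Qed.

(** At [t > 0] the restriction to the half-line is vacuous for increments smaller than [t], hence
    the radius [Num.min d t]. *)
Lemma deriv_halfline_derive (f df : R -> R) (t : R) :
  deriv_halfline f df -> 0 < t -> is_derive t 1 f (df t).
Proof.
move=> /(_ t) h t0; have /cvgrPdist_lt {}h := h (ltW t0).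
have hc : h0^-1 *: (f (h0 *: 1 + t) - f t) @[h0 --> (0 : R)^'] --> df t.
  apply/cvgrPdist_lt => e /h /nbhs_ballP[d /= d0 hd].
  apply/nbhs_ballP; exists (Num.min d t); first by rewrite /= lt_min d0.
  move=> k /=; rewrite /ball/= sub0r normrN lt_min => /andP[kd kt] kn0.
  have := hd (k + t); rewrite /ball/= opprD addrCA subrr addr0 normrN addrK.
  rewrite /GRing.scale/= mulr1; apply=> //.
  - by move: kn0; rewrite -subr_eq0 subr0 => kn0; rewrite -subr_eq0 addrK.
  - rewrite in_itv/= andbT; move: kt; rewrite ltr_norml => /andP[]; lra.
by apply: DeriveDef; [apply/cvg_ex; exists (df t)|exact: cvg_lim hc].
Qed.

Lemma is_tau_dispersive (lam : R) (tau dtau : R -> R) :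
  is_tau lam tau dtau -> dispersive 0 lam tau dtau.
Proof.
move=> [_ _ tau0 d1 d2]; split=> t t0.
- exact/tau0/ltW.
- exact: deriv_halfline_derive.
- by rewrite /force mul0r add0r; exact: (deriv_halfline_derive d2).
Qed.

Lemma Re_sum n (f : 'I_n -> R[i]) :
  complex.Re (\sum_(j < n) f j) = \sum_(j < n) complex.Re (f j).
Proof. by apply: (big_morph _ (id1 := 0)) => // -[a b] [c e]. Qed.

Lemma Im_sum n (f : 'I_n -> R[i]) :
  complex.Im (\sum_(j < n) f j) = \sum_(j < n) complex.Im (f j).
Proof. by apply: (big_morph _ (id1 := 0)) => // -[a b] [c e]. Qed.

Lemma opp_halfE (z : R[i]) :
  - (2^-1 * z) = Complex (- (2^-1 * complex.Re z)) (- (2^-1 * complex.Im z)).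
Proof.
by case: z => p q; congr Complex;
  rewrite /= !(mulr0, mul0r, addr0, oppr0, subr0, expr0n) /=; field.
Qed.

End initial_data.

Section explicit_solution.
Context {R : realType} (n : nat).
Local Notation Rn := 'rV[R]_n.
Local Notation leb := (lebesgue_rV R n).

(** Mass conservation: the Gaussian integral contributes the product of the [s_j], and [amp]
    contains exactly its inverse. At time 0 this evaluates the norm of [u0]. *)
Lemma wave_mass (c0 : R) (x0 : 'I_n -> R) (s ds : 'I_n -> R -> R) (th : R -> R) t :
  (forall j t, 0 < s j t) ->
  (\int[leb]_x (normc (gaussian_wave c0 x0 s ds th t x) ^+ 2)%:E)%E =
  (expR (2 * c0) * Num.sqrt pi ^+ n)%:E.
Proof.
move=> s0; pose E := expR (2 * amp c0 s t).
transitivity (\int[leb]_x (E%:E * (expR (- qform (wdt s t) x0 x))%:E))%E.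
  apply: eq_integral => x _; rewrite sqr_normc_wave -EFinM -expRD /logmod /=.
  by congr (expR _)%:E; field.
have w0 j : 0 < wdt s t j by rewrite exprn_gt0 // invr_gt0.
rewrite ge0_integralZl_EFin ?expR_ge0 //; last exact: measurable_gaussian.
rewrite integral_gaussian // -EFinM; congr EFin.
have -> : E = expR (2 * c0) * \prod_(j < n) (s j t)^-1.
  have -> : \prod_(j < n) (s j t)^-1 = expR (- \sum_(j < n) ln (s j t)).
    rewrite -sumrN expR_sum; apply: eq_bigr => j _.
    by rewrite expRN lnK // posrE.
  by rewrite -expRD /E /amp; congr expR; field.
rewrite -mulrA -big_split /=; congr (_ * _).
rewrite -[in RHS](card_ord n) -prodr_const; apply: eq_bigr => j _.
have sj : s j t != 0 by rewrite gt_eqF.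
rewrite /wdt exprVn invrK sqrtrM ?pi_ge0 // sqrtr_sqr gtr0_norm //.
by field.
Qed.

Lemma gaussian_mass :
  (\int[leb]_x (normc ((gaussian x)%:C)%C ^+ 2)%:E)%E = (Num.sqrt pi ^+ n)%:E.
Proof.
transitivity (\int[leb]_x (expR (- qform (fun=> 1) (fun=> 0) x))%:E)%E.
  apply: eq_integral => x _; rewrite sqr_normc /= expr0n addr0 /gaussian.
  rewrite -expRM_natr; congr (expR _)%:E.
  rewrite /qform /sqr_eucl mulNr divfK ?pnatr_eq0 //; congr (- _).
  by apply: eq_bigr => j _; rewrite mul1r subr0.
rewrite integral_gaussian //; congr EFin.
by rewrite prodr_const card_ord divr1.
Qed.

Lemma gaussian_solution (lam : R) (b0 : R[i]) (a0 : 'I_n -> R[i]) (x0 : 'I_n -> R)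
    (u0 : Rn -> R[i]) : 0 < lam -> b0 != 0 -> (forall j, 0 < complex.Re (a0 j)) ->
  (forall x, u0 x =
    b0 * cexp (- (2^-1 * \sum_(j < n) a0 j * (((x 0 j - x0 j) ^+ 2)%:C)%C))) ->
  exists c0 s ds th,
    [/\ forall j, dispersive 1 lam (s j) (ds j), forall j t, 0 < s j t,
        forall x, u0 x = gaussian_wave c0 x0 s ds th 0 x &
        logNLS_solution lam u0 (gaussian_wave c0 x0 s ds th)].
Proof.
move=> lam0 b0n a00 u0E; have [c [a bE]] := polar_form b0n.
pose al j := Num.sqrt (complex.Re (a0 j)).
have al0 j : 0 < al j by rewrite sqrtr_gt0.
(* These data make [wdt s 0 j] the real part and [chirp s ds 0 j] the imaginary part of [a0 j]. *)
have /choice[s /choice[ds H]] : forall j, exists s ds : R -> R,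
    [/\ s 0 = (al j)^-1, ds 0 = - complex.Im (a0 j) / al j, forall t, 0 < s t,
      forall t : R, is_derive t 1 s (ds t) &
      forall t : R, is_derive t 1 ds (force 1 lam (s t))].
  by move=> j; apply: dispersion_solution => //; rewrite invr_gt0.
have s0 j t : 0 < s j t by have [] := H j.
have dsE j (t : R) : is_derive t 1 (s j) (ds j t) by have [] := H j.
have dds j (t : R) : is_derive t 1 (ds j) (force 1 lam (s j t)) by have [] := H j.
(* Chosen so that [amp c0 s 0 = c], the logarithm of the modulus of [b0]. *)
pose c0 := c + 2^-1 * \sum_(j < n) ln (s j 0).
pose dth t := - (2^-1 * \sum_(j < n) wdt s t j) - 2 * lam * amp c0 s t.
have cdth : continuous dth.
  apply: ctD; apply: ctN; apply: ctM; try exact: ct_cst.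
    by apply: ct_sum => j; exact: (@ct_wdt R n s ds s0 dsE j).
  exact: (@ct_amp R n c0 s ds s0 dsE).
have [F F0 dF] := antiderivative cdth.
pose th t := F t + a.
have dthE (t : R) : is_derive t 1 th (dth t).
  by apply: (der_eq (derD (dF t) (der_cst a t _))); rewrite addr0.
have uw x : u0 x = gaussian_wave c0 x0 s ds th 0 x.
  rewrite u0E bE /cexp /gaussian_wave /rpart /ipart.
  set S := \sum_(j < n) _.
  have ReS : complex.Re S = qform (wdt s 0) x0 x.
    rewrite Re_sum; apply: eq_bigr => j _; have [s00 _ _ _ _] := H j.
    rewrite /wdt s00 invrK /al sqr_sqrtr ?(ltW (a00 j)) //.
    by case: (a0 j) => p q /=; ring.
  have ImS : complex.Im S = qform (chirp s ds 0) x0 x.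
    rewrite Im_sum; apply: eq_bigr => j _; have [s00 d00 _ _ _] := H j.
    have -> : chirp s ds 0 j = complex.Im (a0 j).
      by rewrite /chirp s00 d00; field; rewrite gt_eqF.
    by case: (a0 j) => p q /=; ring.
  have amp0 : amp c0 s 0 = c by rewrite /amp /c0 addrK.
  have lm0 : logmod c0 x0 s (0, x) = c - 2^-1 * complex.Re S.
    by rewrite /logmod /= amp0 ReS.
  have ph0 : phase x0 s ds th (0, x) = a - 2^-1 * complex.Im S.
    by rewrite /phase /= /th F0 add0r ImS.
  rewrite lm0 ph0.
  rewrite (opp_halfE S) /=.
  move: (complex.Re S) (complex.Im S) => p q.
  rewrite expRD cosD sinD.
  congr Complex; ring.
exists c0, s, ds, th; split => //; split.
- exact: wave_Linfty_loc_Sigma s0 dsE dds dthE.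
- exact: wave_continuous_L2 s0 dsE dds dthE.
- exact: gaussian_wave_logNLS s0 dsE dds dthE.
- by apply: aeW => x; rewrite uw.
Qed.

End explicit_solution.

(** * The rescaled profile *)

Section profile.
Context {R : realType} (n : nat).
Local Notation Rn := 'rV[R]_n.
Local Notation leb := (lebesgue_rV R n).
Variables rho m : R -> 'I_n -> R.
Hypotheses (rho1 : forall j, rho t j @[t --> +oo] --> (1 : R))
  (m0 : forall j, m t j @[t --> +oo] --> (0 : R)).

(* The logarithm of [|v(t, y)| ^ 2]; [rho_j = tau / s_j] and [m_j = x0_j / tau]. *)
Definition profile_log (t : R) (y : Rn) : R :=
  \sum_(j < n) ln (rho t j) - qform (fun j => rho t j ^+ 2) (m t) y.

Lemma ct_sqr_eucl : continuous (fun y : Rn => sqr_eucl y).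
Proof. by apply: ct_sum => j; apply: ctX; exact: ct_coord. Qed.

Lemma ct_profile_log t : continuous (profile_log t).
Proof. by apply: ctD; [exact: ct_cst|apply: ctN; exact: ct_qform]. Qed.

Lemma cvg_fin_sum k (f : 'I_k -> R -> R) (l : 'I_k -> R) :
  (forall j, f j t @[t --> +oo] --> l j) ->
  \sum_(j < k) f j t @[t --> +oo] --> \sum_(j < k) l j.
Proof.
elim: k f l => [|k IH] f l fl.
  by under eq_fun do rewrite big_ord0; rewrite big_ord0; exact: cvg_cst.
under eq_fun do rewrite big_ord_recl; rewrite big_ord_recl.
by apply: cvgD; [exact: fl|exact: IH].
Qed.

Lemma cvg_ln_rho j : ln (rho t j) @[t --> +oo] --> (0 : R).
Proof.
have h := continuous_cvg _ (continuous_ln (@ltr01 R)) (rho1 j).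
by rewrite ln1 in h; exact: h.
Qed.

Lemma profile_log_cvg y : profile_log t y @[t --> +oo] --> - sqr_eucl y.
Proof.
have -> : - sqr_eucl y = \sum_(j < n) 0 - \sum_(j < n) 1 * 1 * ((y 0 j - 0) * (y 0 j - 0)).
  rewrite big1 // sub0r; congr (- _); apply: eq_bigr => j _.
  by rewrite subr0; ring.
apply: cvgB; first by apply: cvg_fin_sum; exact: cvg_ln_rho.
rewrite /qform; apply: (cvg_fin_sum
  (f := fun j t => rho t j ^+ 2 * (y 0 j - m t j) ^+ 2)) => j.
apply: cvgM; first by apply: cvgM; exact: rho1.
by apply: cvgM; apply: cvgB => //; exact: cvg_cst.
Qed.

(** Per coordinate, [1/2 <= rho^2 <= 2], [|m| <= 1] and [|ln rho| <= 1] give at most [3/2 - y^2/4]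
    and at least [-5 - 4 y^2]. The upper bound provides decay of the density; the lower one controls
    its logarithm in the entropy. *)
Lemma profile_log_bounds : \forall t \near +oo, forall y : Rn,
  profile_log t y <= 2 * n%:R - sqr_eucl y / 4 /\
  - (5 * n%:R) - 4 * sqr_eucl y <= profile_log t y.
Proof.
have near_j j : \forall t \near +oo,
    [/\ `|ln (rho t j)| <= 1, 2^-1 <= rho t j ^+ 2, rho t j ^+ 2 <= 2 & `|m t j| <= 1].
  near=> t; split; near: t.
  - have /cvgr_norm_le := @cvg_ln_rho j; apply.
    by rewrite normr0.
  - apply: (cvgr_ge (1 * 1 : R)); last by lra.
    by apply: cvgM; exact: rho1.
  - apply: (cvgr_le (1 * 1 : R)); last by lra.
    by apply: cvgM; exact: rho1.
  - have /cvgr_norm_le := @m0 j; apply.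
    by rewrite normr0.
have : \forall t \near +oo, forall j,
    [/\ `|ln (rho t j)| <= 1, 2^-1 <= rho t j ^+ 2, rho t j ^+ 2 <= 2 & `|m t j| <= 1].
  exact: filter_forall.
apply: filterS => t h y.
have nE (c : R) : c * n%:R = \sum_(j < n) c by rewrite sumr_const card_ord mulr_natr.
have sE : profile_log t y = \sum_(j < n) (ln (rho t j) - rho t j ^+ 2 * (y 0 j - m t j) ^+ 2).
  by rewrite /profile_log /qform -sumrB.
rewrite sE !nE; split.
  rewrite /sqr_eucl mulr_suml -sumrB; apply: ler_sum => j _.
  have [h1 h2 h3 h4] := h j; move: h1 h2 h3 h4.
  rewrite !ler_norml => /andP[_ a] b c /andP[e f].
  move: (ln _) (rho t j ^+ 2) (m t j) (y 0 j) a b c e f => l r k z a b c e f.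
  have k1 : k ^+ 2 <= 1 by nra.
  have zk : z ^+ 2 / 2 - 1 <= (z - k) ^+ 2 by have := sqr_ge0 (z - 2 * k); nra.
  have : 2^-1 * (z - k) ^+ 2 <= r * (z - k) ^+ 2 by rewrite ler_wpM2r ?sqr_ge0.
  lra.
rewrite /sqr_eucl -sumrN mulr_sumr -sumrB; apply: ler_sum => j _.
have [h1 h2 h3 h4] := h j; move: h1 h2 h3 h4.
rewrite !ler_norml => /andP[a _] b c /andP[e f].
move: (ln _) (rho t j ^+ 2) (m t j) (y 0 j) a b c e f => l r k z a b c e f.
have k1 : k ^+ 2 <= 1 by nra.
have zk : (z - k) ^+ 2 <= 2 * z ^+ 2 + 2 by have := sqr_ge0 (z + k); nra.
have : r * (z - k) ^+ 2 <= 2 * (z - k) ^+ 2 by rewrite ler_wpM2r ?sqr_ge0.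
lra.
Unshelve. all: by end_near. Qed.

(** The second factor is the logarithm of the density divided by [gaussian ^ 2], since
    [gaussian y ^+ 2 = exp (- |y|^2)]. *)
Definition entropy_density (t : R) (y : Rn) : R :=
  expR (profile_log t y) * (profile_log t y + sqr_eucl y).

Definition profile_gap (t : R) (y : Rn) : R :=
  `|expR (profile_log t y) - gaussian y ^+ 2|.

Lemma sqr_gaussian (y : Rn) : gaussian y ^+ 2 = expR (- sqr_eucl y).
Proof. by rewrite /gaussian -expRM_natr mulNr divfK ?pnatr_eq0. Qed.

(** The rate 1/8 is half the decay in [profile_log_bounds]; the other half absorbs the quadratic
    factor of the entropy. *)
Let env (y : Rn) : R := expR (- qform (fun=> 8^-1) (fun=> 0) y).

Let envE y : env y = expR (- (sqr_eucl y / 8)).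
Proof.
rewrite /env /qform /sqr_eucl mulr_suml; congr (expR (- _)).
by apply: eq_bigr => j _; rewrite subr0 mulrC.
Qed.

(** The bounds give [|L + N| <= 5 n + 5 N] for the profile logarithm [L] and [N = |y|^2]. Multiplied
    by [q = exp (- N / 8)] this is at most [5 n + 40], as [N q <= 8]; what is left over also covers
    [E q + q], with [E = exp (2 n)], for the gap. *)
Let C : R := expR (2 * n%:R) * (5 * n%:R + 41) + 1.

Let integrable_env : leb.-integrable setT (EFin \o (fun y => C * env y)).
Proof.
rewrite (_ : _ \o _ = (fun x => C%:E * (env x)%:E)%E) //.
by apply: integrableZl => //; apply: integrable_gaussian => j; rewrite invr_gt0.
Qed.

Let envelope : \forall t \near +oo, forall y,
  `|entropy_density t y| <= C * env y /\ `|profile_gap t y| <= C * env y.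
Proof.
apply: filterS profile_log_bounds => t h y; have [hi lo] := h y.
have N0 : 0 <= sqr_eucl y by apply: sumr_ge0 => j _; exact: sqr_ge0.
have n0 : 0 <= n%:R :> R by [].
rewrite envE.
have e1 : expR (profile_log t y) <=
    expR (2 * n%:R) * (expR (- (sqr_eucl y / 8)) * expR (- (sqr_eucl y / 8))).
  by rewrite -!expRD ler_expR; lra.
rewrite /entropy_density /profile_gap /C.
move: (profile_log t y) (sqr_eucl y) hi lo N0 e1 (sqr_gaussian y) => L N hi lo N0 e1 ->.
set q := expR (- (N / 8)) in e1 *.
have q0 : 0 < q by exact: expR_gt0.
have q1 : q <= 1 by rewrite -expR0 ler_expR; lra.
have Nq : N / 8 * q <= 1.
  rewrite /q expRN ler_pdivrMr ?expR_gt0 // mul1r.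
  by apply: le_trans (expR_ge1Dx _); rewrite lerDr.
set E := expR (2 * n%:R) in e1 *.
have E1 : 1 <= E by rewrite -expR0 ler_expR mulr_ge0.
have qq : q * q <= q by rewrite ler_piMl // ltW.
have eL0 : 0 < expR L by exact: expR_gt0.
have eLq : expR L <= E * q.
  by apply: le_trans e1 _; rewrite ler_pM2l // (lt_le_trans ltr01).
split.
- rewrite normrM gtr0_norm //.
  have LN : `|L + N| <= 5 * n%:R + 5 * N by rewrite ler_norml; apply/andP; split; lra.
  apply: (@le_trans _ _ (E * (q * q) * (5 * n%:R + 5 * N))).
    by apply: ler_pM => //; exact: ltW.
  rewrite -mulrA -mulrA.
  have : q * (q * (5 * n%:R + 5 * N)) <= q * (5 * n%:R + 40).
    rewrite ler_pM2l // mulrDr lerD //.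
      by rewrite ler_piMl // mulr_ge0.
    by move: Nq; lra.
  move=> h1; apply: (@le_trans _ _ (E * (q * (5 * n%:R + 40)))).
    by rewrite ler_pM2l // (lt_le_trans ltr01).
  have := mulr_gt0 (lt_le_trans ltr01 E1) q0; lra.
- rewrite normr_id; apply: (@le_trans _ _ (E * q + q)).
    apply: le_trans (ler_normB _ _) _; rewrite !gtr0_norm ?expR_gt0 //.
    by rewrite lerD // /q ler_expR; lra.
  have := mulr_gt0 (lt_le_trans ltr01 E1) q0.
  by have := mulr_ge0 (ltW (mulr_gt0 (lt_le_trans ltr01 E1) q0)) n0; lra.
Qed.

Lemma ct_entropy_density t : continuous (entropy_density t).
Proof.
apply: ctM; first by apply: ct_expR; exact: ct_profile_log.
by apply: ctD; [exact: ct_profile_log|exact: ct_sqr_eucl].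
Qed.

Lemma ct_profile_gap t : continuous (profile_gap t).
Proof.
apply: ct_norm; apply: ctD; first by apply: ct_expR; exact: ct_profile_log.
apply: ctN; apply: ctX; apply: ct_expR; apply: ctN; apply: ctM; last exact: ct_cst.
exact: ct_sqr_eucl.
Qed.

Lemma cvg_Rintegral_EFin (f : R -> Rn -> R) :
  (forall t, continuous (f t)) ->
  (\forall t \near +oo, forall y, `|f t y| <= C * env y) ->
  (forall y, f t y @[t --> +oo] --> (0 : R)) ->
  (\int[leb]_y (f t y)%:E)%E @[t --> +oo] --> 0%E.
Proof.
move=> cf fenv f0.
have mf t : measurable_fun setT (f t) by exact: continuous_measurable_rV.
have := dominated_cvgy (l := cst 0) mf (measurable_cst _) integrable_env fenv f0.
rewrite {2}/Rintegral integral0 /= => h.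
(* Extended and real integrals are identified where the domination holds, hence only eventually. *)
apply: (@cvg_trans _ ((\int[leb]_y f t y)%R%:E @[t --> +oo])).
  apply: near_eq_cvg; apply: filterS fenv => t ft.
  by rewrite Rintegral_EFin //; exact: (dominated_integrable (mf t) integrable_env).
by apply: cvg_EFin; [exact: nearW|exact: h].
Qed.

Lemma entropy_density_cvg :
  (\int[leb]_y (entropy_density t y)%:E)%E @[t --> +oo] --> 0%E.
Proof.
apply: cvg_Rintegral_EFin.
- exact: ct_entropy_density.
- by apply: filterS envelope => t h y; have [] := h y.
- move=> y; have cL := @profile_log_cvg y.
  rewrite -(mulr0 (expR (- sqr_eucl y))); apply: cvgM.
    exact: (continuous_cvg _ (@continuous_expR R _) cL).
  by rewrite -(addNr (sqr_eucl y)); apply: cvgD => //; exact: cvg_cst.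
Qed.

Lemma profile_gap_cvg :
  (\int[leb]_y (profile_gap t y)%:E)%E @[t --> +oo] --> 0%E.
Proof.
apply: cvg_Rintegral_EFin.
- exact: ct_profile_gap.
- by apply: filterS envelope => t h y; have [] := h y.
- move=> y; have cL := @profile_log_cvg y.
  have h : expR (profile_log t y) - gaussian y ^+ 2 @[t --> +oo] --> (0 : R).
    rewrite -(subrr (gaussian y ^+ 2)); apply: cvgB; last exact: cvg_cst.
    by rewrite sqr_gaussian; exact: (continuous_cvg _ (@continuous_expR R _) cL).
  by rewrite -(normr0 R); exact: (cvg_norm h).
Qed.

End profile.

(** * From the explicit wave to [v] *)

Section complex_modulus.
Context {R : realType}.
Local Open Scope complex_scope.

Lemma sqr_normcM (x y : R[i]) : normc (x * y) ^+ 2 = normc x ^+ 2 * normc y ^+ 2.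
Proof. by rewrite ComplexField.Normc.normcM exprMn. Qed.

Lemma sqr_normc_real (r : R) : normc r%:C ^+ 2 = r ^+ 2.
Proof. by rewrite sqr_normc /= expr0n addr0. Qed.

Lemma sqr_normc_phase (r : R) : normc (cexp ((0 +i* 1) * r%:C)) ^+ 2 = 1.
Proof.
rewrite sqr_normc /cexp /= !(mul0r, mul1r, mulr0, subr0, addr0, add0r, sub0r, oppr0, expR0).
by rewrite cos2Dsin2.
Qed.

End complex_modulus.

Local Open Scope complex_scope.

Theorem corollary1p11 (R : realType) (d : nat) (hd : (0 < d)%N)
    (lam : R) (hlam : 0 < lam)
    (b0 : R[i]) (hb0 : b0 != 0)
    (a0 : 'I_d -> R[i]) (ha0 : forall j, 0 < complex.Re (a0 j))
    (x0 : 'I_d -> R)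
    (u0 : 'rV[R]_d -> R[i])
    (hu0 : forall x, u0 x =
       b0 * cexp (- (2^-1 * \sum_(j < d) a0 j * ((x 0 j - x0 j) ^+ 2)%:C)))
    (u : R -> 'rV[R]_d -> R[i]) (hu : unique_logNLS_solution lam u0 u)
    (tau dtau : R -> R) (htau : is_tau lam tau dtau)
    (v : R -> 'rV[R]_d -> R[i])
    (hv : forall (t : R) (x : 'rV[R]_d), 0 <= t -> u t x =
       ((tau t `^ (d%:R / 2))^-1)%:C * v t ((tau t)^-1 *: x)
       * (fine (L2norm (lebesgue_rV R d) u0)
          / fine (L2norm (lebesgue_rV R d) (fun y => (gaussian y)%:C)))%:C
       * cexp ((0 +i* 1) * (dtau t / tau t * (sqr_eucl x / 2))%:C)) :
  (\int[lebesgue_rV R d]_y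
     (normc (v t y) ^+ 2 * ln (normc (v t y / (gaussian y)%:C) ^+ 2))%:E)%E
     @[t --> +oo] --> 0%E
  /\
  ('N[lebesgue_rV R d]_1
     [(fun y => (normc (v t y) ^+ 2 - gaussian y ^+ 2)%:E)])%E
     @[t --> +oo] --> 0%E.
Proof.
have [c0 [s [ds [th [sdisp s0 u0w wsol]]]]] := gaussian_solution hlam hb0 ha0 hu0.
have [[_ uL2 _ _] uniq] := hu.
have tdisp := is_tau_dispersive htau.
have [tauoo _] := dispersive_cvgy (lexx 0) hlam tdisp.
have tau0 t : 0 < t -> 0 < tau t by have [h _ _] := tdisp; exact: h.
set w := gaussian_wave c0 x0 s ds th in u0w wsol.
pose rho t j := tau t / s j t; pose m t (j : 'I_d) := x0 j / tau t.
have rho1 j : rho t j @[t --> +oo] --> (1 : R).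
  exact: (dispersive_ratio (lexx 0) ler01 hlam tdisp (sdisp j)).
have m0 j : m t j @[t --> +oo] --> (0 : R).
  rewrite -(mulr0 (x0 j)); apply: cvgM; first exact: cvg_cst.
  by apply/gtr0_cvgV0; [move/cvgryPgt : tauoo; exact|exact: tauoo].
(* Both squared masses contain the same power of [sqrt pi], so the normalising quotient is
   [expR c0], which will cancel [c0] from the amplitude. *)
have KE : fine (L2norm (lebesgue_rV R d) u0)
    / fine (L2norm (lebesgue_rV R d) (fun y => (gaussian y)%:C)) = expR c0.
  rewrite (L2norm_EFin (gaussian_mass d)).
  rewrite (@L2norm_EFin R _ _ _ _ (expR (2 * c0) * Num.sqrt pi ^+ d)); last first.
    rewrite -(wave_mass c0 x0 ds th 0 s0).
    by apply: eq_integral => x _; rewrite u0w.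
  have p0 : 0 < Num.sqrt (Num.sqrt pi ^+ d) :> R.
    by rewrite sqrtr_gt0 exprn_gt0 // sqrtr_gt0 pi_gt0.
  rewrite /= sqrtrM ?expR_ge0 // mulfK ?gt_eqF // mulrC expRM_natr.
  by rewrite sqrtr_sqr gtr0_norm ?expR_gt0.
(* Inverts the change of unknown at [x = tau y]: the quadratic phase has modulus one. This holds for
   every [y], with [u] not yet replaced by the wave. *)
have vE t y : 0 < t ->
    normc (v t y) ^+ 2 = tau t ^+ d * expR (- (2 * c0)) * normc (u t (tau t *: y)) ^+ 2.
  move=> t0; have tn0 : tau t != 0 by rewrite gt_eqF // tau0.
  have pw : (tau t `^ (d%:R / 2)) ^+ 2 = tau t ^+ d.
    rewrite -powR_mulrn ?powR_ge0 // -powRrM divfK ?pnatr_eq0 //.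
    by rewrite powR_mulrn // ltW ?tau0.
  rewrite hv ?(ltW t0) // scalerA mulVf // scale1r KE.
  rewrite sqr_normcM sqr_normc_phase mulr1 !sqr_normcM !sqr_normc_real exprVn pw.
  rewrite -[expR c0 ^+ 2]expRM_natr [c0 * _]mulrC expRN; field.
  by rewrite expf_neq0 // gt_eqF // expR_gt0.
(* Uniqueness replaces [u t] by the wave outside a null set in [x], which the scaling carries to a
   null set in [y]. *)
have v_ae t : 0 < t -> {ae lebesgue_rV R d, forall y,
    normc (v t y) ^+ 2 = expR (profile_log rho m t y)}.
  move=> t0; have tt := tau0 t t0.
  have := ae_scale tt (uniq _ wsol t); apply: filterS => y wu.
  rewrite vE // -wu sqr_normc_wave /logmod /amp /=.
  have -> : tau t ^+ d = expR (\sum_(j < d) ln (tau t)).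
    by rewrite sumr_const card_ord -mulr_natr expRM_natr lnK.
  rewrite -!expRD; congr expR; rewrite /profile_log.
  have -> : \sum_(j < d) ln (rho t j) = \sum_(j < d) ln (tau t) - \sum_(j < d) ln (s j t).
    by rewrite -sumrB; apply: eq_bigr => j _; rewrite ln_div ?posrE.
  have -> : qform (fun j => rho t j ^+ 2) (m t) y = qform (wdt s t) x0 (tau t *: y).
    apply: eq_bigr => j _; rewrite /rho /m /wdt mxE; field.
    by rewrite !gt_eqF.
  by field.
(* Equality almost everywhere does not by itself give measurability, so it is taken from [u t] being
   in [L^2]. *)
have mv t : 0 < t -> measurable_fun setT (fun y => normc (v t y) ^+ 2).
  move=> t0; rewrite (_ : (fun y => _) = fun y =>
    tau t ^+ d * expR (- (2 * c0)) * normc (u t (tau t *: y)) ^+ 2); last first.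
    by apply/funext => y; exact: vE.
  apply: measurable_funM; first exact: measurable_cst.
  have mut := measurable_sqr_normc (uL2.1 t).1.
  exact: (measurableT_comp mut (@measurable_scale R d (tau t))).
have sqv t y : normc (v t y / (gaussian y)%:C) ^+ 2 = normc (v t y) ^+ 2 / gaussian y ^+ 2.
  by rewrite sqr_normcM -fmorphV sqr_normc_real exprVn.
split.
(* For [t > 0] the integrand equals [entropy_density] almost everywhere, so the two integrals
   coincide eventually. *)
- apply: cvg_trans (entropy_density_cvg rho1 m0); apply: near_eq_cvg.
  near=> t; have t0 : 0 < t by near: t; exact: (nbhs_pinfty_gt (num_real _)).
  apply: ae_eq_integral => //.
  + by apply/measurable_EFinP; apply: continuous_measurable_rV; exact: ct_entropy_density.
  + apply/measurable_EFinP; apply: measurable_funM; first exact: mv.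
    apply: (measurableT_comp (@measurable_ln R)); under eq_fun do rewrite sqv.
    apply: measurable_funM; first exact: mv.
    apply: continuous_measurable_rV; apply: ctV => [y|].
      by rewrite expf_neq0 // gt_eqF // expR_gt0.
    apply: ctX; apply: ct_expR; apply: ctN; apply: ctM; last exact: ct_cst.
    exact: ct_sqr_eucl.
  + have := v_ae t t0; apply: filterS => y vy _; congr EFin.
    rewrite sqv vy sqr_gaussian expRN invrK -expRD expRK.
    by [].
- apply: cvg_trans (profile_gap_cvg rho1 m0); apply: near_eq_cvg.
  near=> t; have t0 : 0 < t by near: t; exact: (nbhs_pinfty_gt (num_real _)).
  rewrite Lnorm1; apply: ae_eq_integral => //.
  + by apply/measurable_EFinP; apply: continuous_measurable_rV; exact: ct_profile_gap.
  + apply/measurable_EFinP; apply: measurableT_comp => //.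
    apply: measurable_funB; first exact: mv.
    apply: continuous_measurable_rV; apply: ctX; apply: ct_expR; apply: ctN.
    by apply: ctM; [exact: ct_sqr_eucl|exact: ct_cst].
  + by have := v_ae t t0; apply: filterS => y vy _; rewrite /profile_gap -vy.
Unshelve. all: by end_near. Qed.
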